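(* Let $(Y,d_Y,\mu_Y)$ be a metric measure space (in the sense of the context) such that $(Y,d_Y)$ is a length space and $\mu_Y(Y)<\infty$, and let $\alpha,\beta$ be two fixed positive real numbers. Suppose also that $Y$ is an $\infty$-weak local $(p,p)$-Poincaré space for some $p$ with $1\le p<\infty$. (a) If $p\le \beta/\alpha$, then the metric measure spaces $\mathbb{H}^{\circ}_{\alpha,\beta}(Y)$ and $\mathbb{H}_{\alpha,\beta}(Y)$ are $(p,p)$-Sobolev--Poincaré spaces with a constant $C=C(\beta,p)$ depending only on $\beta$ and $p$, and consequently $$D^{1,p}(\mathbb{H}^{\circ}_{\alpha,\beta}(Y)) = N^{1,p}(\mathbb{H}^{\circ}_{\alpha,\beta}(Y))+\mathbb{R},\qquad (\ast)$$ $$D^{1,p}(\mathbb{H}_{\alpha,\beta}(Y)) = N^{1,p}(\mathbb{H}_{\alpha,\beta}(Y))+\mathbb{R}.\qquad (\ast\ast)$$ (b) If $p>\beta/\alpha$ and $Y$ has at least two points, then $(\ast)$ and $(\ast\ast)$ fail to hold.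
   Context: **Metric measure spaces.** A metric measure space is a triple $(Z,d_Z,\mu_Z)$ where $(Z,d_Z)$ is a non-empty separable metric space, $\mu_Z$ is a Borel regular outer measure on $Z$ (defined on all subsets; measurable sets are those satisfying Carathéodory's criterion; Borel sets are measurable; $\mu_Z(A)=\inf\{\mu_Z(F): F\supset A \text{ Borel}\}$ for all $A\subset Z$), and $0<\mu_Z(B)<\infty$ for all (open) balls $B\subset Z$. Write $u_B$ for the $\mu_Z$-average of $u$ over $B$. **Paths.** A path in a (pseudo)metric space $(Z,d_Z)$ is a continuous map $\gamma:[a,b]\to Z$; $\operatorname{len}_{d_Z}(\gamma)$ is the supremum of $\sum_i d_Z(\gamma(t_{i-1}),\gamma(t_i))$ over partitions; $\gamma$ is rectifiable if this is finite, and a rectifiable $\gamma$ is absolutely continuous if $t\mapsto \operatorname{len}_{d_Z}(\gamma|_{[a,t]})$ is absolutely continuous. The metric speed is $|\gamma'(t)|=\lim_{u\to t} d_Z(\gamma(u),\gamma(t))/|u-t|$, which exists for a.e. $t$ if $\gamma$ is absolutely continuous. For Borel $\rho\ge 0$, $\int_\gamma\rho\,ds=\int\rho(\tilde\gamma(t))|\tilde\gamma'(t)|\,dt$ for any absolutely continuous reparametrization $\tilde\gamma$ of $\gamma$. $(Z,d_Z)$ is a length space if any two points are joined by a rectifiable path and $d_Z(x,y)$ is the infimum of lengths of rectifiable paths from $x$ to $y$. **Function spaces.** For measurable $u:Z\to[-\infty,\infty]$, a Borel function $g:Z\to[0,\infty]$ is an upper gradient of $u$ if $|u(\gamma(b))-u(\gamma(a))|\le\int_\gamma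 g\,ds$ for each non-constant absolutely continuous curve $\gamma:[a,b]\to Z$. A function is integrable over balls if it is in $L^1(B,\mu_Z)$ for every ball $B$. $D^{1,p}(Z)$ is the set of measurable $u:Z\to[-\infty,\infty]$ that are integrable over balls and have an upper gradient $g\in L^p(Z,\mu_Z)$. $N^{1,p}(Z)$ is the set of $u\in D^{1,p}(Z)$ with $\int_Z|u|^p\,d\mu_Z<\infty$. $N^{1,p}(Z)+\mathbb{R}$ is the set of functions $v+c$ with $v\in N^{1,p}(Z)$, $c\in\mathbb{R}$ constant. **Poincaré conditions.** $Z$ is a $(p,q)$-Sobolev--Poincaré space with constant $C>0$ if for all $u\in D^{1,q}(Z)$ and all upper gradients $g\in L^q(Z)$ of $u$ there is $c_u\in\mathbb{R}$ with $\|u-c_u\|_{L^p(Z,\mu_Z)}\le C\|g\|_{L^q(Z,\mu_Z)}$. $Z$ is an $\infty$-weak local $(p,q)$-Poincaré space if for every $x\in Z$ there are $C_x,r_x>0$ such that for every $u$ that is integrable over balls and every upper gradient $g$ of $u$ on $Z$, $\|u-u_{B_Z(x,r_x)}\|_{L^p(B_Z(x,r_x),\mu_Z)}\le C_x\|g\|_{L^q(Z,\mu_Z)}$. **Warped products.** Fix a norm $\|\cdot\|$ on $\mathbb{R}^2$ that is unitary ($\|(1,0)\|=\|(0,1)\|=1$) and coordinate-increasing ($\|(a,c)\|\le\|(b,d)\|$ whenever $0\le a\le b$, $0\le c\le d$); the choice is arbitrary. For length spaces $X,Y$ and continuous $\varphi:X\to[0,\infty)$, and for a path $\gamma=(\gamma_X,\gamma_Y):[a,b]\to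 X\times Y$ absolutely continuous with respect to the $\ell^1$-product metric, set $\ell_\varphi(\gamma)=\int_a^b\|(|\gamma_X'(t)|,\varphi(\gamma_X(t))|\gamma_Y'(t)|)\|\,dt$. Let $d_\varphi((x,y),(x',y'))=\inf_\gamma\ell_\varphi(\gamma)$ over absolutely continuous paths from $(x,y)$ to $(x',y')$ (a pseudometric). $X\times_\varphi Y$ is the quotient of $X\times Y$ identifying points at $d_\varphi$-distance $0$, with the induced metric $d_\varphi$, and $P_\varphi:X\times Y\to X\times_\varphi Y$ is the projection. If $\mu_X,\mu_Y$ are measures on $X,Y$, then $X\times_\varphi Y$ carries $\mu_\varphi(A)=(\mu_X\times\mu_Y)(P_\varphi^{-1}(A))$, where $\mu_X\times\mu_Y$ is the product outer measure. **Solid hyperbolic fillings.** $\mathbb{H}^\circ_{\alpha,\beta}(Y)=([0,\infty),d_{\mathrm{Eucl}},e^{\beta t}\,dt)\times_{\varphi_\alpha}(Y,d_Y,\mu_Y)$ with $\varphi_\alpha(t)=e^{\alpha t}$, and $\mathbb{H}_{\alpha,\beta}(Y)=([0,\infty),d_{\mathrm{Eucl}},\sinh^\beta(t)\,dt)\times_{\psi_\alpha}(Y,d_Y,\mu_Y)$ with $\psi_\alpha(t)=\sinh^\alpha(t)$. *)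

(* Defs.v *)
From HB Require Import structures.
From mathcomp Require Import all_boot all_order all_algebra.
From mathcomp Require Import all_classical all_reals all_analysis measurable_realfun.
Set Implicit Arguments.
Unset Strict Implicit.
Unset Printing Implicit Defensive.
Import Order.TTheory GRing.Theory Num.Theory.
Import numFieldNormedType.Exports.
Local Open Scope classical_set_scope.
Local Open Scope ring_scope.

#[short(type="pmetricType")]
HB.structure Definition PointedMetric (K : numDomainType) :=
  { M of Metric K M & Pointed M }.

(* The triple (Z, d, mu), as raw data. The distance is not bundled as a
   metricType because the notions below are also needed for pseudometrics and
   for warped products, whose metric axioms hold only under hypotheses on the
   factors. *)
Record mmspace (R : realType) := MMSpace {
  carrier :> pointedType ;
  mmdist : carrier -> carrier -> R ;
  mmeas : {outer_measure set carrier -> \bar R} }.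

Definition mms_of_metric (R : realType) (Y : pmetricType R)
    (mu : {outer_measure set Y -> \bar R}) : mmspace R :=
  @MMSpace R Y (@mdist R Y) mu.

Definition metric_measure_space (R : realType) (Y : pmetricType R)
    (mu : {outer_measure set Y -> \bar R}) : Prop :=
  [/\ exists2 D : set Y, countable D & dense D,
      forall A : set Y, <<s open >> A -> mu.-caratheodory A,
      forall A : set Y,
        mu A = ereal_inf [set mu F | F in [set F | <<s open >> F /\ A `<=` F]]
    & forall (x : Y) (r : R), 0 < r -> (0 < mu (ball x r) < +oo)%E].

Section paths.
Context {R : realType} {T : Type} (d : T -> T -> R).
Implicit Types (g : R -> T) (a b : R).

(* A path [a, b] -> T is represented by a total function R -> T, only the
   values on [a, b] being relevant. *)
Definition is_path g a b : Prop :=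
  a <= b /\
  forall t, t \in `[a, b] -> forall e : R, 0 < e ->
    exists2 dl : R, 0 < dl &
      forall u, u \in `[a, b] -> `|u - t| < dl -> d (g t) (g u) < e.

Definition path_variation g a b (s : seq R) : R :=
  \sum_(0 <= n < size s) d (g (nth b (a :: s) n)) (g (nth b (a :: s) n.+1)).

Definition path_length g a b : \bar R :=
  ereal_sup [set (path_variation g a b s)%:E | s in itv_partition a b].

Definition rectifiable g a b : Prop :=
  is_path g a b /\ (path_length g a b < +oo)%E.

Definition absolutely_continuous_on (f : R -> R) a b : Prop :=
  forall e : R, 0 < e -> exists2 dl : R, 0 < dl &
    forall (n : nat) (s t : 'I_n -> R),
      (forall i, a <= s i /\ s i <= t i /\ t i <= b) ->
      trivIset setT (fun i => [set` `]s i, t i[ ]) ->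
      \sum_i (t i - s i) < dl ->
      \sum_i `|f (t i) - f (s i)| < e.

Definition ac_path g a b : Prop :=
  rectifiable g a b /\
  absolutely_continuous_on (fun t => fine (path_length g a t)) a b.

(* The values of g outside [a, b] affect the speed on [a, b] at the endpoints
   only, hence no integral over [a, b]. Where the limit does not exist, lim
   returns a fixed default value. *)
Definition metric_speed g (t : R) : R :=
  lim (d (g u) (g t) / `|u - t| @[u --> t^']).

(* An absolutely continuous path is one of its own absolutely continuous
   reparametrizations. *)
Definition path_integral (rho : T -> \bar R) g a b : \bar R :=
  (\int[@lebesgue_measure R]_(t in `[a, b]) (rho (g t) * (metric_speed g t)%:E))%E.

Definition length_space : Prop :=
  (forall x y, exists g a b, [/\ rectifiable g a b, g a = x & g b = y]) /\
  forall x y, (d x y)%:E = ereal_inf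
    [set l | exists g a b,
       [/\ rectifiable g a b, g a = x, g b = y & l = path_length g a b]].

End paths.

Section function_spaces.
Context {R : realType} (Z : mmspace R).
Implicit Types (u g : Z -> \bar R) (A B : set Z) (p q : R).
Local Open Scope ereal_scope.

Definition mmball (x : Z) (r : R) : set Z := [set y | (mmdist x y < r)%R].

Definition mmopen (U : set Z) : Prop :=
  forall x, U x -> exists2 r : R, (0 < r)%R & mmball x r `<=` U.

Definition measurable_on A u : Prop :=
  @measurable_fun _ _ (caratheodory_type (mmeas Z)) _ A u.

Definition borel_function g : Prop :=
  @measurable_fun _ _ (g_sigma_algebraType mmopen) _ setT g.

Definition mm_integral A u : \bar R :=
  @integral _ (caratheodory_type (mmeas Z)) R (mmeas Z) A u.

Definition mm_integrable A u : Prop :=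
  @integrable _ (caratheodory_type (mmeas Z)) R (mmeas Z) A u.

Definition Lp_norm p A u : \bar R :=
  @Lnorm _ (caratheodory_type (mmeas Z)) R (mmeas Z) p%:E (u \_ A).

Definition integrable_over_balls u : Prop :=
  forall (x : Z) (r : R), (0 < r)%R -> mm_integrable (mmball x r) u.

Definition ball_average u A : R :=
  (fine (mm_integral A u) / fine (mmeas Z A))%R.

(* With the conventions of \bar R, the left-hand side of the inequality is
   +oo as soon as u is infinite at one of the endpoints, including when the
   difference is of the form oo - oo. *)
Definition upper_gradient g u : Prop :=
  [/\ borel_function g, forall x, 0 <= g x &
    forall (c : R -> Z) (a b : R), ac_path (@mmdist R Z) c a b ->
      (exists s t, [/\ s \in `[a, b], t \in `[a, b] & c s <> c t])%R ->
      `| u (c b) - u (c a) | <= path_integral (@mmdist R Z) g c a b].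

Definition dirichlet_space p : set (Z -> \bar R) :=
  [set u | [/\ measurable_on setT u, integrable_over_balls u &
     exists2 g, upper_gradient g u & Lp_norm p setT g < +oo]].

Definition newtonian_space p : set (Z -> \bar R) :=
  [set u | dirichlet_space p u /\ mm_integral setT (fun x => `|u x| `^ p) < +oo].

Definition newtonian_plus_constants p : set (Z -> \bar R) :=
  [set u | exists v (c : R), newtonian_space p v /\ u = (fun x => v x + c%:E)].

Definition sobolev_poincare p q (C : R) : Prop :=
  forall u g, dirichlet_space q u -> upper_gradient g u -> Lp_norm q setT g < +oo ->
    exists c : R,
      Lp_norm p setT (fun x => u x - c%:E) <= C%:E * Lp_norm q setT g.

Definition weak_local_poincare p q : Prop :=
  forall x : Z, exists C r : R, [/\ (0 < C)%R, (0 < r)%R &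
    forall u g, integrable_over_balls u -> upper_gradient g u ->
      Lp_norm p (mmball x r) (fun y => u y - (ball_average u (mmball x r))%:E)
      <= C%:E * Lp_norm q setT g].

End function_spaces.

Arguments dirichlet_space {R} Z p _.
Arguments newtonian_space {R} Z p _.
Arguments newtonian_plus_constants {R} Z p _.

Lemma mmopenE (R : realType) (Y : pmetricType R)
    (mu : {outer_measure set Y -> \bar R}) :
  @mmopen R (mms_of_metric mu) = (@open Y).
Proof.
apply/funext => U; apply/propext; split=> [Uo|].
  rewrite openE => x /Uo[r r0 rU]; apply/nbhs_ballP.
  by exists r => //; rewrite ballEmdist.
rewrite openE => Uo x /Uo/nbhs_ballP[r r0 rU]; exists r => //.
by move: rU; rewrite ballEmdist.
Qed.

(* The metric space associated with a pseudometric d: its points are the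
   classes of points at distance 0, and the distance is computed on
   representatives. *)
Definition mquot (R : realType) (T : pointedType) (d : T -> T -> R) : Type :=
  {A : set T | exists z, A = [set z' | d z z' = 0]}.

Section mquot.
Context {R : realType} {T : pointedType} (d : T -> T -> R).

Definition mquot_pi (z : T) : mquot d :=
  exist _ [set z' | d z z' = 0] (ex_intro _ z erefl).

HB.instance Definition _ := gen_eqMixin (mquot d).
HB.instance Definition _ := gen_choiceMixin (mquot d).
HB.instance Definition _ := isPointed.Build (mquot d) (mquot_pi point).

Definition mquot_dist (a b : mquot d) : R := d (get (sval a)) (get (sval b)).

End mquot.

Section pushforward_outer_measure.
Context {R : realType} {T U : Type} (f : T -> U)
  (mu : {outer_measure set T -> \bar R}).

Definition pushforward_outer (A : set U) : \bar R := mu (f @^-1` A).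

Let pushforward_outer0 : pushforward_outer set0 = 0%E.
Proof. by rewrite /pushforward_outer preimage_set0 outer_measure0. Qed.

Let pushforward_outer_ge0 A : (0 <= pushforward_outer A)%E.
Proof. exact: outer_measure_ge0. Qed.

Let le_pushforward_outer :
  {homo pushforward_outer : A B / A `<=` B >-> (A <= B)%E}.
Proof. by move=> A B AB; apply: le_outer_measure => x /AB. Qed.

Let pushforward_outer_sigma_subadditive : sigma_subadditive pushforward_outer.
Proof.
by move=> F; rewrite /pushforward_outer preimage_bigcup;
  exact: outer_measure_sigma_subadditive.
Qed.

HB.instance Definition _ := isOuterMeasure.Build R U pushforward_outer
  pushforward_outer0 pushforward_outer_ge0 le_pushforward_outer
  pushforward_outer_sigma_subadditive.

End pushforward_outer_measure.

Section product_outer_measure.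
Context {R : realType} {X Y : Type}
  (muX : {outer_measure set X -> \bar R})
  (muY : {outer_measure set Y -> \bar R}).
Local Open Scope ereal_scope.

Definition rectangle_cover (S : set (X * Y)) : set (nat -> set X * set Y) :=
  [set F | (forall k, muX.-caratheodory (F k).1 /\ muY.-caratheodory (F k).2) /\
           S `<=` \bigcup_k ((F k).1 `*` (F k).2)].

Definition product_outer (S : set (X * Y)) : \bar R :=
  ereal_inf [set \sum_(k <oo) (muX (F k).1 * muY (F k).2)
            | F in rectangle_cover S].

Let weight (F : set X * set Y) := muX F.1 * muY F.2.

Let weight_ge0 F : 0 <= weight F.
Proof. by apply: mule_ge0; exact: outer_measure_ge0. Qed.

Let product_outer_ge0 S : 0 <= product_outer S.
Proof.
apply: le_ereal_inf_tmp => x [F _ <-{x}].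
by apply: nneseries_ge0 => n _ _; exact: weight_ge0.
Qed.

Let product_outer0 : product_outer set0 = 0.
Proof.
apply/eqP; rewrite eq_le product_outer_ge0 andbT.
apply: ereal_inf_lbound; exists (fun=> (set0, set0)).
  split=> [k|]; last exact: sub0set.
  by split=> /=; exact: caratheodory_measurable_set0.
by rewrite eseries0// => n _ _ /=; rewrite outer_measure0 mul0e.
Qed.

Let le_product_outer : {homo product_outer : A B / A `<=` B >-> A <= B}.
Proof.
move=> A B AB; apply/ereal_inf_le_tmp => x [F [mF BF]] <-{x}.
by exists F => //; split => //; exact: subset_trans AB BF.
Qed.

Let product_outer_sigma_subadditive : sigma_subadditive product_outer.
Proof.
move=> A; have [[i ioo]|] := pselect (exists i, product_outer (A i) = +oo).
  rewrite (eseries_pinfty _ _ ioo) ?leey// => n _.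
  by rewrite -ltNye (lt_le_trans _ (product_outer_ge0 _)).
rewrite -forallNE => Aoo.
suff add2e (e : {posnum R}) : product_outer (\bigcup_n A n) <=
    \sum_(i <oo) product_outer (A i) + e%:num%:E.
  by apply/lee_addgt0Pr => _/posnumP[].
rewrite (le_trans _ (epsilon_trick _ _ _))//.
pose P n (F : nat -> set X * set Y) := rectangle_cover (A n) F /\
  \sum_(k <oo) weight (F k) <=
    product_outer (A n) + (e%:num / (2 ^ n.+1)%:R)%:E.
have [G PG] : {G : nat -> nat -> set X * set Y & forall n, P n (G n)}.
  apply: (@choice _ _ P) => n; rewrite /P /product_outer.
  set S := (X in ereal_inf X); move infS : (ereal_inf S) => iS.
  case: iS infS => [r Sr|Soo|Soo].
  - have en1 : (0 < e%:num / (2 ^ n.+1)%:R)%R by [].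
    have /(lb_ereal_inf_adherent en1) : ereal_inf S \is a fin_num by rewrite Sr.
    move=> [x [B AB muBx] xS].
    by exists B; split => //; rewrite muBx -Sr; exact/ltW.
  - by have := Aoo n; rewrite /product_outer Soo.
  - suff : lbound S 0 by move/le_ereal_inf_tmp; rewrite Soo.
    by move=> /= _ [B _ <-]; apply: nneseries_ge0 => k _ _; exact: weight_ge0.
have muG_ge0 x : 0 <= (weight \o uncurry G) x by exact: weight_ge0.
apply: (@le_trans _ _ (\esum_(i in setT) (weight \o uncurry G) i)).
  apply: ereal_inf_lbound => /=.
  have /card_esym/ppcard_eqP[f] := card_nat2.
  exists (uncurry G \o f).
    split => [i|t [n _ /(PG n).1.2[k _ Gk]]].
      by rewrite /= /uncurry; case: (f i) => n k; exact: (PG n).1.1.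
    by exists (f^-1%FUN (n, k)) => //=; rewrite invK ?inE.
  rewrite -(esum_pred_image (weight \o uncurry G) _ xpredT) ?[fun=> _]set_true//.
  by rewrite image_eq.
rewrite (_ : esum _ _ = \sum_(i <oo) \sum_(j <oo) weight (G i j)); last first.
  pose J : nat -> set (nat * nat) := fun i => [set (i, j) | j in setT].
  rewrite (_ : setT = \bigcup_k J k); last first.
    by rewrite predeqE => -[a b]; split => // _; exists a => //; exists b.
  rewrite esum_bigcupT /=; last 2 first.
    - apply/trivIsetP => i j _ _ ij.
      rewrite predeqE => -[n m] /=; split => //= -[] [_] _ [<-{n} _].
      by move=> [m' _] [] /esym/eqP; rewrite (negbTE ij).
    - by move=> [n m]; exact: muG_ge0.
  rewrite -(image_id [set: nat]) -fun_true esum_pred_image//; last first.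
    by move=> n _; exact: esum_ge0.
  apply: eq_eseriesr => /= j _.
  rewrite -(esum_pred_image (weight \o uncurry G) (pair j) predT)//=; last first.
    by move=> ? ? _ _; exact: (@can_inj _ _ _ snd).
  by congr esum; rewrite predeqE => -[a b]; split; move=> [i _ <-]; exists i.
apply: lee_lim.
- apply: is_cvg_nneseries => n *.
  by apply: nneseries_ge0 => m *; exact: (muG_ge0 (n, m)).
- by apply: is_cvg_nneseries => n *; apply: adde_ge0.
- by near=> n; apply: lee_sum => i _; exact: (PG i).2.
Unshelve. all: by end_near. Qed.

HB.instance Definition _ := isOuterMeasure.Build R (X * Y)%type product_outer
  product_outer0 product_outer_ge0 le_product_outer
  product_outer_sigma_subadditive.

End product_outer_measure.

Record warping_norm (R : realType) (N : R * R -> R) : Prop := WarpingNorm {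
  wnorm_triangle : forall v w, N (v + w) <= N v + N w ;
  wnorm_homogeneous : forall (k : R) v, N (k * v.1, k * v.2) = `|k| * N v ;
  wnorm_definite : forall v, N v = 0 -> v = (0, 0) ;
  wnorm_unitary : N (1, 0) = 1 /\ N (0, 1) = 1 ;
  wnorm_increasing : forall a b c d : R,
    0 <= a -> a <= b -> 0 <= c -> c <= d -> N (a, c) <= N (b, d) }.

Section warped_product.
Context {R : realType} (N : R * R -> R) {X Y : pmetricType R}
  (muX : {outer_measure set X -> \bar R})
  (muY : {outer_measure set Y -> \bar R})
  (phi : X -> R).

Definition l1_dist (z z' : X * Y) : R := mdist z.1 z'.1 + mdist z.2 z'.2.

Definition warped_length (c : R -> X * Y) (a b : R) : \bar R :=
  (\int[@lebesgue_measure R]_(t in `[a, b])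
     (N (metric_speed (@mdist R X) (fst \o c) t,
         phi (c t).1 * metric_speed (@mdist R Y) (snd \o c) t))%:E)%E.

Definition warped_pdist (z z' : X * Y) : R :=
  fine (ereal_inf [set l | exists c a b,
    [/\ ac_path l1_dist c a b, c a = z, c b = z' & l = warped_length c a b]]).

Definition warped_proj : X * Y -> mquot warped_pdist :=
  @mquot_pi R (X * Y)%type warped_pdist.

Definition warped_product : mmspace R :=
  @MMSpace R (mquot warped_pdist) (@mquot_dist _ _ warped_pdist)
    (pushforward_outer warped_proj (product_outer muX muY)).

End warped_product.

Definition halfline (R : realType) : Type := {t : R | 0 <= t}.

Section halfline.
Context {R : realType}.

HB.instance Definition _ := gen_eqMixin (halfline R).
HB.instance Definition _ := gen_choiceMixin (halfline R).
HB.instance Definition _ := isPointed.Build (halfline R) (exist _ 0 (lexx 0)).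

Definition halfline_dist (s t : halfline R) : R := `|sval s - sval t|.

Let halfline_distxx s : halfline_dist s s = 0.
Proof. by rewrite /halfline_dist subrr normr0. Qed.

Let halfline_dist_positivity s t : halfline_dist s t = 0 -> s = t.
Proof.
move=> /normr0_eq0/eqP; rewrite subr_eq0 => /eqP st.
by apply: eq_sig_hprop => // x; exact: bool_irrelevance.
Qed.

Let halfline_dist_sym s t : halfline_dist s t = halfline_dist t s.
Proof. exact: distrC. Qed.

Let halfline_dist_triangle s t u :
  halfline_dist t u <= halfline_dist t s + halfline_dist s u.
Proof. exact: ler_distD. Qed.

HB.instance Definition _ := @isMetric.Build R (halfline R) halfline_dist
  halfline_distxx halfline_dist_positivity halfline_dist_sym
  halfline_dist_triangle.

End halfline.

(* The Borel regular outer measure w(t) dt on [0, +oo): mu_ext extends the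
   measure F |-> \int_F w from the Borel sets of R to all sets. *)
Section weighted_halfline_measure.
Context {R : realType} (w : {nnfun R >-> R}).
Local Open Scope ereal_scope.

Definition weighted_lebesgue (F : set R) : \bar R :=
  \int[@lebesgue_measure R]_(t in F) (w t)%:E.

Definition weighted_outer (A : set (halfline R)) : \bar R :=
  mu_ext weighted_lebesgue (sval @` A).

Let density0 : weighted_lebesgue set0 = 0.
Proof. exact: integral_set0. Qed.

Let density_ge0 F : 0 <= weighted_lebesgue F.
Proof. by apply: integral_ge0 => t _; rewrite lee_fin. Qed.

Let weighted_outer0 : weighted_outer set0 = 0.
Proof. by rewrite /weighted_outer image_set0 (mu_ext0 density0 density_ge0). Qed.

Let weighted_outer_ge0 A : 0 <= weighted_outer A.
Proof. exact: (mu_ext_ge0 density_ge0). Qed.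

Let le_weighted_outer : {homo weighted_outer : A B / A `<=` B >-> A <= B}.
Proof. by move=> A B AB; apply: le_mu_ext; exact: image_subset. Qed.

Let weighted_outer_sigma_subadditive : sigma_subadditive weighted_outer.
Proof.
move=> F; rewrite /weighted_outer image_bigcup.
exact: (mu_ext_sigma_subadditive density_ge0).
Qed.

HB.instance Definition _ := isOuterMeasure.Build R (halfline R) weighted_outer
  weighted_outer0 weighted_outer_ge0 le_weighted_outer
  weighted_outer_sigma_subadditive.

End weighted_halfline_measure.

Definition sinh (R : realType) (t : R) : R := (expR t - expR (- t)) / 2.

Section weights.
Context {R : realType} (beta : R).

Definition exp_weight (t : R) : R := expR (beta * t).

Definition sinh_weight (t : R) : R := sinh t `^ beta.

Let exp_weight_ge0 t : 0 <= exp_weight t.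
Proof. exact: expR_ge0. Qed.

Let sinh_weight_ge0 t : 0 <= sinh_weight t.
Proof. exact: powR_ge0. Qed.

HB.instance Definition _ := isNonNegFun.Build R R exp_weight exp_weight_ge0.
HB.instance Definition _ := isNonNegFun.Build R R sinh_weight sinh_weight_ge0.

End weights.

Definition solid_filling_exp (R : realType) (N : R * R -> R) (alpha beta : R)
    (Y : pmetricType R) (muY : {outer_measure set Y -> \bar R}) : mmspace R :=
  warped_product N (weighted_outer (exp_weight beta)) muY
    (fun t : halfline R => exp_weight alpha (sval t)).

Definition solid_filling_sinh (R : realType) (N : R * R -> R) (alpha beta : R)
    (Y : pmetricType R) (muY : {outer_measure set Y -> \bar R}) : mmspace R :=
  warped_product N (weighted_outer (sinh_weight beta)) muY
    (fun t : halfline R => sinh_weight alpha (sval t)).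

(* Main.v *)
Require Import Defs.
From HB Require Import structures.
From mathcomp Require Import all_boot all_order all_algebra.
From mathcomp Require Import all_classical all_reals all_analysis measurable_realfun.
From mathcomp Require Import ring lra.
Set Implicit Arguments.
Unset Strict Implicit.
Unset Printing Implicit Defensive.
Import Order.TTheory GRing.Theory Num.Theory.
Import numFieldNormedType.Exports.
Local Open Scope classical_set_scope.
Local Open Scope ring_scope.

(** Both fillings are half-lines [0, oo) warped over Y, with a warping function
W = omega^alpha and a density w = omega^beta, where omega is exp or sinh. Of
these only a few features matter ([exponential_profile]): W and w grow like
e^{alpha t} and e^{beta t}, and w t <= e^{- beta (s - t)} w s for t <= s.

Why the inequality holds when p <= beta / alpha. Let g be an upper gradient of
u. A vertical ray t |-> (t, y) has speed at most 1 ([vertical_gradient]), so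
u (., y) oscillates on [t, oo) by at most the tail F (t, y) of the integral of
g (., y). The growth of w makes Hardy's inequality applicable ([hardy]): the
p-th power of F has a w-integral at most (p / beta)^p times that of g. Hence u
is, on almost every ray, within F of its limit V (y) at infinity, and it is
enough to see that V is constant. Slices are used for this. On the slice over
t the function u has the upper gradient W t g (t, .) ([slice_upper_gradient]),
whose p-th power has integral at most W(t)^p B(t) <= w(t) B(t) for large t,
where B is the integral of g^p over the slice; as w B is integrable, these
energies tend to 0 along some sequence of heights ([good_height]). The weak
local Poincare inequality on Y, applied to u composed with a bounded injective
contraction, then makes V constant almost everywhere on small balls
([local_limit]), and V is constant because Y is connected by paths
([ae_limit_constant]). The equality of function spaces follows, since constants
are integrable on balls and do not affect upper gradients.

Why the equality fails when p > beta / alpha. The function that equals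
min (1, d (y0, y)) far away and 0 near the root does not tend to a constant at
infinity, while points at height t and at distance d from each other have second
coordinates at distance O(d e^{- alpha t}) ([bump_local]). So e^{- alpha t} is,
up to a constant, an upper gradient ([u_gradient]), and its p-th power is
integrable against e^{beta t} exactly when alpha p > beta.

Two technical points take most of the space. An upper gradient is tested on
absolutely continuous paths, for the Lebesgue integral of the metric speed. A
path is absolutely continuous if and only if its increments are bounded by those
of an absolutely continuous real function ([dominated]), in which form the
property passes to products, restrictions and images under Lipschitz maps; that
distances are at most the integral of the speed is [dist_le_integral]. And the
measure on the filling is an outer measure on all subsets, whose measurable sets
need not belong to the product sigma-algebra; their slices are measurable only
almost everywhere ([measurable_sections]), which is the reason for choosing the
heights among almost all of them. *)

(** * Absolutely continuous paths *)

Section interval_families.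
Context {R : realType}.
Implicit Types (f : R -> R) (a b s t : R).

(** A bound on all increments, the form in which lengths, absolute continuity
and speeds are handled. *)
Definition dominated {T : Type} (d : T -> T -> R) (g : R -> T) f a b :=
  forall s t, a <= s -> s <= t -> t <= b -> d (g s) (g t) <= f t - f s.

Definition pseudometric {T : Type} (d : T -> T -> R) : Prop :=
  [/\ forall x, d x x = 0, forall x y, d x y = d y x &
      forall x y z, d x z <= d x y + d y z].

Lemma pseudometric_ge0 (T : Type) (d : T -> T -> R) x y :
  pseudometric d -> 0 <= d x y.
Proof.
by move=> [dxx dC dT]; have := dT x y x; rewrite dxx (dC y x); lra.
Qed.

Lemma mdist_pseudometric (T : pmetricType R) : pseudometric (@mdist R T).
Proof.
by split; [exact: mdistxx|exact: metric_sym|exact: metric_triangle].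
Qed.

Lemma real_pseudometric : pseudometric (fun x y : R => `|y - x|).
Proof.
split=> [x|x y|x y z]; first by rewrite subrr normr0.
  exact: distrC.
by rewrite -[z - x](subrKA y) [leRHS]addrC ler_normD.
Qed.

Lemma dominated_le (T : Type) (d : T -> T -> R) g f a b :
  pseudometric d -> dominated d g f a b ->
  forall s t, a <= s -> s <= t -> t <= b -> f s <= f t.
Proof.
move=> dP dom s t sa st tb; have := dom _ _ sa st tb.
by have := pseudometric_ge0 (g s) (g t) dP; lra.
Qed.

Lemma acont_uniform f a b : absolutely_continuous_on f a b ->
  forall e, 0 < e -> exists2 dl, 0 < dl &
    forall s t, a <= s -> s <= t -> t <= b -> t - s < dl -> `|f t - f s| < e.
Proof.
move=> fac e e0; have [dl dl0 H] := fac e e0; exists dl => // s t sa st tb stl.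
have := H 1%N (fun=> s) (fun=> t); rewrite !big_ord1; apply => //.
by move=> i j _ _ _; rewrite !ord1.
Qed.

Lemma trivIset_oo n (s t s' t' : 'I_n -> R) :
  (forall i j x, i != j -> `]s' i, t' i[%classic x -> `]s' j, t' j[%classic x ->
    exists2 z, `]s i, t i[%classic z & `]s j, t j[%classic z) ->
  trivIset setT (fun i => [set` `]s i, t i[ ]) ->
  trivIset setT (fun i => [set` `]s' i, t' i[ ]).
Proof.
move=> H tr i j _ _ [x [xi xj]]; apply/eqP/negPn/negP => ij.
have [z zi zj] := H i j x ij xi xj.
by move/eqP: ij; apply; apply: tr => //; exists z.
Qed.

(** A nondecreasing contraction sends disjoint intervals to disjoint intervals
of smaller total length. *)
Lemma acont_comp (f sg : R -> R) a b a' b' :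
  absolutely_continuous_on f a b ->
  (forall s, a' <= s <= b' -> a <= sg s <= b) ->
  (forall s t, a' <= s -> s <= t -> t <= b' -> 0 <= sg t - sg s <= t - s) ->
  absolutely_continuous_on (f \o sg) a' b'.
Proof.
move=> fac sgab sgL e e0; have [dl dl0 H] := fac e e0; exists dl => // n s t st tr sm.
apply: H.
- move=> i; have [h1 [h2 h3]] := st i.
  have := sgL _ _ h1 h2 h3; have := sgab (s i); have := sgab (t i); lra.
- apply: (trivIset_oo _ tr) => i j x ij /=; rewrite !in_itv/=.
  move=> /andP[xi1 xi2] /andP[xj1 xj2].
  have lt_of k l : sg (s k) < x -> x < sg (t l) -> s k < t l.
    move=> h1 h2; rewrite ltNge; apply/negP => h3.
    have [hk1 [hk2 hk3]] := st k; have [hl1 [hl2 hl3]] := st l.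
    by have := sgL (t l) (s k) (le_trans hl1 hl2) h3 (le_trans hk2 hk3); lra.
  have h1 := lt_of i i xi1 xi2; have h2 := lt_of j j xj1 xj2.
  have h3 := lt_of i j xi1 xj2; have h4 := lt_of j i xj1 xi2.
  pose m := Num.max (s i) (s j); pose M := Num.min (t i) (t j).
  have mM : m < M by rewrite lt_min !gt_max h1 h2 h3 h4.
  exists ((m + M) / 2) => /=; rewrite in_itv/=.
  - have : s i <= m by rewrite le_max lexx.
    have : M <= t i by rewrite ge_min lexx.
    lra.
  - have : s j <= m by rewrite le_max lexx orbT.
    have : M <= t j by rewrite ge_min lexx orbT.
    lra.
- apply: le_lt_trans sm; apply: ler_sum => i _.
  by have [h1 [h2 h3]] := st i; have := sgL _ _ h1 h2 h3; lra.
Qed.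

Lemma acont_opp f a b : absolutely_continuous_on f a b ->
  absolutely_continuous_on (fun x => - f (- x)) (- b) (- a).
Proof.
move=> fac e e0; have [dl dl0 H] := fac e e0; exists dl => // n s t st tr sm.
rewrite (eq_bigr (fun i => `|f (- s i) - f (- t i)|)); last first.
  by move=> i _; congr `|_|; ring.
apply: H.
- by move=> i; have := st i; lra.
- apply: (trivIset_oo _ tr) => i j x ij /=; rewrite !in_itv/=.
  by move=> xi xj; exists (- x); rewrite /= in_itv/=; lra.
- by rewrite (eq_bigr (fun i => t i - s i)) // => i _; ring.
Qed.

Lemma acont_sum_le (f1 f2 f : R -> R) a b :
  absolutely_continuous_on f1 a b -> absolutely_continuous_on f2 a b ->
  (forall s t, a <= s -> s <= t -> t <= b ->
    `|f t - f s| <= `|f1 t - f1 s| + `|f2 t - f2 s|) ->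
  absolutely_continuous_on f a b.
Proof.
move=> ac1 ac2 fle e e0; have e20 : 0 < e / 2 by lra.
have [d1 d10 H1] := ac1 _ e20; have [d2 d20 H2] := ac2 _ e20.
exists (Num.min d1 d2); first by rewrite lt_min d10.
move=> n s t st tr; rewrite lt_min => /andP[sm1 sm2].
have := H1 _ _ _ st tr sm1; have := H2 _ _ _ st tr sm2.
suff : \sum_i `|f (t i) - f (s i)| <=
  \sum_i `|f1 (t i) - f1 (s i)| + \sum_i `|f2 (t i) - f2 (s i)| by lra.
by rewrite -big_split; apply: ler_sum => i _; have [? [? ?]] := st i; exact: fle.
Qed.

Lemma acont_le (f1 f : R -> R) a b : absolutely_continuous_on f1 a b ->
  (forall s t, a <= s -> s <= t -> t <= b -> `|f t - f s| <= `|f1 t - f1 s|) ->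
  absolutely_continuous_on f a b.
Proof.
move=> ac1 fle; apply: (acont_sum_le ac1 ac1) => s t h1 h2 h3.
by apply: le_trans (fle _ _ h1 h2 h3) _; rewrite lerDl.
Qed.

Lemma acont_scale (f : R -> R) k a b : absolutely_continuous_on f a b ->
  absolutely_continuous_on (fun x => k * f x) a b.
Proof.
move=> fac e e0; have k0 : 0 < `|k| + 1 by have := normr_ge0 k; lra.
have [dl dl0 H] := fac (e / (`|k| + 1)) (divr_gt0 e0 k0).
exists dl => // n s t st tr sm; have := H _ _ _ st tr sm.
rewrite ltr_pdivlMr // => He; apply: le_lt_trans He; rewrite mulr_suml.
apply: ler_sum => i _; rewrite -mulrBr normrM mulrC ler_wpM2l //.
by lra.
Qed.

Lemma acont_id a b : absolutely_continuous_on (@id R) a b.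
Proof.
move=> e e0; exists e => // n s t st _; apply: le_lt_trans.
by apply: ler_sum => i _; rewrite ger0_norm//; have := st i; lra.
Qed.

End interval_families.

Section path_length.
Context {R : realType} {T : Type} (d : T -> T -> R).
Hypothesis dP : pseudometric d.
Implicit Types (g : R -> T) (f : R -> R) (a b s t : R) (l : seq R).

Let d0 x y : 0 <= d x y. Proof. exact: pseudometric_ge0. Qed.

Lemma path_variation_nil g a b : path_variation d g a b [::] = 0.
Proof. by rewrite /path_variation big_nil. Qed.

Lemma path_variation_cons g a b x l :
  path_variation d g a b (x :: l) = d (g a) (g x) + path_variation d g x b l.
Proof.
by rewrite /path_variation /= big_nat_recl.
Qed.

Lemma itv_partition_consE (a b x : R) l :
  itv_partition a b (x :: l) <-> a < x /\ itv_partition x b l.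
Proof.
by split=> [[/= /andP[-> ?] ?]|[ax [/= ? ?]]]; split => //=; rewrite ax.
Qed.

Lemma path_variation_ge0 g a b l : 0 <= path_variation d g a b l.
Proof. by apply: sumr_ge0 => i _. Qed.

Lemma path_variation_dominated g f a b l : dominated d g f a b ->
  itv_partition a b l -> path_variation d g a b l <= f b - f a.
Proof.
elim: l a => [|x l IH] a dom.
  by move=> /itv_partition_nil ->; rewrite path_variation_nil subrr.
move=> /itv_partition_consE[ax xl]; rewrite path_variation_cons.
have xb := itv_partition_le xl.
have : d (g a) (g x) <= f x - f a by apply: dom => //; exact: ltW.
have : path_variation d g x b l <= f b - f x.
  by apply: IH => // s t xs; apply: dom; rewrite (le_trans (ltW ax)).
lra.
Qed.

Local Open Scope ereal_scope.

Lemma path_length_ge0 g a b : (a <= b)%R -> 0 <= path_length d g a b.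
Proof.
rewrite le_eqVlt => /predU1P[<-|ab].
  apply: le_ereal_sup_tmp; exists 0 => //; exists [::]; first by split => //=.
  by rewrite path_variation_nil.
apply: le_ereal_sup_tmp; exists (path_variation d g a b [:: b])%:E.
  by exists [:: b] => //; exact: itv_partition1.
by rewrite lee_fin path_variation_ge0.
Qed.

Lemma path_length_cons g a s t : (a <= s)%R -> (s <= t)%R ->
  (d (g a) (g s))%:E + path_length d g s t <= path_length d g a t.
Proof.
rewrite le_eqVlt => /predU1P[<-|as_] st.
  by case: dP => -> _ _; rewrite add0e.
rewrite -leeBrDl//; apply: ge_ereal_sup => _ [l lP <-].
rewrite leeBrDl// -EFinD -path_variation_cons.
by apply: ereal_sup_ubound; exists (s :: l) => //; exact/itv_partition_consE.
Qed.

Lemma path_length_ge g a s : (a <= s)%R ->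
  (d (g a) (g s))%:E <= path_length d g a s.
Proof.
move=> as_; apply: le_trans (path_length_cons g as_ (lexx s)).
by rewrite leeDl// path_length_ge0.
Qed.

Lemma path_length_rcons g a s t : (a <= s)%R -> (s <= t)%R ->
  path_length d g a s + (d (g s) (g t))%:E <= path_length d g a t.
Proof.
move=> as_ st; rewrite -leeBrDr//; apply: ge_ereal_sup => _ [l lP <-].
rewrite leeBrDr// -EFinD.
elim: l a as_ lP => [|x l IH] a as_.
  move=> /itv_partition_nil ->; rewrite path_variation_nil add0r.
  exact: path_length_ge.
move=> /itv_partition_consE[ax xl]; rewrite path_variation_cons.
have xs := itv_partition_le xl.
apply: le_trans (path_length_cons g (ltW ax) (le_trans xs st)).
by rewrite -addrA EFinD leeD2l// IH.
Qed.

(** Inserting s into a partition of [a, t] does not decrease the variation, and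
the part beyond s is bounded by the increment of f. *)
Lemma path_length_increment g f a s t : (a <= s)%R -> (s <= t)%R ->
  dominated d g f a t ->
  path_length d g a t <= path_length d g a s + (f t - f s)%:E.
Proof.
move=> as_ st dom; apply: ge_ereal_sup => _ [l lP <-].
elim: l a as_ dom lP => [|x l IH] a as_ dom.
  move=> /itv_partition_nil at_; rewrite path_variation_nil adde_ge0 //.
    exact: path_length_ge0.
  rewrite lee_fin subr_ge0.
  by apply: (dominated_le dP dom).
move=> /itv_partition_consE[ax xl]; rewrite path_variation_cons.
have xt := itv_partition_le xl.
have domx : dominated d g f x t.
  by move=> u v xu; apply: dom; rewrite (le_trans (ltW ax)).
have [xs|sx] := leP x s.
  apply: (le_trans (y := (d (g a) (g x))%:E + (path_length d g x s + (f t - f s)%:E))).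
    by rewrite EFinD leeD2l// IH.
  rewrite addeA leeD2r//; exact: path_length_cons (ltW ax) xs.
apply: (le_trans (y := (d (g a) (g s))%:E + (f t - f s)%:E)); last first.
  by rewrite leeD2r// path_length_ge.
rewrite -EFinD lee_fin.
have := path_variation_dominated domx xl.
have : (d (g s) (g x) <= f x - f s)%R by apply: dom => //; exact: ltW.
by case: dP => _ _ /(_ (g a) (g s) (g x)); lra.
Qed.

(** Absolutely continuous paths are those whose increments are controlled by
the increments of an absolutely continuous real function: the length function
is such a function, and conversely it grows no faster than any of them. *)
Lemma dominated_ac_path g f a b : (a <= b)%R ->
  absolutely_continuous_on f a b -> dominated d g f a b -> ac_path d g a b.
Proof.
move=> ab fac dom.
have len s t : (a <= s)%R -> (s <= t)%R -> (t <= b)%R -> dominated d g f s t.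
  move=> as_ st tb u v su uv vt; apply: dom => //.
    exact: le_trans su.
  exact: le_trans tb.
have lfin t : (a <= t)%R -> (t <= b)%R -> path_length d g a t \is a fin_num.
  move=> at_ tb; rewrite ge0_fin_numE ?path_length_ge0//.
  apply: (@le_lt_trans _ _ (f t - f a)%:E); last exact: ltry.
  apply: ge_ereal_sup => _ [l lP <-]; rewrite lee_fin.
  exact: path_variation_dominated (len _ _ (lexx a) at_ tb) lP.
split; first split; [split => // | |].
- move=> t; rewrite in_itv/= => /andP[at_ tb] e e0.
  have [dl dl0 H] := acont_uniform fac e0.
  exists dl => // u; rewrite in_itv/= => /andP[au ub] utdl.
  have [tu|ut] := leP t u.
    have := H _ _ at_ tu ub; rewrite -[X in (X < dl)%R -> _]ger0_norm ?subr_ge0//.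
    move=> /(_ utdl); apply: le_lt_trans.
    by apply: le_trans (ler_norm _); exact: dom.
  have := H _ _ au (ltW ut) tb.
  rewrite -[X in (X < dl)%R -> _]ger0_norm ?subr_ge0 ?ltW// distrC.
  move=> /(_ utdl); apply: le_lt_trans; case: dP => _ -> _.
  by apply: le_trans (ler_norm _); apply: dom => //; exact: ltW.
- by rewrite -ge0_fin_numE ?path_length_ge0// lfin.
- apply: (acont_le fac) => s t as_ st tb.
  have Ls := lfin _ as_ (le_trans st tb); have Lt := lfin _ (le_trans as_ st) tb.
  have := path_length_increment as_ st (len _ _ (lexx a) (le_trans as_ st) tb).
  have := path_length_rcons g as_ st.
  rewrite -(fineK Ls) -(fineK Lt) -!EFinD !lee_fin => h1 h2.
  rewrite ger0_norm; last by have := d0 (g s) (g t); lra.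
  by apply: le_trans (ler_norm _); lra.
Qed.

Lemma rectifiable_dominated g a b : rectifiable d g a b ->
  dominated d g (fun t => fine (path_length d g a t)) a b.
Proof.
move=> [[ab _] lfin] s t as_ st tb.
have fn u : (a <= u)%R -> (u <= b)%R -> path_length d g a u \is a fin_num.
  move=> au ub; rewrite ge0_fin_numE ?path_length_ge0//; apply: le_lt_trans lfin.
  by apply: le_trans (path_length_rcons g au ub); rewrite leeDl// lee_fin.
have := path_length_rcons g as_ st.
rewrite -(fineK (fn s as_ (le_trans st tb))) -(fineK (fn t (le_trans as_ st) tb)).
by rewrite -EFinD lee_fin; lra.
Qed.

Lemma ac_path_dominated g a b : ac_path d g a b -> (a <= b)%R /\
  exists2 f, absolutely_continuous_on f a b & dominated d g f a b.
Proof.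
move=> [grect fac]; split; first by case: grect => -[].
by eexists; [exact: fac|exact: rectifiable_dominated].
Qed.

End path_length.

(** * Integrals of functions that need not be measurable, and densities *)

Section integrals_without_measurability.
Context {dd : measure_display} {T : measurableType dd} {R : realType}.
Variable mu : {measure set T -> \bar R}.
Local Open Scope ereal_scope.
Import HBNNSimple.

(** The integral of a nonnegative function is the supremum of the integrals of
the simple functions below it, whether or not the function is measurable. This
matters for path integrals, whose integrands involve the metric speed and an
arbitrary composition with a path. *)
Lemma le_integral_ge0 (D : set T) (f g : T -> \bar R) :
  (forall x, D x -> 0 <= f x) -> (forall x, D x -> f x <= g x) ->
  \int[mu]_(x in D) f x <= \int[mu]_(x in D) g x.
Proof.
move=> f0 fg.
have g0 x : D x -> 0 <= g x by move=> Dx; exact: le_trans (f0 x Dx) (fg x Dx).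
rewrite !ge0_integralE//; apply: ge_ereal_sup => _ [h hf <-].
apply: ereal_sup_ubound; exists h => // x; apply: le_trans (hf x) _.
by apply: lee_restrict.
Qed.

(** A simple function below f splits between A and B minus A. *)
Lemma ge0_integral_setU_le (A B : set T) (f : T -> \bar R) :
  measurable A -> measurable B -> (forall x, (A `|` B) x -> 0 <= f x) ->
  \int[mu]_(x in A `|` B) f x <=
  \int[mu]_(x in A) f x + \int[mu]_(x in B) f x.
Proof.
move=> mA mB f0; rewrite [leLHS]ge0_integralE//; apply: ge_ereal_sup => _ [h hf <-].
have hle (D : set T) : D `<=` A `|` B -> \int[mu]_(x in D) (h x)%:E <= \int[mu]_(x in D) f x.
  move=> DAB; apply: le_integral_ge0 => x Dx; first by rewrite lee_fin.
  by have := hf x; rewrite patchE mem_set//; exact: DAB.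
rewrite -integralT_nnsfun.
have hS D : measurable D -> measurable_fun D (EFin \o h).
  by move=> mD; apply: measurable_funTS; exact/measurable_EFinP.
have -> : \int[mu]_x (h x)%:E = \int[mu]_(x in A `|` B) (h x)%:E.
  rewrite [RHS]integral_mkcond; apply: eq_integral => x _; rewrite patchE.
  case: ifPn => // /negP xAB; apply/eqP; rewrite eqe eq_le fun_ge0 andbT.
  have := hf x; rewrite patchE ifF ?lee_fin//; exact/negP.
have -> : A `|` B = A `|` (B `\` A).
  apply/seteqP; split => [x [Ax|Bx]|x [Ax|[Bx _]]]; [by left| |by left|by right].
  by have [Ax|Ax] := pselect (A x); [left|right].
rewrite ge0_integral_setU//; last 4 first.
- exact: measurableD.
- by apply: hS; apply: measurableU => //; exact: measurableD.
- by move=> x _; rewrite lee_fin.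
- by rewrite disj_set2E setDIK.
apply: leeD; first by apply: hle; exact: subsetUl.
apply: (@le_trans _ _ (\int[mu]_(x in B) (h x)%:E)); last by apply: hle; exact: subsetUr.
apply: ge0_subset_integral => //; first exact: measurableD.
- exact: hS.
- by move=> x _; rewrite lee_fin.
Qed.

Lemma ae_le_integral_ge0 (D : set T) (f g : T -> \bar R) :
  measurable D -> measurable_fun D f ->
  (forall x, D x -> 0 <= f x) -> (forall x, D x -> 0 <= g x) ->
  {ae mu, forall x, D x -> f x <= g x} ->
  \int[mu]_(x in D) f x <= \int[mu]_(x in D) g x.
Proof.
move=> mD mf f0 g0 [N [mN N0 NP]].
rewrite (ge0_negligible_integral mN mD mf f0 N0).
rewrite integral_mkcond [leRHS]integral_mkcond; apply: le_integral_ge0.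
  by move=> x _; apply: erestrict_ge0 => y [Dy _]; exact: f0.
move=> x _; rewrite !patchE; case: ifPn => [/set_mem[Dx Nx]|_].
  rewrite mem_set//; apply: contrapT => fg; apply: Nx; apply: NP => /=.
  by apply/not_implyP.
by case: ifPn => // /set_mem; exact: g0.
Qed.

End integrals_without_measurability.

Section lebesgue_isometry.
Context {R : realType}.
Local Notation mu := (@lebesgue_measure R).
Local Open Scope ereal_scope.
Import HBNNSimple.

(** Simple functions below the left integrand are carried by the inverse map to
simple functions below the right one. *)
Lemma le_integral_isometry (sg sg' : R -> R) (D : set R) (f : R -> \bar R) :
  measurable_fun setT (sg : measurableTypeR R -> measurableTypeR R) ->
  measurable_fun setT (sg' : measurableTypeR R -> measurableTypeR R) ->
  cancel sg sg' -> cancel sg' sg ->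
  (forall A, measurable A -> mu (sg @^-1` A) = mu A) ->
  (forall x, D x -> 0 <= f x) ->
  \int[mu]_(x in sg @^-1` D) f (sg x) <= \int[mu]_(x in D) f x.
Proof.
move=> msg msg' sgK sgK' sgmu f0.
rewrite [leLHS]ge0_integralE; last by move=> x Dx; exact: f0.
apply: ge_ereal_sup => _ [h hf <-].
rewrite -integralT_nnsfun.
have mh : measurable_fun setT (fun y : measurableTypeR R => (h (sg' y))%:E).
  by apply/measurable_EFinP; exact: (measurableT_comp (measurable_funP h) msg').
have -> : \int[mu]_x (h x)%:E = \int[pushforward mu (sg : measurableTypeR R -> measurableTypeR R)]_y (h (sg' y))%:E.
  rewrite ge0_integral_pushforward//.
    by apply: eq_integral => x _; rewrite /= sgK.
  by move=> y _; rewrite lee_fin.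
have -> : \int[pushforward mu (sg : measurableTypeR R -> measurableTypeR R)]_y (h (sg' y))%:E =
          \int[mu]_y (h (sg' y))%:E.
  by apply: eq_measure_integral => A mA _; exact: sgmu.
rewrite [leRHS]integral_mkcond; apply: le_integral_ge0 => y _.
  by rewrite lee_fin.
have E : (sg' y \in sg @^-1` D) = (y \in D).
  by apply/idP/idP => /set_mem /=; rewrite ?sgK' => yD; apply/mem_set; rewrite //= sgK'.
by have := hf (sg' y); rewrite !patchE E sgK'.
Qed.

Lemma lebesgue_measure_shift (k : R) (A : set R) : measurable A ->
  mu ((fun x => x + k)%R @^-1` A) = mu A.
Proof.
move=> mA; have ms : measurable_fun setT ((fun x => x + k)%R : measurableTypeR R -> measurableTypeR R).
  by apply: measurable_funD => //; exact: measurable_cst.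
have := @lebesgue_measure_unique R (pushforward mu ((fun x => x + k)%R : measurableTypeR R -> measurableTypeR R)).
rewrite /pushforward/= => H; apply/esym/H => // _ [[a b] _ <-]; rewrite /pushforward /=.
have -> : (fun x => x + k)%R @^-1` `]a, b] = `](a - k)%R, (b - k)%R]%classic.
  by apply/seteqP; split => x /=; rewrite !in_itv/= ltrBlDr lerBrDr.
rewrite !lebesgue_measure_itv/= !lte_fin ltrD2r.
by case: ifP => // _; rewrite -!EFinB; congr EFin; lra.
Qed.

Lemma le_integral_shift (k : R) (D : set R) (f : R -> \bar R) :
  (forall x, D x -> 0 <= f x) ->
  \int[mu]_(x in (fun x => x + k)%R @^-1` D) f (x + k)%R <= \int[mu]_(x in D) f x.
Proof.
move=> f0; apply: (@le_integral_isometry (fun x => x + k)%R (fun x => x - k)%R) => //.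
- by apply: measurable_funD => //; exact: measurable_cst.
- by apply: measurable_funD => //; exact: measurable_cst.
- by move=> x /=; rewrite addrK.
- by move=> x /=; rewrite subrK.
- by move=> A mA; exact: lebesgue_measure_shift.
Qed.

Lemma le_integral_opp (D : set R) (f : R -> \bar R) :
  (forall x, D x -> 0 <= f x) ->
  \int[mu]_(x in -%R @^-1` D) f (- x)%R <= \int[mu]_(x in D) f x.
Proof.
move=> f0; apply: (@le_integral_isometry -%R -%R) => //.
- exact: opprK.
- exact: opprK.
- by move=> A mA; exact: lebesgue_measureN.
Qed.

End lebesgue_isometry.

Section density.
Context {R : realType}.
Local Notation mu := (@lebesgue_measure R).
Variables (f : R -> R) (a b : R).
Hypothesis ab : a <= b.
Hypothesis fnd : forall s t, a <= s -> s <= t -> t <= b -> f s <= f t.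
Hypothesis fac : absolutely_continuous_on f a b.

Let cl (x : R) := Num.max a (Num.min x b).

Let cl_itv x : a <= cl x <= b.
Proof. by rewrite /cl le_max lexx/= ge_max ab/= ge_min lexx orbT. Qed.

Let cl_lip x y : x <= y -> 0 <= cl y - cl x <= y - x.
Proof.
rewrite /cl; have ab' := ab; have [xb|bx] := leP x b; have [yb|by_] := leP y b => xy.
- by have [ax|xa] := leP a x; have [ay|ya] := leP a y; lra.
- by have [ax|xa] := leP a x; rewrite (max_idPr ab); lra.
- by lra.
- by lra.
Qed.

Let cl_id x : a <= x -> x <= b -> cl x = x.
Proof. by move=> ax xb; rewrite /cl (min_idPl xb) (max_idPr ax). Qed.

Let F x := f (cl x).

Let F_nd : {homo F : x y / x <= y}.
Proof.
move=> x y xy; have /andP[ax xb] := cl_itv x; have /andP[ay yb] := cl_itv y.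
by apply: fnd => //; have := cl_lip xy; lra.
Qed.

Let F_rc : right_continuous F.
Proof.
move=> x; apply: cvg_within_filter; apply/cvgrPdist_lt => e e0.
have [dl dl0 H] := acont_uniform fac e0.
near=> y; have yx : `|x - y| < dl by near: y; exact: cvgr_dist_lt.
have /andP[ax xb] := cl_itv x; have /andP[ay yb] := cl_itv y.
have [xy|/ltW yx'] := leP x y.
- rewrite distrC; apply: H => //; have := cl_lip xy; first by lra.
  by move: yx; rewrite distrC ger0_norm ?subr_ge0//; lra.
- apply: H => //; have := cl_lip yx'; first by lra.
  by move: yx; rewrite ger0_norm ?subr_ge0//; lra.
Unshelve. all: by end_near. Qed.

HB.instance Definition _ := isCumulative.Build R _ R F F_nd F_rc.

Let nu0 := lebesgue_stieltjes_measure F.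

Let nu0_itv x y : x <= y -> nu0 `]x, y] = (F y - F x)%:E.
Proof.
move=> xy; rewrite /nu0 /lebesgue_stieltjes_measure/= /measure_extension.
by rewrite measurable_mu_extE/= ?wlength_itv_bnd//; exact: is_ocitv.
Qed.

Let mI : measurable (`]a, b]%classic : set (measurableTypeR R)).
Proof. exact: measurable_itv. Qed.

Let nu0_fin : (nu0 `]a, b] < +oo)%E.
Proof. by rewrite nu0_itv// ltry. Qed.

Let nu := mfrestr mI nu0_fin.

(** An open set of small measure is a disjoint union of open intervals, so
absolute continuity bounds the increments of the function over it. *)
Let nu_dominated : nu `<< mu.
Proof.
apply/null_content_dominatesP => A mA A0.
rewrite /nu /mfrestr /mrestr/=; apply/eqP; rewrite eq_le measure_ge0 andbT.
apply/lee_addgt0Pr => e e0; rewrite add0e.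
have [dl dl0 H] := fac e0.
have [U [oU AU Udl]] := @outer_measure_open_le R A (dl / 2) (divr_gt0 dl0 (ltr0Sn _ 1)).
have mU : (mu U < dl%:E)%E.
  apply: le_lt_trans Udl _; have -> : ((wlength idfun)^* A)%mu = 0%E by exact: A0.
  by rewrite add0e lte_fin; lra.
pose V := U `&` `](a - 1), (b + 1)[.
have oV : open V by apply: openI => //; exact: interval_open.
pose I := open_disjoint_itv oV.
have VI : V = \bigcup_i I i by exact: open_disjoint_itv_bigcup.
have tI : trivIset setT I by exact: open_disjoint_itv_trivIset.
have IV i : I i `<=` V by rewrite VI => x Ix; exists i.
have Ib i : has_lbound (I i) /\ has_ubound (I i).
  by split; [exists (a - 1)|exists (b + 1)] => x /IV[_] /=; rewrite in_itv/= => /andP[]; lra.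
have Ieq i : I i = `]inf (I i), sup (I i)[%classic.
  rewrite -interval_bounded_interior ?(Ib i).1 ?(Ib i).2//.
  - by apply/esym/interior_id/open_disjoint_itv_open.
  - exact: open_disjoint_itv_is_interval.
  - exact: (Ib i).1.
  - exact: (Ib i).2.
have infsup i : inf (I i) <= sup (I i).
  have [->|/set0P[x Ix]] := eqVneq (I i) set0; first by rewrite inf0 sup0.
  have [lI uI] := Ib i; apply: (@le_trans _ _ x).
    by apply: ge_inf.
  by apply: ub_le_sup.
have mI' i : measurable (I i : set (measurableTypeR R)) by rewrite Ieq; exact: measurable_itv.
have mV : measurable (V : set (measurableTypeR R)) by exact: open_measurable.
apply: (@le_trans _ _ (nu0 V)).
  apply: le_measure; rewrite ?inE//; first exact: measurableI.
  by move=> x [/AU Ux] /=; rewrite in_itv/= => /andP[? ?]; split => //=; rewrite in_itv/=; lra.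
rewrite VI /nu0 measure_bigcup//.
apply: lime_le; first by apply: is_cvg_nneseries.
apply: nearW => n.
apply: (@le_trans _ _ (\sum_(i < n) (F (sup (I i)) - F (inf (I i)))%:E)%E).
  rewrite big_mkord; under eq_bigl do rewrite in_setT.
  apply: lee_sum => i _; rewrite -nu0_itv//.
  apply: le_measure; rewrite ?inE//.
  by rewrite [X in X `<=` _]Ieq => x /=; rewrite !in_itv/= => /andP[-> /ltW].
rewrite sumEFin lee_fin; apply: ltW.
apply: (@le_lt_trans _ _ (\sum_(i < n) `|f (cl (sup (I i))) - f (cl (inf (I i)))|)).
  by apply: ler_sum => i _; exact: ler_norm.
apply: H.
- move=> i; have /andP[? ?] := cl_itv (inf (I i)); have /andP[? ?] := cl_itv (sup (I i)).
  by split => //; split => //; have := cl_lip (infsup i); lra.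
- move=> i j _ _ [x [/= xi xj]]; apply/val_inj; apply: tI => //.
  have clI k : x \in `]cl (inf (I k)), cl (sup (I k))[ -> I k x.
    rewrite [I k in X in _ -> X]Ieq /= !in_itv/= /cl => /andP[].
    by rewrite gt_max lt_max lt_min gt_min => /andP[h1 h2] /orP[|/andP[]]; lra.
  by exists x; split; apply: clI.
- rewrite -lte_fin; apply: le_lt_trans mU.
  apply: (@le_trans _ _ (mu V)); last first.
    by apply: le_measure; rewrite ?inE//; [exact: open_measurable|exact: subIsetl].
  rewrite VI measure_bigcup//.
  apply: (@le_trans _ _ (\sum_(0 <= i < n | i \in [set: nat]) mu (I i))%E); last first.
    apply: nneseries_lim_ge => i _ _; exact: measure_ge0.
  rewrite big_mkord; under [leRHS]eq_bigl do rewrite in_setT.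
  rewrite -sumEFin; apply: lee_sum => i _.
  rewrite [X in mu X]Ieq lebesgue_measure_itv/= lte_fin.
  have := cl_lip (infsup i).
  by case: ltP => h h2; rewrite ?lee_fin; have := infsup i; lra.
Qed.

(** A nondecreasing absolutely continuous function is the integral of its
Radon-Nikodym density. *)
Lemma acont_density : exists h : R -> R, [/\ forall x, 0 <= h x,
  mu.-integrable setT (EFin \o h) &
  forall s t, a <= s -> s <= t -> t <= b ->
    (f t - f s)%:E = (\int[mu]_(x in `]s, t]) (h x)%:E)%E].
Proof.
pose h := Radon_Nikodym_SigmaFinite.f nu mu.
have hE x : h x = (fine (h x))%:E.
  by rewrite fineK//; exact: Radon_Nikodym_SigmaFinite.f_fin_num nu_dominated x.
exists (fine \o h); split => [x||s t as_ st tb].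
- by rewrite /= -lee_fin -hE; exact: Radon_Nikodym_SigmaFinite.f_ge0 nu_dominated x.
- have := Radon_Nikodym_SigmaFinite.f_integrable nu_dominated.
  by apply: eq_integrable => // x _ /=; rewrite -hE.
- have nuE : nu `]s, t] = (f t - f s)%:E.
    change (nu0 (`]s, t] `&` `]a, b]) = (f t - f s)%:E).
    rewrite (_ : _ `&` _ = `]s, t]%classic); last first.
      apply/setIidPl => x /=; rewrite !in_itv/= => /andP[sx xt].
      by rewrite (le_lt_trans as_ sx) (le_trans xt tb).
    have [sb at_] := (le_trans st tb, le_trans as_ st).
    by rewrite nu0_itv// /F !cl_id//.
  rewrite -nuE; apply: etrans (Radon_Nikodym_SigmaFinite.f_integral nu_dominated (@measurable_itv R `]s, t])) _.
  by apply: eq_integral => x _; rewrite /= -hE.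
Qed.

End density.

(** * Metric speed *)

Section almost_everywhere.
Context {dd : measure_display} {T : measurableType dd} {R : realType}.
Variable mu : {measure set T -> \bar R}.

Lemma ae_imp (P Q : T -> Prop) : {ae mu, forall x, P x} ->
  (forall x, P x -> Q x) -> {ae mu, forall x, Q x}.
Proof.
by move=> + PQ; apply: (@filterS _ _ (ae_filter_ringOfSetsType mu)); exact: PQ.
Qed.

Lemma ae_imp2 (P P' Q : T -> Prop) : {ae mu, forall x, P x} ->
  {ae mu, forall x, P' x} ->
  (forall x, P x -> P' x -> Q x) -> {ae mu, forall x, Q x}.
Proof.
by move=> + + PQ; apply: (@filterS2 _ _ (ae_filter_ringOfSetsType mu)); exact: PQ.
Qed.

End almost_everywhere.

Section speed.
Context {R : realType}.
Local Notation mu := (@lebesgue_measure R).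
Implicit Types (f h k : R -> R) (a b s t x l : R).

(** The limit in the definition of the metric speed, whose existence cannot be
read off from the value of the speed. *)
Definition speed_at {T : Type} (d : T -> T -> R) (g : R -> T) x l :=
  forall e, 0 < e -> exists2 dl, 0 < dl &
    forall u, 0 < `|u - x| -> `|u - x| < dl -> `|d (g u) (g x) / `|u - x| - l| < e.

Definition slope_at f x l :=
  forall e, 0 < e -> exists2 dl, 0 < dl &
    forall u, 0 < `|u - x| -> `|u - x| < dl -> `|(f u - f x) / (u - x) - l| < e.

Lemma speed_at_cvgP (T : Type) (d : T -> T -> R) g x l :
  speed_at d g x l <-> d (g u) (g x) / `|u - x| @[u --> x^'] --> l.
Proof.
split=> [H|].
  apply/cvgrPdist_lt => e e0; have [dl dl0 Hdl] := H e e0.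
  rewrite near_withinE; apply/nbhs_ballP; exists dl => //= u; rewrite /ball/= => ux uNx.
  rewrite distrC; apply: Hdl; last by rewrite distrC.
  by rewrite normr_gt0 subr_eq0.
move=> /cvgrPdist_lt H e e0; have := H e e0.
rewrite near_withinE => /nbhs_ballP[dl /= dl0 Hdl]; exists dl => // u u0 ux.
rewrite distrC; apply: Hdl; first by rewrite /ball/= distrC.
by move: u0; rewrite normr_gt0 subr_eq0.
Qed.

Lemma metric_speedE (T : Type) (d : T -> T -> R) g x l :
  speed_at d g x l -> metric_speed d g x = l.
Proof. by move=> /speed_at_cvgP H; apply/cvg_lim => //; exact: Rhausdorff. Qed.

(** Without a limit, lim returns the default real number, which is 0; this keeps
comparisons of speeds valid at every point. *)
Lemma metric_speed_none (T : Type) (d : T -> T -> R) g x :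
  ~ (exists l, speed_at d g x l) -> metric_speed d g x = 0.
Proof.
move=> H; rewrite /metric_speed dvgP//.
by move=> /cvg_ex[l lP]; apply: H; exists l; exact/speed_at_cvgP.
Qed.

Lemma punctured_point x (e : R) : 0 < e ->
  exists u, 0 < `|u - x| /\ `|u - x| < e.
Proof.
move=> e0; exists (x + e / 2).
rewrite addrC addKr gtr0_norm ?divr_gt0//; lra.
Qed.

Lemma speed_at_le (T : Type) (d : T -> T -> R) g x l c :
  (exists2 e, 0 < e & forall u, 0 < `|u - x| -> `|u - x| < e ->
    d (g u) (g x) <= c * `|u - x|) ->
  speed_at d g x l -> l <= c.
Proof.
move=> [e e0 H] sl; apply/ler_addgt0Pl => e' e'0.
have [dl dl0 Hdl] := sl e' e'0.
have [|u [u0]] := @punctured_point x (Num.min e dl); first by rewrite lt_min e0.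
rewrite lt_min => /andP[ue ud].
have := Hdl u u0 ud; rewrite ltr_norml => /andP[h1 _].
have : d (g u) (g x) / `|u - x| <= c by rewrite ler_pdivrMr// H.
lra.
Qed.

Lemma metric_speed_le (T : Type) (d : T -> T -> R) g x c : 0 <= c ->
  (exists2 e, 0 < e & forall u, 0 < `|u - x| -> `|u - x| < e ->
    d (g u) (g x) <= c * `|u - x|) ->
  metric_speed d g x <= c.
Proof.
move=> c0 H; have [[l sl]|no] := pselect (exists l, speed_at d g x l).
  by rewrite (metric_speedE sl); exact: speed_at_le H sl.
by rewrite metric_speed_none.
Qed.

Lemma speed_at_ge (T : Type) (d : T -> T -> R) g x l c :
  (exists2 e, 0 < e & forall u, 0 < `|u - x| -> `|u - x| < e ->
    c * `|u - x| <= d (g u) (g x)) ->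
  speed_at d g x l -> c <= l.
Proof.
move=> [e e0 H] sl; apply/ler_addgt0Pl => e' e'0.
have [dl dl0 Hdl] := sl e' e'0.
have [|u [u0]] := @punctured_point x (Num.min e dl); first by rewrite lt_min e0.
rewrite lt_min => /andP[ue ud].
have := Hdl u u0 ud; rewrite ltr_norml => /andP[_ h1].
have : c <= d (g u) (g x) / `|u - x| by rewrite ler_pdivlMr// H.
lra.
Qed.

Lemma metric_speed_ge0 (T : Type) (d : T -> T -> R) g x :
  pseudometric d -> 0 <= metric_speed d g x.
Proof.
move=> dP; have [[l sl]|no] := pselect (exists l, speed_at d g x l).
  rewrite (metric_speedE sl); apply: speed_at_ge sl; exists 1 => // u _ _.
  by rewrite mul0r; exact: pseudometric_ge0.
by rewrite metric_speed_none.
Qed.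

(** Lebesgue's differentiation theorem, for the indefinite integral. *)
Lemma integrable_slope h : mu.-integrable setT (EFin \o h) ->
  {ae mu, forall x, slope_at (fun y => \int[mu]_(t in `]-oo, y]) h t) x (h x)}.
Proof.
move=> hi; have := @FTC1Ny R h.
have hy y : mu.-integrable `]-oo, y] (EFin \o h).
  by apply: integrableS hi => //; exact: measurable_itv.
move=> /(_ hy (open_integrable_locally openT hi)).
move/ae_imp; apply => x [dF F'].
move: F'; rewrite derive1E /derive => F' e e0.
have : (fun r : R => r^-1 *: (\int[mu]_(t in `]-oo, r *: 1 + x]) h t -
   \int[mu]_(t in `]-oo, x]) h t)) r @[r --> 0^'] --> h x.
  by rewrite -F'; exact: dF.
move=> /cvgrPdist_lt /(_ e e0); rewrite near_withinE => /nbhs_ballP[dl /= dl0 H].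
exists dl => // u u0 ux.
have := H (u - x); rewrite /ball/= sub0r normrN => /(_ ux).
rewrite -normr_gt0 => /(_ u0); rewrite distrC /GRing.scale/= mulr1 subrK.
by rewrite mulrC.
Qed.

Lemma integral_increment h s t : s <= t -> mu.-integrable setT (EFin \o h) ->
  \int[mu]_(y in `]-oo, t]) h y - \int[mu]_(y in `]-oo, s]) h y =
  \int[mu]_(y in `]s, t]) h y.
Proof.
move=> st hi; apply: Rintegral_itvB => //.
by apply: integrableS hi => //; exact: measurable_itv.
Qed.

Lemma slope_at_local f f' x l (e : R) : 0 < e ->
  (forall u, `|u - x| < e -> f u - f x = f' u - f' x) ->
  slope_at f' x l -> slope_at f x l.
Proof.
move=> e0 H fs e' e'0; have [dl dl0 Hdl] := fs e' e'0.
exists (Num.min e dl); first by rewrite lt_min e0.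
by move=> u u0; rewrite lt_min => /andP[ue ud]; rewrite H// Hdl.
Qed.

Lemma slope_atB f f' x l l' : slope_at f x l -> slope_at f' x l' ->
  slope_at (fun u => f u - f' u) x (l - l').
Proof.
move=> fs fs' e e0; have e20 : 0 < e / 2 by lra.
have [d1 d10 H1] := fs _ e20; have [d2 d20 H2] := fs' _ e20.
exists (Num.min d1 d2); first by rewrite lt_min d10.
move=> u u0; rewrite lt_min => /andP[u1 u2].
have := H1 u u0 u1; have := H2 u u0 u2.
rewrite !ltr_norml (_ : f u - f' u - (f x - f' x) = (f u - f x) - (f' u - f' x)); last by ring.
rewrite mulrBl; lra.
Qed.

Lemma slope_at_abs_le f f' x l l' (e : R) : 0 < e ->
  (forall u, `|u - x| < e -> `|f u - f x| <= `|f' u - f' x|) ->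
  slope_at f x l -> slope_at f' x l' -> `|l| <= `|l'|.
Proof.
move=> e0 H fs fs'; apply/ler_addgt0Pl => e' e'0.
have e20 : 0 < e' / 2 by lra.
have [d1 d10 H1] := fs _ e20; have [d2 d20 H2] := fs' _ e20.
have [|u [u0]] := @punctured_point x (Num.min e (Num.min d1 d2)).
  by rewrite !lt_min e0 d10.
rewrite !lt_min => /andP[ue /andP[u1 u2]].
have h1 := H1 u u0 u1; have h2 := H2 u u0 u2.
have h3 : `|(f u - f x) / (u - x)| <= `|(f' u - f' x) / (u - x)|.
  by rewrite !normrM ler_wpM2r// H.
have := ler_normB ((f u - f x) / (u - x)) ((f u - f x) / (u - x) - l).
have := ler_normD ((f' u - f' x) / (u - x) - l') l'.
rewrite subrK subKr; lra.
Qed.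

Lemma acont_density_slope f a b : a <= b ->
  (forall s t, a <= s -> s <= t -> t <= b -> f s <= f t) ->
  absolutely_continuous_on f a b ->
  exists h, [/\ forall x, 0 <= h x, mu.-integrable setT (EFin \o h),
    {ae mu, forall x, a < x < b -> slope_at f x (h x)} &
    forall s t, a <= s -> s <= t -> t <= b ->
      f t - f s = \int[mu]_(x in `]s, t]) h x].
Proof.
move=> ab fnd fac; have [h [h0 hi hE]] := acont_density ab fnd fac.
have hE' s t : a <= s -> s <= t -> t <= b ->
  f t - f s = \int[mu]_(x in `]s, t]) h x.
  by move=> as_ st tb; rewrite /Rintegral -hE.
exists h; split => //; apply: (ae_imp (integrable_slope hi)) => x hx /andP[ax xb].
apply: (@slope_at_local _ (fun y => \int[mu]_(t in `]-oo, y]) h t) _ _ (Num.min (x - a) (b - x))) hx.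
  by rewrite lt_min !subr_gt0 ax.
move=> u; rewrite lt_min !ltr_norml => /andP[/andP[u1 _] /andP[_ u2]].
have au : a <= u by lra.
have ub : u <= b by lra.
have [xu|/ltW ux] := leP x u.
  by rewrite hE' ?(ltW ax)// integral_increment.
by rewrite -opprB hE' ?(ltW xb)// -[RHS]opprB integral_increment.
Qed.

(** A function dominated by f is the difference of the nondecreasing functions
phi + f and f. *)
Lemma dominated_density phi f a b : a <= b -> absolutely_continuous_on f a b ->
  dominated (fun x y : R => `|y - x|) phi f a b ->
  exists k, [/\ mu.-integrable setT (EFin \o k),
    {ae mu, forall x, a < x < b -> slope_at phi x (k x)} &
    forall s t, a <= s -> s <= t -> t <= b ->
      phi t - phi s = \int[mu]_(x in `]s, t]) k x].
Proof.
move=> ab fac dom.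
have fnd := dominated_le real_pseudometric dom.
have [h [h0 hi hs hE]] := acont_density_slope ab fnd fac.
pose f1 x := phi x + f x.
have f1nd s t : a <= s -> s <= t -> t <= b -> f1 s <= f1 t.
  move=> as_ st tb; have := dom _ _ as_ st tb; rewrite ler_norml /f1; lra.
have f1ac : absolutely_continuous_on f1 a b.
  apply: (acont_sum_le fac fac) => s t as_ st tb; rewrite /f1.
  rewrite (_ : phi t + f t - (phi s + f s) = (phi t - phi s) + (f t - f s)); last by ring.
  apply: le_trans (ler_normD _ _) _; rewrite lerD2r.
  by apply: le_trans (dom _ _ as_ st tb) (ler_norm _).
have [k [k0 ki ks kE]] := acont_density_slope ab f1nd f1ac.
exists (fun x => k x - h x); split.
- exact: (integrableB measurableT ki hi).
- apply: (ae_imp2 ks hs) => x xk xh xab.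
  apply: (slope_at_local ltr01 _ (slope_atB (xk xab) (xh xab))) => u _.
  by rewrite /f1; ring.
- move=> s t as_ st tb; rewrite RintegralB//; last 2 first.
  + by apply: integrableS ki => //; exact: measurable_itv.
  + by apply: integrableS hi => //; exact: measurable_itv.
  by rewrite -kE// -hE// /f1; ring.
Qed.

End speed.

Section metric_derivative.
Context {R : realType}.
Local Notation mu := (@lebesgue_measure R).

Lemma ae_neq (c : R) : {ae mu, forall x, x != c}.
Proof.
exists [set c]; split; first exact: measurable_set1.
- exact: lebesgue_measure_set1.
- by move=> x /= /negP; rewrite negbK => /eqP.
Qed.

Lemma ae_le_Rintegral (D : set R) (f1 f2 : R -> R) : measurable D ->
  mu.-integrable D (EFin \o f1) -> mu.-integrable D (EFin \o f2) ->
  (forall x, 0 <= f1 x) -> (forall x, 0 <= f2 x) ->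
  {ae mu, forall x, D x -> f1 x <= f2 x} ->
  \int[mu]_(x in D) f1 x <= \int[mu]_(x in D) f2 x.
Proof.
move=> mD i1 i2 f10 f20 f12; apply: fine_le; try exact: integrable_fin_num.
have [m1 m2] := (measurable_int _ i1, measurable_int _ i2).
apply: ae_ge0_le_integral => //; try by move=> x _; rewrite lee_fin.
Qed.

Variables (T : Type) (d : T -> T -> R) (g : R -> T) (f : R -> R) (a b : R).
Hypotheses (dP : pseudometric d) (ab : a <= b).
Hypotheses (fac : absolutely_continuous_on f a b) (dom : dominated d g f a b).

(* a dense sequence of [a, b], with repetitions of its endpoints *)
Let q (n : nat) : R :=
  Num.max a (Num.min (if unpickle n is Some r then ratr r else 0) b).

Let phi n (t : R) := d (g (q n)) (g t).

Let dC x y : d x y = d y x. Proof. by case: dP. Qed.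

Let dT x y z : d x z <= d x y + d y z. Proof. by case: dP. Qed.

Let phi_le n s t : `|phi n t - phi n s| <= d (g s) (g t).
Proof.
rewrite /phi ler_norml; have := dT (g (q n)) (g s) (g t).
by have := dT (g (q n)) (g t) (g s); rewrite (dC (g t)); lra.
Qed.

Let phi_dom n : dominated (fun x y : R => `|y - x|) (phi n) f a b.
Proof. by move=> s t as_ st tb; apply: le_trans (phi_le _ _ _) _; exact: dom. Qed.

Let q_dense s t : s < t -> a <= s -> t <= b -> exists n, s < q n < t.
Proof.
move=> st as_ tb; have [r] := rat_in_itvoo st; rewrite in_itv/= => /andP[sr rt].
have rb : ratr r <= b by rewrite ltW// (lt_le_trans rt).
have ar : a <= ratr r by rewrite ltW// (le_lt_trans as_).
by exists (pickle r); rewrite /q pickleK (min_idPl rb) (max_idPr ar) sr.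
Qed.

Let dense_lower s t e : a <= s -> s < t -> t <= b -> 0 < e ->
  exists n, d (g s) (g t) <= `|phi n t - phi n s| + e.
Proof.
move=> as_ st tb e0; have [dl dl0 H] := acont_uniform fac (divr_gt0 e0 (ltr0Sn _ 1)).
have h1 : Num.max s (t - dl) < t by rewrite gt_max st/= ltrBlDr ltrDl.
have h2 : a <= Num.max s (t - dl) by rewrite le_max as_.
have [n /andP[qn1 qn2]] := q_dense h1 h2 tb => {h1 h2}.
move: qn1; rewrite gt_max => /andP[sq tq]; exists n.
have aq : a <= q n by rewrite ltW// (le_lt_trans as_).
have h1 : d (g (q n)) (g t) < e / 2.
  apply: (@le_lt_trans _ _ (f t - f (q n))); first by apply: dom => //; exact: ltW.
  by apply: le_lt_trans (ler_norm _) _; apply: H => //; [exact: ltW|lra].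
rewrite /phi; have := ler_norm (d (g (q n)) (g s) - d (g (q n)) (g t)).
by rewrite distrC; have := dT (g s) (g (q n)) (g t); rewrite (dC (g s) (g (q n))); lra.
Qed.

(** The metric derivative of an absolutely continuous path is the supremum of
the derivatives of the distances to countably many points dense in the path:
each of them is at most the metric difference quotients, and together they
recover the distance by the triangle inequality. *)
Theorem metric_derivative : exists m : R -> R, [/\ forall x, 0 <= m x,
  mu.-integrable setT (EFin \o m),
  {ae mu, forall x, a < x < b -> speed_at d g x (m x)} &
  forall s t, a <= s -> s <= t -> t <= b ->
    d (g s) (g t) <= \int[mu]_(x in `]s, t]) m x].
Proof.
have fnd := dominated_le dP dom.
have [h [h0 hi hs hE]] := acont_density_slope ab fnd fac.
have /choice[k kP] : forall n, exists k, [/\ mu.-integrable setT (EFin \o k),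
    {ae mu, forall x, a < x < b -> slope_at (phi n) x (k x)} &
    forall s t, a <= s -> s <= t -> t <= b ->
      phi n t - phi n s = \int[mu]_(x in `]s, t]) k x].
  by move=> n; exact: dominated_density ab fac (phi_dom n).
pose u n x := Num.min `|k n x| (h x).
pose m x := sup (range (u ^~ x)).
have ub x : has_ubound (range (u ^~ x)).
  by exists (h x) => _ [n _ <-]; rewrite /u ge_min lexx orbT.
have um n x : u n x <= m x by apply: ub_le_sup => //; exists n.
have mh x : m x <= h x.
  apply: ge_sup; first by exists (u 0%N x), 0%N.
  by move=> _ [n _ <-]; rewrite /u ge_min lexx orbT.
have u0 n x : 0 <= u n x by rewrite /u le_min normr_ge0 h0.
have m0 x : 0 <= m x by apply: le_trans (u0 0%N x) (um _ _).
have adh x e : 0 < e -> exists n, m x - e < u n x.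
  move=> e0; have [|_ [n _ <-] ?] := @sup_adherent _ (range (u ^~ x)) _ e0.
    by split; [exists (u 0%N x), 0%N|exact: ub].
  by exists n.
have mm : measurable_fun [set: measurableTypeR R] m.
  have -> : m = (fun x => sups (u ^~ x) 0%N).
    apply/funext => x; rewrite /m /sups /sdrop; congr sup.
    by apply/seteqP; split => _ [n _ <-]; exists n.
  apply: measurable_fun_sups => // n; apply: measurable_minr.
    by apply: measurableT_comp => //; have [/measurable_int/measurable_EFinP] := kP n.
  by apply/measurable_EFinP; exact: measurable_int hi.
have mi : mu.-integrable setT (EFin \o m).
  apply: le_integrable hi => //; first exact/measurable_EFinP.
  by move=> x _ /=; rewrite lee_fin !ger0_norm.
have kae : {ae mu, forall x, forall n, a < x < b -> slope_at (phi n) x (k n x) /\ `|k n x| = u n x}.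
  apply: ae_foralln => n; have [_ kn _] := kP n.
  apply: (ae_imp2 kn hs) => x xk xh xab; split; first exact: xk.
  rewrite /u (min_idPl _)// -[leRHS]ger0_norm//.
  case/andP: (xab) => ax xb.
  apply: (@slope_at_abs_le _ (phi n) f x _ _ (Num.min (x - a) (b - x))) (xk xab) (xh xab).
    by rewrite lt_min !subr_gt0 ax.
  move=> v; rewrite lt_min !ltr_norml => /andP[/andP[v1 _] /andP[_ v2]].
  have [av vb] : a <= v /\ v <= b by lra.
  have [xv|/ltW vx] := leP x v.
    by apply: le_trans (ler_norm _); apply: phi_dom => //; exact: ltW.
  rewrite distrC [leRHS]distrC.
  by apply: le_trans (ler_norm _); apply: phi_dom => //; exact: ltW.
have minc s t : a <= s -> s <= t -> t <= b ->
    d (g s) (g t) <= \int[mu]_(x in `]s, t]) m x.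
  move=> as_ + tb; rewrite le_eqVlt => /predU1P[<-|st].
    case: dP => -> _ _; exact: Rintegral_ge0.
  apply/ler_addgt0Pr => e e0; have [n dn] := dense_lower as_ st tb e0.
  apply: le_trans dn _; rewrite lerD2r.
  have [ki _ kE] := kP n; rewrite (kE _ _ as_ (ltW st) tb).
  have iS j : mu.-integrable setT (EFin \o j) -> mu.-integrable `]s, t] (EFin \o j).
    by move=> ji; apply: integrableS ji => //; exact: measurable_itv.
  apply: (@le_trans _ _ (\int[mu]_(x in `]s, t]) `|k n x|)).
    by apply: le_normr_Rintegral; [exact: measurable_itv|exact: iS].
  have kiS : mu.-integrable `]s, t] (EFin \o (fun x => `|k n x|)).
    by apply: integrable_norm; exact: iS.
  have miS := iS _ mi.
  apply: ae_le_Rintegral => //.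
  apply: (ae_imp2 kae (ae_neq b)) => x xk xb; rewrite /= in_itv/= => /andP[sx xt].
  have [|_ ->] := xk n; last exact: um.
  by rewrite (le_lt_trans as_ sx) lt_neqAle xb (le_trans xt tb).
exists m; split => //.
apply: (ae_imp2 kae (integrable_slope mi)) => x xk xm xab e e0.
have /andP[ax xb] := xab.
have e20 : 0 < e / 2 by lra.
have [n mn] := adh x _ e20.
have [kn un] := xk n xab; rewrite -un in mn.
have [d1 d10 H1] := kn _ e20; have [d2 d20 H2] := xm _ e0.
exists (Num.min (Num.min (x - a) (b - x)) (Num.min d1 d2)).
  by rewrite !lt_min !subr_gt0 ax xb d10.
move=> v v0; rewrite !lt_min => /andP[/andP[vl vr] /andP[v1 v2]].
have [av vb] : a <= v /\ v <= b by move: vl vr; rewrite !ltr_norml; lra.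
have low : m x - e < d (g v) (g x) / `|v - x|.
  have h1 := H1 v v0 v1.
  apply: (@lt_le_trans _ _ (`|phi n v - phi n x| / `|v - x|)); last first.
    by rewrite ler_pM2r ?invr_gt0// dC phi_le.
  have := ler_normB ((phi n v - phi n x) / (v - x)) ((phi n v - phi n x) / (v - x) - k n x).
  by rewrite subKr normrM normfV; lra.
have upp : d (g v) (g x) / `|v - x| < m x + e.
  have h2 := H2 v v0 v2.
  apply: (@le_lt_trans _ _ (`|(\int[mu]_(t in `]-oo, v]) m t -
    \int[mu]_(t in `]-oo, x]) m t) / (v - x)|)); last first.
    have := ler_normD ((\int[mu]_(t in `]-oo, v]) m t -
      \int[mu]_(t in `]-oo, x]) m t) / (v - x) - m x) (m x).
    by rewrite subrK (ger0_norm (m0 x)); lra.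
  rewrite normrM normfV ler_pM2r ?invr_gt0//.
  have [xv|/ltW vx] := leP x v.
    rewrite integral_increment// dC; apply: le_trans (ler_norm _).
    by apply: minc => //; exact: ltW.
  rewrite distrC integral_increment//; apply: le_trans (ler_norm _).
  by apply: minc => //; exact: ltW.
by rewrite ltr_norml; lra.
Qed.

Lemma speed_at_ae :
  {ae mu, forall x, a < x < b -> exists l, speed_at d g x l}.
Proof.
have [m [_ _ mae _]] := metric_derivative.
by apply: (ae_imp mae) => x mx xab; exists (m x); exact: mx.
Qed.

(** To bound a distance it suffices to bound the speed where it exists, since it
agrees almost everywhere with a measurable function. *)
Lemma dist_le_integral (r : R -> \bar R) :
  (forall x, a <= x <= b -> (0 <= r x)%E) ->
  {ae mu, forall x, a < x < b -> forall l, speed_at d g x l -> (l%:E <= r x)%E} ->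
  ((d (g a) (g b))%:E <= \int[mu]_(x in `[a, b]) r x)%E.
Proof.
move=> r0 rae; have [m [m0 mi mae mE]] := metric_derivative.
have iS (i : interval R) : mu.-integrable [set` i] (EFin \o m).
  by apply: integrableS mi => //; exact: measurable_itv.
have mS (i : interval R) : measurable_fun [set` i] (EFin \o m) by exact: measurable_int (iS i).
apply: (@le_trans _ _ (\int[mu]_(x in `[a, b]) (m x)%:E)%E).
  rewrite -integral_itv_obnd_cbnd; last exact: mS.
  rewrite -[leRHS]fineK; last exact: integrable_fin_num.
  by rewrite lee_fin; exact: mE.
have mS' := mS `[a, b].
have r0' x : x \in `[a, b] -> (0 <= r x)%E by rewrite in_itv; exact: r0.
apply: ae_le_integral_ge0 => // [x _|]; first by rewrite lee_fin.
apply: (ae_imp2 (ae_imp2 mae rae (fun x p1 p2 => conj p1 p2))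
  (ae_imp2 (ae_neq a) (ae_neq b) (fun x p1 p2 => conj p1 p2))).
move=> x [xm xr] [xa xb]; rewrite /= in_itv/= => /andP[ax xb'].
have xab : a < x < b by rewrite !lt_neqAle eq_sym xa ax xb xb'.
by apply: xr => //; exact: xm.
Qed.

End metric_derivative.

Section subset_integral.
Context {dd : measure_display} {T : measurableType dd} {R : realType}.
Variable mu : {measure set T -> \bar R}.
Local Open Scope ereal_scope.

Lemma integral_subset_ge0 (A B : set T) (f : T -> \bar R) : A `<=` B ->
  (forall x, B x -> 0 <= f x) ->
  \int[mu]_(x in A) f x <= \int[mu]_(x in B) f x.
Proof.
move=> AB f0; rewrite integral_mkcond [leRHS]integral_mkcond.
apply: le_integral_ge0 => x _; first by apply: erestrict_ge0 => y /AB; exact: f0.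
rewrite !patchE; case: ifPn => [/set_mem/AB xB|_]; first by rewrite mem_set.
by case: ifPn => // /set_mem; exact: f0.
Qed.

End subset_integral.

Section speed_transfer.
Context {R : realType}.
Implicit Types (x l k : R).

Lemma metric_speed_eq (T T' : Type) (d : T -> T -> R) (d' : T' -> T' -> R) g g' x x' :
  (forall l, speed_at d g x l <-> speed_at d' g' x' l) ->
  metric_speed d g x = metric_speed d' g' x'.
Proof.
move=> H; have [[l sl]|no] := pselect (exists l, speed_at d g x l).
  by rewrite (metric_speedE sl); apply/esym/metric_speedE/H.
rewrite !metric_speed_none//; apply: contra_not no => -[l /H sl].
by exists l.
Qed.

Lemma speed_at_local (T : Type) (d : T -> T -> R) g g' x l e : 0 < e ->
  (forall u, `|u - x| < e -> g u = g' u) -> speed_at d g x l -> speed_at d g' x l.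
Proof.
move=> e0 H sl e' e'0; have [dl dl0 Hdl] := sl e' e'0.
exists (Num.min e dl); first by rewrite lt_min e0.
move=> u u0; rewrite lt_min => /andP[ue ud]; rewrite -!H//; first exact: Hdl.
by rewrite subrr normr0.
Qed.

Lemma metric_speed_local (T : Type) (d : T -> T -> R) g g' x e : 0 < e ->
  (forall u, `|u - x| < e -> g u = g' u) -> metric_speed d g x = metric_speed d g' x.
Proof.
move=> e0 H; apply: metric_speed_eq => l; split; apply: speed_at_local e0 _ => //.
by move=> u /H.
Qed.

Lemma metric_speed_shift (T : Type) (d : T -> T -> R) (g : R -> T) k x :
  metric_speed d (fun t => g (t + k)) x = metric_speed d g (x + k).
Proof.
apply: metric_speed_eq => l; split=> sl e e0; have [dl dl0 H] := sl e e0.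
  exists dl => // u u0 ud; have := H (u - k); rewrite subrK.
  by rewrite (_ : u - k - x = u - (x + k)); [exact|rewrite opprD; ring].
exists dl => // u u0 ud; have := H (u + k).
by rewrite (_ : u + k - (x + k) = u - x); [exact|ring].
Qed.

Lemma metric_speed_opp (T : Type) (d : T -> T -> R) (g : R -> T) x :
  metric_speed d (fun t => g (- t)) x = metric_speed d g (- x).
Proof.
apply: metric_speed_eq => l; split=> sl e e0; have [dl dl0 H] := sl e e0.
  exists dl => // u u0 ud; have := H (- u); rewrite opprK.
  by rewrite (_ : `|- u - x| = `|u - (- x)|); [exact|rewrite -normrN; congr `|_|; ring].
exists dl => // u u0 ud; have := H (- u).
by rewrite (_ : `|- u - - x| = `|u - x|); [exact|rewrite -normrN; congr `|_|; ring].
Qed.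

Lemma speed_at_scale (T : Type) (d : T -> T -> R) g x l k : 0 < k ->
  speed_at (fun y z => k * d y z) g x l -> speed_at d g x (l / k).
Proof.
move=> k0 sl e e0; have [dl dl0 H] := sl (k * e) (mulr_gt0 k0 e0).
exists dl => // u u0 ud; have := H u u0 ud.
rewrite (_ : k * d (g u) (g x) / `|u - x| - l = k * (d (g u) (g x) / `|u - x| - l / k)).
  by rewrite normrM gtr0_norm// ltr_pM2l.
by rewrite mulrBr mulrA mulrCA divff ?gt_eqF// mulr1.
Qed.

Lemma metric_speed_cst (T : Type) (d : T -> T -> R) (z : T) x :
  d z z = 0 -> metric_speed d (fun=> z) x = 0.
Proof.
move=> dz; apply: metric_speedE => e e0; exists 1 => // u _ _.
by rewrite dz mul0r subrr normr0.
Qed.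

End speed_transfer.

Section arc_length.
Context {R : realType} {T : Type} (d : T -> T -> R).
Hypothesis dP : pseudometric d.

(** Reparametrization by arc length. The parameter of a point of length s is
taken to be the largest one, which makes sense without continuity of the
length function. *)
Lemma lipschitz_reparametrization (g : R -> T) (f : R -> R) (a b : R) :
  is_path d g a b -> dominated d g f a b -> exists c : R -> T,
  [/\ d (g a) (c 0) = 0, c (f b - f a) = g b &
      forall s t, d (c s) (c t) <= `|t - s|].
Proof.
move=> [ab gc] dom; have [dxx dC dT] := dP.
have fnd := dominated_le dP dom.
have d0 x y : 0 <= d x y by exact: pseudometric_ge0.
pose A s := [set t | a <= t <= b /\ f t - f a <= s].
pose tau s := sup (A s).
have ub s : has_ubound (A s) by exists b => t [/andP[]].
have Aa s : 0 <= s -> A s a by move=> s0; split; rewrite ?lexx ?ab// subrr.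
have tab s : 0 <= s -> a <= tau s <= b.
  move=> s0; rewrite /tau ub_le_sup//=; last exact: Aa.
  by apply: ge_sup; [exists a; exact: Aa|move=> t [/andP[]]].
have tau_adh s e : 0 <= s -> 0 < e -> exists t, [/\ A s t, tau s - e < t & t <= tau s].
  move=> s0 e0; have [|t At tt] := @sup_adherent _ (A s) _ e0.
    by split; [exists a; exact: Aa|exact: ub].
  by exists t; split => //; exact: ub_le_sup.
have key s s' : 0 <= s -> s <= s' -> d (g (tau s)) (g (tau s')) <= s' - s.
  move=> s0 ss'; have s'0 := le_trans s0 ss'.
  have [<-|neq] := eqVneq (tau s) (tau s'); first by rewrite dxx subr_ge0.
  have tlt : tau s < tau s'.
    rewrite lt_neqAle neq/=; apply: ge_sup; first by exists a; exact: Aa.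
    by move=> t [tab' ft]; apply: ub_le_sup => //; split => //; exact: le_trans ss'.
  apply/ler_addgt0Pr => e e0; have e20 : 0 < e / 2 by rewrite divr_gt0.
  have ts : tau s \in `[a, b] by rewrite in_itv/= tab.
  have ts' : tau s' \in `[a, b] by rewrite in_itv/= tab.
  have [d1 d10 H1] := gc _ ts _ e20; have [d2 d20 H2] := gc _ ts' _ e20.
  have [|t' [[t'ab ft'] t'1 t'2]] := @tau_adh s' (Num.min d2 (tau s' - tau s)) s'0.
    by rewrite lt_min d20 subr_gt0.
  have t't : tau s < t'.
    have : Num.min d2 (tau s' - tau s) <= tau s' - tau s by rewrite ge_min lexx orbT.
    lra.
  have t'd : tau s' - t' < d2.
    have : Num.min d2 (tau s' - tau s) <= d2 by rewrite ge_min lexx.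
    lra.
  pose t := tau s + Num.min d1 (t' - tau s) / 2.
  have m0 : 0 < Num.min d1 (t' - tau s) by rewrite lt_min d10 subr_gt0.
  have m1 : Num.min d1 (t' - tau s) <= d1 by rewrite ge_min lexx.
  have m2 : Num.min d1 (t' - tau s) <= t' - tau s by rewrite ge_min lexx orbT.
  have tst : tau s < t by rewrite /t; lra.
  have tt' : t < t' by rewrite /t; lra.
  have td : t - tau s < d1 by rewrite /t; lra.
  have [/andP[ats _] /andP[at' t'b]] := (tab _ s0, t'ab).
  have tab' : a <= t <= b by apply/andP; split; lra.
  have st : s < f t - f a.
    rewrite ltNge; apply/negP => fts.
    by have : t <= tau s; [apply: ub_le_sup|lra].
  have h1 : d (g (tau s)) (g t) < e / 2.
    by apply: H1; rewrite ?in_itv//= gtr0_norm; lra.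
  have h2 : d (g (tau s')) (g t') < e / 2.
    by apply: H2; rewrite ?in_itv//= distrC ger0_norm; lra.
  have h3 : d (g t) (g t') <= f t' - f t.
    by case/andP: tab' => h _; apply: dom => //; exact: ltW.
  have := dT (g (tau s)) (g t) (g (tau s')); have := dT (g t) (g t') (g (tau s')).
  by rewrite (dC (g t') (g (tau s'))); lra.
have fab : 0 <= f b - f a by rewrite subr_ge0 fnd.
have tauE : tau (f b - f a) = b.
  apply/eqP; rewrite eq_le; case/andP: (tab _ fab) => _ -> /=.
  by apply: ub_le_sup => //; split; rewrite ?ab ?lexx.
pose cl s := Num.max 0 (Num.min s (f b - f a)).
have cl0 s : 0 <= cl s by rewrite /cl le_max lexx.
have cl_lip s t : s <= t -> 0 <= cl t - cl s <= t - s.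
  rewrite /cl; move: (f b - f a) fab => L L0 st.
  have [sb|bs] := leP s L; have [tb|bt] := leP t L.
  - by have [ax|xa] := leP 0 s; have [ay|ya] := leP 0 t; lra.
  - by have [ax|xa] := leP 0 s; rewrite (max_idPr L0); lra.
  - by lra.
  - by lra.
exists (fun s => g (tau (cl s))); split.
- rewrite (_ : cl 0 = 0); last by rewrite /cl (min_idPl fab) maxxx.
  apply/eqP; rewrite eq_le d0 andbT; apply/ler_addgt0Pr => e e0; rewrite add0r.
  have ts : tau 0 \in `[a, b] by rewrite in_itv/= tab.
  have [d1 d10 H1] := gc _ ts _ e0.
  have [t [[tab' ft] t1 t2]] := tau_adh 0 _ (lexx 0) d10.
  have h1 : d (g (tau 0)) (g t) < e.
    by apply: H1; rewrite ?in_itv//= distrC ger0_norm; lra.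
  have h2 : d (g a) (g t) <= f t - f a by case/andP: tab' => h1' h2'; apply: dom.
  have := dT (g a) (g t) (g (tau 0)); rewrite (dC (g t) (g (tau 0))); lra.
- by rewrite (_ : cl _ = f b - f a) ?tauE// /cl minxx (max_idPr fab).
- move=> s t; have [st|/ltW ts] := leP s t.
    have /andP[h1 h2] := cl_lip _ _ st.
    rewrite ger0_norm ?subr_ge0//; apply: le_trans h2; apply: key => //.
    by rewrite -subr_ge0.
  have /andP[h1 h2] := cl_lip _ _ ts.
  rewrite distrC ger0_norm ?subr_ge0// dC; apply: le_trans h2; apply: key => //.
  by rewrite -subr_ge0.
Qed.

End arc_length.

(** * The warped distance *)

Lemma l1_dist_pseudometric (R : realType) (X Y : pmetricType R) :
  pseudometric (@l1_dist R X Y).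
Proof.
rewrite /l1_dist; split=> [z|z z'|z w z'].
- by rewrite !mdistxx addr0.
- by rewrite metric_sym [X in _ + X]metric_sym.
- by rewrite addrACA lerD// metric_triangle.
Qed.

Section warping_norm.
Context {R : realType} (N : R * R -> R).
Hypothesis hN : warping_norm N.

Lemma warping_normx0 x : 0 <= x -> N (x, 0) = x.
Proof.
move=> x0; have := wnorm_homogeneous hN x (1, 0); rewrite /= mulr1 mulr0 => ->.
by rewrite (wnorm_unitary hN).1 mulr1 ger0_norm.
Qed.

Lemma warping_norm0x x : 0 <= x -> N (0, x) = x.
Proof.
move=> x0; have := wnorm_homogeneous hN x (0, 1); rewrite /= mulr1 mulr0 => ->.
by rewrite (wnorm_unitary hN).2 mulr1 ger0_norm.
Qed.

Lemma warping_norm_ge1 x y : 0 <= x -> 0 <= y -> x <= N (x, y).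
Proof.
by move=> x0 y0; rewrite -[leLHS](warping_normx0 x0); apply: (wnorm_increasing hN).
Qed.

Lemma warping_norm_ge2 x y : 0 <= x -> 0 <= y -> y <= N (x, y).
Proof.
by move=> x0 y0; rewrite -[leLHS](warping_norm0x y0); apply: (wnorm_increasing hN).
Qed.

End warping_norm.

Section warped_distance.
Context {R : realType} (N : R * R -> R) {X Y : pmetricType R} (phi : X -> R).
Hypothesis hN : warping_norm N.
Hypothesis phi0 : forall x, 0 <= phi x.
Local Notation mu := (@lebesgue_measure R).
Implicit Types (c : R -> X * Y) (a b : R) (z : X * Y).

Let dXP : pseudometric (@mdist R X) := mdist_pseudometric X.
Let dYP : pseudometric (@mdist R Y) := mdist_pseudometric Y.
Let l1P : pseudometric (@l1_dist R X Y) := l1_dist_pseudometric X Y.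

Definition warped_speed c t := N (metric_speed (@mdist R X) (fst \o c) t,
  phi (c t).1 * metric_speed (@mdist R Y) (snd \o c) t).

Lemma warped_lengthE c a b :
  warped_length N phi c a b = (\int[mu]_(t in `[a, b]) (warped_speed c t)%:E)%E.
Proof. by []. Qed.

Let sX0 c t : 0 <= metric_speed (@mdist R X) (fst \o c) t.
Proof. exact: metric_speed_ge0. Qed.

Let sY0 c t : 0 <= phi (c t).1 * metric_speed (@mdist R Y) (snd \o c) t.
Proof. by rewrite mulr_ge0//; exact: metric_speed_ge0. Qed.

Lemma warped_speed_ge0 c t : 0 <= warped_speed c t.
Proof. exact: le_trans (sX0 c t) (warping_norm_ge1 hN (sX0 c t) (sY0 c t)). Qed.

Lemma dominated_fst c f a b : dominated (@l1_dist R X Y) c f a b ->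
  dominated (@mdist R X) (fst \o c) f a b.
Proof.
move=> dom s t as_ st tb; apply: le_trans (dom _ _ as_ st tb).
by rewrite /l1_dist lerDl mdist_ge0.
Qed.

Lemma dominated_snd c f a b : dominated (@l1_dist R X Y) c f a b ->
  dominated (@mdist R Y) (snd \o c) f a b.
Proof.
move=> dom s t as_ st tb; apply: le_trans (dom _ _ as_ st tb).
by rewrite /l1_dist lerDr mdist_ge0.
Qed.

Lemma dominated_sub (T : Type) (d : T -> T -> R) (g : R -> T) f a b a' b' :
  a <= a' -> b' <= b -> dominated d g f a b -> dominated d g f a' b'.
Proof. by move=> aa bb dom s t as_ st tb; apply: dom => //; lra. Qed.

Lemma acont_sub f a b a' b' : a <= a' -> b' <= b ->
  absolutely_continuous_on f a b -> absolutely_continuous_on f a' b'.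
Proof.
move=> aa bb fac e e0; have [dl dl0 H] := fac e e0; exists dl => // n s t st.
by apply: H => i; have := st i; lra.
Qed.

Lemma warped_length_ge1 c f a b : a <= b -> absolutely_continuous_on f a b ->
  dominated (@l1_dist R X Y) c f a b ->
  ((mdist (c a).1 (c b).1)%:E <= warped_length N phi c a b)%E.
Proof.
move=> ab fac dom; rewrite warped_lengthE.
apply: (dist_le_integral dXP ab fac (dominated_fst dom)) => [x _|].
  by rewrite lee_fin warped_speed_ge0.
apply: aeW => x _ l /metric_speedE <-.
by rewrite lee_fin; exact: warping_norm_ge1.
Qed.

(** Either the first coordinate travels as far as e, or it stays where phi is at
least m, and then the length is at least that of the second coordinate for the
scaled distance. *)
Lemma warped_length_ge2 c f a b e m : a <= b -> absolutely_continuous_on f a b ->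
  dominated (@l1_dist R X Y) c f a b ->
  0 <= m -> (forall x, mdist (c a).1 x < e -> m <= phi x) ->
  ((Num.min e (m * mdist (c a).2 (c b).2))%:E <= warped_length N phi c a b)%E.
Proof.
move=> ab fac dom m0 me.
have [[t [/andP[at_ tb] et]]|no] :=
    pselect (exists t, a <= t <= b /\ e <= mdist (c a).1 (c t).1).
  apply: (@le_trans _ _ (warped_length N phi c a t)).
    apply: le_trans (warped_length_ge1 at_ (acont_sub (lexx a) tb fac)
      (dominated_sub (lexx a) tb dom)).
    by rewrite lee_fin ge_min et.
  rewrite !warped_lengthE; apply: integral_subset_ge0.
    by move=> x /=; rewrite !in_itv/= => /andP[-> xt]; exact: le_trans tb.
  by move=> x _; rewrite lee_fin warped_speed_ge0.
apply: (@le_trans _ _ (m * mdist (c a).2 (c b).2)%:E).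
  by rewrite lee_fin ge_min lexx orbT.
have mP : pseudometric (fun y y' : Y => m * mdist y y').
  case: dYP => h1 h2 h3; split=> [y|y y'|y w y']; first by rewrite h1 mulr0.
    by rewrite h2.
  by rewrite -mulrDr ler_wpM2l.
have mdom : dominated (fun y y' : Y => m * mdist y y') (snd \o c) (fun t => m * f t) a b.
  by move=> s t as_ st tb; rewrite -mulrBr ler_wpM2l//; exact: (dominated_snd dom).
rewrite warped_lengthE.
apply: (dist_le_integral mP ab (acont_scale m fac) mdom) => [x _|].
  by rewrite lee_fin warped_speed_ge0.
apply: aeW => x /andP[ax xb] l sl; rewrite lee_fin.
apply: le_trans (warping_norm_ge2 hN (sX0 c x) (sY0 c x)).
move: m0; rewrite le_eqVlt => /predU1P[m0|m0].
  move/metric_speedE: sl => <-; apply: le_trans (sY0 c x); rewrite le_eqVlt; apply/orP; left.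
  apply/eqP/metric_speedE => e' e'0; exists 1 => // u _ _.
  by rewrite -m0 !mul0r subrr normr0.
rewrite (metric_speedE (speed_at_scale m0 sl)).
have l0 : 0 <= l.
  by apply: speed_at_ge sl; exists 1 => // u _ _; rewrite mul0r mulr_ge0 ?mdist_ge0 ?ltW.
have mphi : m <= phi (c x).1.
  apply: me; rewrite ltNge; apply/negP => ex; apply: no; exists x.
  by split => //; apply/andP; split; exact: ltW.
by rewrite mulrCA ler_peMr// ler_pdivlMr// mul1r.
Qed.

Definition warped_lengths z z' : set (\bar R) := [set l | exists c a b,
    [/\ ac_path (@l1_dist R X Y) c a b, c a = z, c b = z' & l = warped_length N phi c a b]].

(** The warped distance before its real part is taken, for use while its
finiteness is not known. *)
Definition warped_edist z z' : \bar R := ereal_inf (warped_lengths z z').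

Lemma warped_pdistE z z' : warped_pdist N phi z z' = fine (warped_edist z z').
Proof. by []. Qed.

Lemma warped_edist_ge0 z z' : (0 <= warped_edist z z')%E.
Proof.
apply: le_ereal_inf_tmp => _ [c [a [b [_ _ _ ->]]]]; rewrite warped_lengthE.
by apply: integral_ge0 => t _; rewrite lee_fin warped_speed_ge0.
Qed.

Lemma warped_edist_le c f a b : a <= b -> absolutely_continuous_on f a b ->
  dominated (@l1_dist R X Y) c f a b ->
  (warped_edist (c a) (c b) <= warped_length N phi c a b)%E.
Proof.
move=> ab fac dom; apply: ereal_inf_lbound; exists c, a, b.
by split => //; exact: (dominated_ac_path l1P ab fac dom).
Qed.

Lemma warped_edistxx z : warped_edist z z = 0%E.
Proof.
apply/eqP; rewrite eq_le warped_edist_ge0 andbT.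
have := @warped_edist_le (fun=> z) id 0 0 (lexx _) (@acont_id _ 0 0).
rewrite warped_lengthE set_itv1 integral_set1; apply.
by move=> s t s0 st t0; case: l1P => -> _ _; rewrite subr_ge0.
Qed.

Lemma warped_edist_ge1 z z' : ((mdist z.1 z'.1)%:E <= warped_edist z z')%E.
Proof.
apply: le_ereal_inf_tmp => _ [c [a [b [cP <- <- ->]]]].
have [ab [f fac dom]] := ac_path_dominated l1P cP.
exact: warped_length_ge1 fac dom.
Qed.

Lemma warped_edist_ge2 z z' e m : 0 <= m ->
  (forall x, mdist z.1 x < e -> m <= phi x) ->
  ((Num.min e (m * mdist z.2 z'.2))%:E <= warped_edist z z')%E.
Proof.
move=> m0 me; apply: le_ereal_inf_tmp => _ [c [a [b [cP ca <- ->]]]].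
rewrite -ca in me *.
have [ab [f fac dom]] := ac_path_dominated l1P cP.
exact: warped_length_ge2 fac dom m0 me.
Qed.

Lemma warped_edist_sym_le z z' : (warped_edist z' z <= warped_edist z z')%E.
Proof.
apply: le_ereal_inf_tmp => _ [c [a [b [cP <- <- ->]]]].
have [ab [f fac dom]] := ac_path_dominated l1P cP.
pose c' t := c (- t).
have h : (warped_edist (c' (- b)%R) (c' (- a)%R) <= warped_length N phi c' (- b)%R (- a)%R)%E.
  apply: (@warped_edist_le _ (fun t => - f (- t))); first by rewrite lerN2.
    exact: acont_opp.
  move=> s t bs st ta; rewrite /c'; case: l1P => _ -> _.
  rewrite opprK addrC; apply: dom; lra.
move: h; rewrite /c' !opprK => /le_trans; apply.
rewrite !warped_lengthE.
have -> : `[(- b), (- a)]%classic = -%R @^-1` `[a, b].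
  by apply/seteqP; split => x /=; rewrite !in_itv/=; lra.
apply: le_trans (le_integral_opp (f := fun t => (warped_speed c t)%:E) _); last first.
  by move=> x _; rewrite lee_fin warped_speed_ge0.
apply: le_integral_ge0 => x _; first by rewrite lee_fin warped_speed_ge0.
rewrite lee_fin /warped_speed /c'.
rewrite (metric_speed_opp (@mdist R X) (fst \o c)).
by rewrite (metric_speed_opp (@mdist R Y) (snd \o c)).
Qed.

Lemma warped_edistC z z' : warped_edist z z' = warped_edist z' z.
Proof. by apply/eqP; rewrite eq_le !warped_edist_sym_le. Qed.

(** The speed of the concatenation is that of one of the two paths, except at the
junction, which is a null set. *)
Lemma warped_edist_concat c1 f1 a b c2 f2 b' : a <= b -> b <= b' ->
  absolutely_continuous_on f1 a b -> dominated (@l1_dist R X Y) c1 f1 a b ->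
  absolutely_continuous_on f2 b b' -> dominated (@l1_dist R X Y) c2 f2 b b' ->
  c1 b = c2 b ->
  (warped_edist (c1 a) (c2 b') <=
   warped_length N phi c1 a b + warped_length N phi c2 b b')%E.
Proof.
move=> ab bb' ac1 dom1 ac2 dom2 cb.
pose c t := if t <= b then c1 t else c2 t.
pose f t := f1 (Num.min t b) + f2 (Num.max t b).
have ac : absolutely_continuous_on f a b'.
  apply: (acont_sum_le (f1 := fun t => f1 (Num.min t b)) (f2 := fun t => f2 (Num.max t b))).
  - apply: (acont_comp (sg := fun t => Num.min t b) ac1).
      by move=> s /andP[as_ sb]; rewrite le_min as_ ab ge_min lexx orbT.
    move=> s t as_ st tb; have [tb'|bt] := leP t b; have [sb|bs] := leP s b; lra.
  - apply: (acont_comp (sg := fun t => Num.max t b) ac2).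
      by move=> s /andP[as_ sb]; rewrite le_max lexx orbT ge_max sb bb'.
    move=> s t as_ st tb; have [tb'|bt] := leP t b; have [sb|bs] := leP s b; lra.
  - move=> s t as_ st tb; rewrite /f.
    rewrite (_ : f1 (Num.min t b) + f2 (Num.max t b) - (f1 (Num.min s b) + f2 (Num.max s b)) =
      (f1 (Num.min t b) - f1 (Num.min s b)) + (f2 (Num.max t b) - f2 (Num.max s b))); last by ring.
    exact: ler_normD.
have dom : dominated (@l1_dist R X Y) c f a b'.
  move=> s t as_ st tb; rewrite /c /f.
  have [tb'|bt] := leP t b; have [sb|bs] := leP s b.
  - by have := dom1 _ _ as_ st tb'; lra.
  - lra.
  - have h1 := dom1 _ _ as_ sb (lexx b); have h2 := dom2 _ _ (lexx b) (ltW bt) tb.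
    case: l1P => _ _ /(_ (c1 s) (c1 b) (c2 t)); rewrite {2}cb; lra.
  - by have := dom2 _ _ (ltW bs) st tb; lra.
have ab' := le_trans ab bb'.
have := warped_edist_le ab' ac dom.
rewrite /c ab; have -> : (if b' <= b then c1 b' else c2 b') = c2 b'.
  by case: ifPn => // b'b; rewrite (_ : b' = b)//; apply/eqP; rewrite eq_le b'b.
move/le_trans; apply; rewrite -/c !warped_lengthE.
have -> : `[a, b']%classic = `[a, b[ `|` (`[b, b] `|` `]b, b']).
  apply/seteqP; split => x /=; rewrite !in_itv/=.
    move=> /andP[ax xb]; have [xb'|bx|xb'] := ltgtP x b; [left|right; right|right; left].
    - by rewrite ax.
    - by [].
    - by [].
  by case=> [/andP[? ?]|[/andP[? ?]|/andP[? ?]]]; apply/andP; split; lra.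
have ws0 x : (0 <= (warped_speed c x)%:E)%E by rewrite lee_fin warped_speed_ge0.
apply: le_trans (ge0_integral_setU_le _ _ _ _) _ => //.
  by apply: measurableU; exact: measurable_itv.
apply: leeD.
  apply: (@le_trans _ _ (\int[mu]_(x in `[a, b[) (warped_speed c1 x)%:E)%E); last first.
    apply: integral_subset_ge0 => [x /=|x _]; last by rewrite lee_fin warped_speed_ge0.
    by rewrite !in_itv/= => /andP[-> /ltW].
  apply: le_integral_ge0 => // x /=; rewrite in_itv/= => /andP[ax xb].
  have bx0 : 0 < b - x by rewrite subr_gt0.
  have cE u : `|u - x| < b - x -> c u = c1 u.
    by rewrite /c ltr_norml => /andP[_ h]; rewrite ifT//; lra.
  rewrite lee_fin /warped_speed cE ?subrr ?normr0//.
  rewrite (metric_speed_local (@mdist R X) (g' := fst \o c1) bx0); last by move=> u /cE /= ->.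
  by rewrite (metric_speed_local (@mdist R Y) (g' := snd \o c1) bx0)// => u /cE /= ->.
apply: le_trans (ge0_integral_setU_le _ _ _ _) _ => //.
rewrite set_itv1 integral_set1 add0e.
apply: (@le_trans _ _ (\int[mu]_(x in `]b, b']) (warped_speed c2 x)%:E)%E); last first.
  apply: integral_subset_ge0 => [x /=|x _]; last by rewrite lee_fin warped_speed_ge0.
  by rewrite !in_itv/= => /andP[/ltW ->].
apply: le_integral_ge0 => // x /=; rewrite in_itv/= => /andP[ax xb].
have bx0 : 0 < x - b by rewrite subr_gt0.
have cE u : `|u - x| < x - b -> c u = c2 u.
  by rewrite /c ltr_norml => /andP[h _]; rewrite ifF//; apply/negbTE; rewrite -ltNge; lra.
rewrite lee_fin /warped_speed cE ?subrr ?normr0//.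
rewrite (metric_speed_local (@mdist R X) (g' := fst \o c2) bx0); last by move=> u /cE /= ->.
by rewrite (metric_speed_local (@mdist R Y) (g' := snd \o c2) bx0)// => u /cE /= ->.
Qed.

Lemma warped_edist_triangle z w z' :
  (warped_edist z z' <= warped_edist z w + warped_edist w z')%E.
Proof.
have [->|f1] := eqVneq (warped_edist z w) +oo%E.
  by rewrite addye ?leey// -ltNye (lt_le_trans _ (warped_edist_ge0 _ _)).
have [->|f2] := eqVneq (warped_edist w z') +oo%E.
  by rewrite addey ?leey// -ltNye (lt_le_trans _ (warped_edist_ge0 _ _)).
have {}f1 : warped_edist z w \is a fin_num.
  by rewrite ge0_fin_numE ?warped_edist_ge0// ltey.
have {}f2 : warped_edist w z' \is a fin_num.
  by rewrite ge0_fin_numE ?warped_edist_ge0// ltey.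
apply/lee_addgt0Pr => e e0; have e20 : 0 < e / 2 by rewrite divr_gt0.
have [_ [c1 [a1 [b1 [c1P c1a c1b ->]]]] h1] := lb_ereal_inf_adherent e20 f1.
have [_ [c2 [a2 [b2 [c2P c2a c2b ->]]]] h2] := lb_ereal_inf_adherent e20 f2.
have [ab1 [g1 ac1 dom1]] := ac_path_dominated l1P c1P.
have [ab2 [g2 ac2 dom2]] := ac_path_dominated l1P c2P.
pose k := a2 - b1.
have kb : b1 + k = a2 by rewrite /k addrC subrK.
pose c2' t := c2 (t + k).
have := @warped_edist_concat c1 g1 a1 b1 c2' (fun t => g2 (t + k)) (b2 - k).
rewrite /c2' kb c1a c1b subrK c2a c2b => H.
apply: (@le_trans _ _ (warped_length N phi c1 a1 b1 + warped_length N phi c2' b1 (b2 - k)%R)%E).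
  apply: H => //.
  - by rewrite /k; lra.
  - apply: (acont_comp (sg := fun t => t + k) ac2) => [s|s t _ st _].
      by rewrite /k; lra.
    by apply/andP; split; lra.
  - by move=> s t bs st tb; apply: dom2; rewrite /k in tb *; lra.
have h3 : (warped_length N phi c2' b1 (b2 - k)%R <= warped_length N phi c2 a2 b2)%E.
  rewrite !warped_lengthE.
  have -> : `[b1, (b2 - k)]%classic = (fun x => x + k) @^-1` `[a2, b2].
    by apply/seteqP; split => x /=; rewrite !in_itv/= /k; lra.
  apply: le_trans (le_integral_shift (f := fun t => (warped_speed c2 t)%:E) k _); last first.
    by move=> x _; rewrite lee_fin warped_speed_ge0.
  apply: le_integral_ge0 => x _; first by rewrite lee_fin warped_speed_ge0.
  rewrite lee_fin /warped_speed /c2'.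
  rewrite (metric_speed_shift (@mdist R X) (fst \o c2)).
  by rewrite (metric_speed_shift (@mdist R Y) (snd \o c2)).
apply: le_trans (leeD (ltW h1) (le_trans h3 (ltW h2))) _.
by rewrite addeACA -EFinD -splitr.
Qed.

(** An almost shortest path of Y, parametrized by arc length inside the fibre
over x, has warped speed at most phi x. *)
Lemma warped_edist_fiber x y y' : length_space (@mdist R Y) ->
  (warped_edist (x, y) (x, y') <= (phi x * mdist y y')%:E)%E.
Proof.
move=> [_ lenY]; apply/lee_addgt0Pr => e e0.
have k0 : 0 < phi x + 1 by rewrite ltr_pwDr.
have e'0 : 0 < e / (phi x + 1) by rewrite divr_gt0.
have : (ereal_inf [set l | exists g a b, [/\ rectifiable (@mdist R Y) g a b, g a = y,
  g b = y' & l = path_length (@mdist R Y) g a b]])%E \is a fin_num by rewrite -lenY.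
move=> /(lb_ereal_inf_adherent e'0)[_ [g [a [b [grect ga gb ->]]]]]; rewrite -lenY => gl.
have gdom := rectifiable_dominated dYP grect.
have ab : a <= b by case: grect => -[].
have [c [c0 cl cL]] := lipschitz_reparametrization dYP grect.1 gdom.
move: c0 cl; rewrite ga gb; set L := _ - _ => c0 cl.
have La : (path_length (@mdist R Y) g a a < +oo)%E.
  apply: le_lt_trans grect.2; apply: le_trans (path_length_rcons dYP g (lexx a) ab).
  by rewrite leeDl// lee_fin mdist_ge0.
have L0 : 0 <= L by rewrite /L subr_ge0; exact: (dominated_le dYP gdom).
have Ll : (L%:E <= path_length (@mdist R Y) g a b)%E.
  rewrite -(fineK (_ : path_length (@mdist R Y) g a b \is a fin_num)).
    by rewrite lee_fin /L lerBlDr lerDl fine_ge0// path_length_ge0.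
  by rewrite ge0_fin_numE ?path_length_ge0// grect.2.
have dom : dominated (@l1_dist R X Y) (fun t => (x, c t)) id 0 L.
  move=> s t _ st _; rewrite /l1_dist/= mdistxx add0r; apply: le_trans (cL s t) _.
  by rewrite ger0_norm// subr_ge0.
have := warped_edist_le L0 (@acont_id _ _ _) dom.
rewrite /= cl -(mdist_positivity _ _ c0) => /le_trans; apply.
rewrite warped_lengthE.
apply: (@le_trans _ _ (\int[mu]_(t in `[0%R, L]) (cst (phi x)%:E) t)%E).
  apply: le_integral_ge0 => t _; rewrite lee_fin ?warped_speed_ge0//.
  rewrite /warped_speed (_ : fst \o _ = fun=> x)// metric_speed_cst ?mdistxx//.
  rewrite warping_norm0x//; last by rewrite mulr_ge0// metric_speed_ge0.
  rewrite ler_piMr//; apply: metric_speed_le => //; exists 1 => // u _ _.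
  by rewrite mul1r distrC.
rewrite integral_cst; last exact: measurable_itv.
rewrite /= lebesgue_measure_itv/= lte_fin.
apply: (@le_trans _ _ (phi x * L)%:E).
  case: ifPn => [_|]; first by rewrite -EFinD -EFinM oppr0 addr0.
  by rewrite mule0 lee_fin mulr_ge0.
have LL : L <= mdist y y' + e / (phi x + 1).
  by rewrite -lee_fin EFinD; exact: le_trans Ll (ltW gl).
rewrite -EFinD lee_fin; apply: le_trans (ler_wpM2l (phi0 x) LL) _.
rewrite mulrDr lerD2l mulrCA ler_piMr ?(ltW e0)//.
by rewrite ler_pdivrMr// mul1r lerDl.
Qed.

End warped_distance.

Section metric_quotient.
Context {R : realType} {T : pointedType} (d : T -> T -> R).
Hypothesis dP : pseudometric d.

(** The representative through which distances in the quotient are computed. *)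
Definition mquot_repr (q : mquot d) : T := get (sval q).

Lemma mquot_reprP z : d z (mquot_repr (mquot_pi d z)) = 0.
Proof.
apply: (@getPex _ (fun z' => d z z' = 0)).
by exists z; case: dP.
Qed.

Let eq_dist z z' w : d z z' = 0 -> d z w = d z' w.
Proof.
case: dP => _ dC dT zz'; apply/eqP; rewrite eq_le.
have h1 := dT z z' w; have h2 := dT z' z w.
by move: h1 h2; rewrite (dC z' z) zz' !add0r => -> ->.
Qed.

Lemma mquot_pi_eq z z' : d z z' = 0 -> mquot_pi d z = mquot_pi d z'.
Proof.
move=> zz'; apply: eq_exist.
by apply/funext => w; rewrite /= (eq_dist w zz').
Qed.

Lemma mquot_reprK q : mquot_pi d (mquot_repr q) = q.
Proof.
have [z ->] : exists z, q = mquot_pi d z.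
  by case: q => A [z Az]; exists z; exact: eq_exist.
by apply/esym/mquot_pi_eq/mquot_reprP.
Qed.

Lemma mquot_distE z z' : mquot_dist (mquot_pi d z) (mquot_pi d z') = d z z'.
Proof.
rewrite /mquot_dist -/(mquot_repr _) -/(mquot_repr (mquot_pi d z')).
have [_ dC _] := dP.
rewrite -(eq_dist _ (mquot_reprP z)) dC -(eq_dist _ (mquot_reprP z')).
exact: dC.
Qed.

Lemma mquot_dist_pseudometric : pseudometric (@mquot_dist R T d).
Proof.
by case: dP => h1 h2 h3; split => *; rewrite /mquot_dist; [exact: h1|exact: h2|exact: h3].
Qed.

End metric_quotient.

Section warped_halfline.
Context {R : realType} (N : R * R -> R) {Y : pmetricType R} (W : R -> R).
Hypothesis hN : warping_norm N.
Hypothesis W0 : forall t, 0 <= t -> 0 <= W t.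
Hypothesis lenY : length_space (@mdist R Y).
Implicit Types (s t : halfline R) (y : Y) (z : halfline R * Y).

Lemma halfline_of_subproof (x : R) : 0 <= Num.max 0 x.
Proof. by rewrite le_max lexx. Qed.

Definition halfline_of (x : R) : halfline R :=
  exist (fun t : R => is_true (0 <= t)) _ (halfline_of_subproof x).

Lemma halfline_ofK t : halfline_of (sval t) = t.
Proof.
case: t => t t0; rewrite /halfline_of/=; apply: eq_exist => /=.
exact: (max_idPr t0).
Qed.

Lemma sval_halfline_of (x : R) : 0 <= x -> sval (halfline_of x) = x.
Proof. by move=> x0 /=; exact: (max_idPr x0). Qed.

Lemma halfline_ge0 t : 0 <= sval t. Proof. exact: (svalP t). Qed.

Lemma mdist_halfline s t : mdist s t = `|sval s - sval t|.
Proof. by []. Qed.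

Lemma halfline_of_lip (x x' : R) : mdist (halfline_of x) (halfline_of x') <= `|x - x'|.
Proof.
rewrite mdist_halfline/=; have [x0|x0] := leP 0 x; have [x'0|x'0] := leP 0 x'.
- by [].
- rewrite subr0 ger0_norm// ger0_norm; lra.
- rewrite sub0r normrN ger0_norm// distrC ger0_norm; lra.
- by rewrite subrr normr0.
Qed.

Let phi (t : halfline R) := W (sval t).

Let phi0 t : 0 <= phi t. Proof. exact: W0 (halfline_ge0 t). Qed.

Local Notation ed := (warped_edist N phi).
Local Notation wd := (@warped_pdist R N (halfline R) Y phi).

Let ed_vertical_le (s t : R) y : 0 <= s -> s <= t ->
  (ed (halfline_of s, y) (halfline_of t, y) <= (t - s)%:E)%E.
Proof.
move=> s0 st.
pose c x := (halfline_of x, y).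
have dom : dominated (@l1_dist R (halfline R) Y) c id s t.
  move=> u v su uv vt; rewrite /l1_dist/= mdistxx addr0.
  apply: le_trans (halfline_of_lip u v) _; rewrite distrC ger0_norm// subr_ge0//.
apply: le_trans (@warped_edist_le R N _ Y phi c id s t st (@acont_id R s t) dom) _.
rewrite warped_lengthE.
apply: (@le_trans _ _ (\int[@lebesgue_measure R]_(x in `[s, t]) (cst 1%:E) x)%E).
  apply: le_integral_ge0 => x _; rewrite lee_fin ?warped_speed_ge0//.
  rewrite /warped_speed (_ : snd \o c = fun=> y)// metric_speed_cst ?mdistxx// mulr0.
  rewrite (warping_normx0 hN); last by apply: metric_speed_ge0; exact: mdist_pseudometric.
  apply: metric_speed_le => //; exists 1 => // u _ _.
  by rewrite mul1r; exact: halfline_of_lip.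
rewrite integral_cst; last exact: measurable_itv.
rewrite /= lebesgue_measure_itv/= lte_fin mul1e; case: ifPn => [_|_].
  by rewrite -EFinB.
by rewrite lee_fin subr_ge0.
Qed.

Let ed_vertical s t y : (ed (s, y) (t, y) <= `|sval s - sval t|%:E)%E.
Proof.
rewrite -(halfline_ofK s) -(halfline_ofK t).
rewrite !(sval_halfline_of (halfline_ge0 _)).
have [st|/ltW ts] := leP (sval s) (sval t).
  by rewrite distrC ger0_norm ?subr_ge0// ed_vertical_le// halfline_ge0.
by rewrite warped_edistC// ger0_norm ?subr_ge0// ed_vertical_le// halfline_ge0.
Qed.

Let ed_le z z' : (ed z z' <= (`|sval z.1 - sval z'.1| + phi z'.1 * mdist z.2 z'.2)%:E)%E.
Proof.
case: z z' => [s y] [t y'] /=; rewrite EFinD.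
apply: le_trans (warped_edist_triangle hN phi0 _ (t, y) _) _.
by apply: leeD; [exact: ed_vertical|exact: warped_edist_fiber].
Qed.

Let ed_fin z z' : ed z z' \is a fin_num.
Proof.
rewrite ge0_fin_numE ?warped_edist_ge0//.
by apply: le_lt_trans (ed_le z z') _; exact: ltry.
Qed.

Let wdE z z' : (wd z z')%:E = ed z z'.
Proof. by rewrite warped_pdistE fineK. Qed.

Lemma warped_pdist_pseudometric : pseudometric wd.
Proof.
split=> [z|z z'|z w z'].
- by rewrite warped_pdistE warped_edistxx.
- by rewrite !warped_pdistE warped_edistC.
- by rewrite -lee_fin EFinD !wdE warped_edist_triangle.
Qed.

Lemma warped_pdist_le z z' :
  wd z z' <= `|sval z.1 - sval z'.1| + phi z'.1 * mdist z.2 z'.2.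
Proof. by rewrite -lee_fin wdE. Qed.

Lemma warped_pdist_ge1 z z' : `|sval z.1 - sval z'.1| <= wd z z'.
Proof. by rewrite -lee_fin wdE -mdist_halfline warped_edist_ge1. Qed.

Lemma warped_pdist_vertical s t y : wd (s, y) (t, y) = `|sval s - sval t|.
Proof.
apply/eqP; rewrite eq_le (warped_pdist_ge1 (s, y) (t, y)) andbT.
by apply: le_trans (warped_pdist_le _ _) _; rewrite /= mdistxx mulr0 addr0.
Qed.

Lemma warped_pdist_fiber t y y' : wd (t, y) (t, y') <= W (sval t) * mdist y y'.
Proof. by apply: le_trans (warped_pdist_le _ _) _; rewrite /= subrr normr0 add0r. Qed.

Lemma warped_pdist_ge2 z z' e m : 0 <= m ->
  (forall x : R, 0 <= x -> `|sval z.1 - x| < e -> m <= W x) ->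
  Num.min e (m * mdist z.2 z'.2) <= wd z z'.
Proof.
move=> m0 me; rewrite -lee_fin wdE; apply: warped_edist_ge2 => // t zt.
by apply: me => //; exact: halfline_ge0.
Qed.

End warped_halfline.

(** * The product outer measure *)

Section caratheodory_sigma_finite.
Context {R : realType} {T : pointedType} (mu : {outer_measure set T -> \bar R}).
Hypothesis sf : sigma_finite setT (mu : set (caratheodory_type mu) -> \bar R).

(** The proof of sigma-finiteness is an argument, so that the instances below
are found by unification. *)
Definition cara_measure of sigma_finite setT (mu : set (caratheodory_type mu) -> \bar R) :
  set (caratheodory_type mu) -> \bar R := mu.

HB.instance Definition _ := Measure.on (cara_measure sf).
HB.instance Definition _ := Measure_isSigmaFinite.Build _ _ _ (cara_measure sf) sf.

End caratheodory_sigma_finite.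

(** Bundled, since the sigma-algebra of measurable sets is attached to the
bundled outer measure. *)
Definition product_om {R : realType} {X Y : Type}
    (muX : {outer_measure set X -> \bar R}) (muY : {outer_measure set Y -> \bar R}) :
  {outer_measure set (X * Y) -> \bar R} := product_outer muX muY.

Section product_outer_theory.
Context {R : realType} {X Y : pointedType}
  (muX : {outer_measure set X -> \bar R})
  (muY : {outer_measure set Y -> \bar R}).
Hypothesis sfX : sigma_finite setT (muX : set (caratheodory_type muX) -> \bar R).
Hypothesis sfY : sigma_finite setT (muY : set (caratheodory_type muY) -> \bar R).
Local Open Scope ereal_scope.

Local Notation CX := (caratheodory_type muX).
Local Notation CY := (caratheodory_type muY).
Local Notation mX := (cara_measure sfX).
Local Notation mY := (cara_measure sfY).
Local Notation pi := (product_om muX muY).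
Local Notation CP := (caratheodory_type pi).
Local Notation piC := (pi : set CP -> \bar R).

Lemma product_outer_rect_le (A : set X) (B : set Y) :
  muX.-caratheodory A -> muY.-caratheodory B -> pi (A `*` B) <= muX A * muY B.
Proof.
move=> mA mB; apply: ereal_inf_lbound.
exists (fun n => if n is 0%N then (A, B) else (set0, set0)).
  split=> [[|k]//=|z Az]; last by exists 0%N.
  by split; exact: caratheodory_measurable_set0.
rewrite (nneseriesD1 (n := 0%N))//=; last first.
  by move=> k _; apply: mule_ge0; exact: outer_measure_ge0.
rewrite [X in _ + X]eseries0 ?adde0// => -[|i] _ //= _.
by rewrite outer_measure0 mul0e.
Qed.

(** Each rectangle of a covering is cut into its part inside the given rectangle
and two rectangles outside it. *)
Lemma product_outer_rect_caratheodory (A : set X) (B : set Y) :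
  muX.-caratheodory A -> muY.-caratheodory B -> (product_om muX muY).-caratheodory (A `*` B).
Proof.
move=> mA mB; apply: le_caratheodory_measurable => S.
apply: le_ereal_inf_tmp => _ [F [mF SF] <-].
pose F1 k := (F k).1; pose F2 k := (F k).2.
have mF1 k : muX.-caratheodory (F1 k) by case: (mF k).
have mF2 k : muY.-caratheodory (F2 k) by case: (mF k).
have ge0X Z : 0 <= muX Z by exact: outer_measure_ge0.
have ge0Y Z : 0 <= muY Z by exact: outer_measure_ge0.
have h1 : pi (S `&` A `*` B) <= \sum_(k <oo) (muX (F1 k `&` A) * muY (F2 k `&` B)).
  apply: (@le_trans _ _ (pi (\bigcup_k ((F1 k `&` A) `*` (F2 k `&` B))))).
    apply: le_outer_measure => -[x y] [/SF[k _ [/= h h']] [/= Ax By]].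
    by exists k.
  apply: le_trans (outer_measure_sigma_subadditive _ _) _.
  apply: lee_nneseries => k _ //.
  by apply: product_outer_rect_le; exact: caratheodory_measurable_setI.
have h2 : pi (S `&` ~` (A `*` B)) <= \sum_(k <oo)
    (muX (F1 k `\` A) * muY (F2 k) + muX (F1 k `&` A) * muY (F2 k `\` B)).
  apply: (@le_trans _ _ (pi (\bigcup_k (((F1 k `\` A) `*` F2 k) `|`
      ((F1 k `&` A) `*` (F2 k `\` B)))))).
    apply: le_outer_measure => -[x y] [/SF[k _ [/= h h']] /= nAB].
    exists k => //; have [Ax|Ax] := pselect (A x); [right|by left].
    by split => //=; split => // By; apply: nAB.
  apply: le_trans (outer_measure_sigma_subadditive _ _) _.
  apply: lee_nneseries => k _ //.
  apply: le_trans (outer_measureU2 _ _ _) _; apply: leeD.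
    by apply: product_outer_rect_le => //; exact: caratheodory_measurable_setD.
  apply: product_outer_rect_le; first exact: caratheodory_measurable_setI.
  exact: caratheodory_measurable_setD.
apply: le_trans (leeD h1 h2) _.
rewrite -nneseriesD; last 2 first.
- by move=> k _ _; exact: mule_ge0.
- by move=> k _ _; apply: adde_ge0; exact: mule_ge0.
apply: lee_nneseries => k _ //.
  by move=> _; do ?[apply: adde_ge0 => //]; exact: mule_ge0.
have -> : muX (F k).1 = muX (F1 k `&` A) + muX (F1 k `\` A) by rewrite setDE; exact: mA.
have YE : muY (F2 k) = muY (F2 k `&` B) + muY (F2 k `\` B) by rewrite setDE; exact: mB.
rewrite -/(F2 k) ge0_muleDl// {2}YE ge0_muleDr// addeA.
by rewrite addeAC -!addeA; apply: leeD2l; rewrite addeC.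
Qed.

Lemma measurable_id_product :
  measurable_fun setT ((fun z => (z.1, z.2)) : CP -> (CX * CY)%type).
Proof.
apply: (@measurable_fun_pair _ _ _ CP CX CY (fst : CP -> CX) (snd : CP -> CY)).
  move=> _ A mA; rewrite setTI.
  have -> : (fst : CP -> CX) @^-1` A = A `*` setT by apply/seteqP; split => // z [].
  apply: product_outer_rect_caratheodory => //.
  exact: (@measurableT _ CY).
move=> _ A mA; rewrite setTI.
have -> : (snd : CP -> CY) @^-1` A = setT `*` A by apply/seteqP; split => // z [].
apply: product_outer_rect_caratheodory => //.
exact: (@measurableT _ CX).
Qed.

Lemma product_measurable_caratheodory (S : set (CX * CY)) :
  measurable S -> (product_om muX muY).-caratheodory S.
Proof.
move=> mS; have := measurable_id_product measurableT mS.
by rewrite setTI; congr caratheodory_measurable; apply/seteqP; split => -[].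
Qed.

Let prodm (S : set (CX * CY)) : \bar R := pi S.

Let prodm0 : prodm set0 = 0. Proof. exact: outer_measure0. Qed.

Let prodm_ge0 S : 0 <= prodm S. Proof. exact: outer_measure_ge0. Qed.

Let prodm_sigma_additive : semi_sigma_additive prodm.
Proof.
move=> F mF tF mUF.
apply: (@caratheodory_measure_sigma_additive R _ pi F) => //.
  by move=> i; exact: product_measurable_caratheodory.
exact: product_measurable_caratheodory.
Qed.

HB.instance Definition _ := isMeasure.Build _ _ _ prodm prodm0 prodm_ge0 prodm_sigma_additive.

Lemma product_outer_ge (S : set (CX * CY)) :
  measurable S -> (mX \x mY) S <= pi S.
Proof.
move=> mS; apply: le_ereal_inf_tmp => _ [F [mF SF] <-].
have mFk k : measurable ((F k).1 `*` (F k).2 : set (CX * CY)).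
  by apply: measurableX; case: (mF k).
apply: (@le_trans _ _ (\sum_(k <oo) (mX \x mY) ((F k).1 `*` (F k).2))).
  by apply: measure_sigma_subadditive.
apply: lee_nneseries => k _ //.
by rewrite product_measure1E//; case: (mF k).
Qed.

(** On the product sigma-algebra the outer product measure is the product
measure: coverings by rectangles only overestimate the latter, and both agree
on rectangles. *)
Lemma product_outerE (S : set (CX * CY)) :
  measurable S -> pi S = (mX \x mY) S.
Proof.
move=> mS; apply/esym/(@product_measure_unique _ _ CX CY R mX mY prodm) => // A B mA mB.
apply/eqP; rewrite eq_le; apply/andP; split.
  exact: product_outer_rect_le.
rewrite -product_measure1E//; apply: product_outer_ge; exact: measurableX.
Qed.

Lemma product_outer_rect (A : set X) (B : set Y) :
  muX.-caratheodory A -> muY.-caratheodory B -> pi (A `*` B) = muX A * muY B.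
Proof.
move=> mA mB.
have mAB : measurable (A `*` B : set (CX * CY)) by exact: measurableX.
by rewrite (product_outerE mAB) (product_measure1E mX mY).
Qed.

(** Both sides are integrals over image measures that agree on the product
sigma-algebra. *)
Lemma integral_product_outer (F : (CX * CY)%type -> \bar R) :
  measurable_fun setT F -> (forall z, 0 <= F z) ->
  \int[piC]_z F z = \int[mX \x mY]_z F z.
Proof.
move=> mF F0; pose idp := (fun z => (z.1, z.2)) : CP -> (CX * CY)%type.
have E : \int[pushforward piC idp]_z F z = \int[piC]_z F (idp z).
  by rewrite ge0_integral_pushforward//; exact: measurable_id_product.
transitivity (\int[prodm]_z F z); last first.
  by apply: eq_measure_integral => A mA _; exact: product_outerE.
transitivity (\int[piC]_z F (idp z)); first by apply: eq_integral => -[].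
rewrite -E; apply: eq_measure_integral => [|midp A mA _]; first exact: measurable_id_product.
change (pi (idp @^-1` A) = pi A).
by apply: (congr1 (fun B : set (X * Y) => pi B)); apply/seteqP; split => -[].
Qed.

(** The hull is the intersection of the unions of coverings whose weights tend to
the outer measure of S. *)
Lemma product_outer_hull (S : set (X * Y)) : pi S < +oo ->
  exists G : set (CX * CY), [/\ measurable G, S `<=` G & pi G = pi S].
Proof.
move=> Soo; have Sfin : pi S \is a fin_num by rewrite ge0_fin_numE ?outer_measure_ge0.
have /choice[F FP] : forall n, exists F, rectangle_cover muX muY S F /\
    \sum_(k <oo) (muX (F k).1 * muY (F k).2) < pi S + (n.+1%:R^-1)%:E.
  move=> n; have n0 : (0 < n.+1%:R^-1 :> R)%R by rewrite invr_gt0.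
  by have [_ [F FS <-] h] := lb_ereal_inf_adherent n0 Sfin; exists F.
pose G := \bigcap_n \bigcup_k ((F n k).1 `*` (F n k).2).
have mG : measurable (G : set (CX * CY)).
  apply: bigcap_measurable => // n _; apply: bigcup_measurable => k _.
  by have [[/(_ k)[h1 h2] _] _] := FP n; apply: measurableX.
have SG : S `<=` G by move=> z Sz n _; have [[_ SF] _] := FP n; exact: SF.
exists G; split => //; apply/eqP; rewrite eq_le; apply/andP; split; last exact: le_outer_measure.
apply/lee_addgt0Pr => e e0; have [n ne] : exists n, (n.+1%:R^-1 < e)%R.
  have [n] := ltr_add_invr e0; rewrite add0r; by exists n.
have [[mF _] h] := FP n.
apply: (@le_trans _ _ (pi S + (n.+1%:R^-1)%:E)); last by rewrite leeD2l// lee_fin ltW.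
apply: le_trans (ltW h); apply: ereal_inf_lbound; exists (F n) => //; split => //.
by move=> z /(_ n I).
Qed.

(** By Tonelli's theorem for a null set of the product sigma-algebra that
contains S. *)
Lemma product_null_sections (S : set (X * Y)) : pi S = 0 ->
  {ae mX, forall x, muY (xsection S x) = 0}.
Proof.
move=> S0; have [|G [mG SG]] := @product_outer_hull S; first by rewrite S0.
rewrite S0 product_outerE// /product_measure1 => G0.
have mGx : measurable_fun setT (mY \o xsection G) by exact: measurable_fun_xsection.
have : ae_eq mX setT (mY \o xsection G) (cst 0).
  apply/ae_eq_integral_abs => //; rewrite -[RHS]G0.
  by apply: eq_integral => x _; rewrite gee0_abs.
move/ae_imp; apply => x /(_ I) /= Gx.
apply/eqP; rewrite eq_le outer_measure_ge0 andbT.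
rewrite -[leRHS]Gx; apply: le_outer_measure => y; rewrite /xsection/= !inE; exact: SG.
Qed.

Lemma caratheodory_null (T : pointedType) (mu : {outer_measure set T -> \bar R}) (A : set T) :
  mu A = 0 -> mu.-caratheodory A.
Proof.
move=> A0; apply: le_caratheodory_measurable => S.
have -> : mu (S `&` A) = 0.
  by apply/eqP; rewrite eq_le outer_measure_ge0 andbT -A0; exact: le_outer_measure.
by rewrite add0e; exact: le_outer_measure.
Qed.

(** A measurable set is squeezed between a set of the product sigma-algebra and
a null set; almost every section of the latter is null. *)
Lemma caratheodory_sections (S : set (X * Y)) : (product_om muX muY).-caratheodory S ->
  {ae mX, forall x, muY.-caratheodory (xsection S x)}.
Proof.
move=> mS.
have [A [AT _ AP]] := (sigma_finiteP _ mX).1 sfX.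
have [B [BT _ BP]] := (sigma_finiteP _ mY).1 sfY.
have AE x : exists n, A n x by have : [set: CX] x by []; rewrite AT => -[n _ ?]; exists n.
have BE x : exists n, B n x by have : [set: CY] x by []; rewrite BT => -[n _ ?]; exists n.
pose E i j := S `&` (A i `*` B j).
have mE i j : pi.-caratheodory (E i j).
  apply: caratheodory_measurable_setI => //.
  by apply: product_outer_rect_caratheodory; [exact: (AP i).1|exact: (BP j).1].
suff H i j : {ae mX, forall x, muY.-caratheodory (xsection (E i j) x)}.
  have : {ae mX, forall x, forall i j, muY.-caratheodory (xsection (E i j) x)}.
    by apply: ae_foralln => i; apply: ae_foralln => j; exact: H.
  move/ae_imp; apply => x Ex.
  have -> : xsection S x = \bigcup_i \bigcup_j xsection (E i j) x.
    apply/seteqP; split => y; rewrite /xsection/= ?inE.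
      move=> Sxy; have [i Ai] := AE x; have [j Bj] := BE y.
      by exists i => //; exists j => //=; rewrite inE; split.
    by move=> [i _ [j _ /=]]; rewrite inE => -[].
  by apply: caratheodory_measurable_bigcup => i; apply: caratheodory_measurable_bigcup.
have Eoo : pi (E i j) < +oo.
  apply: (@le_lt_trans _ _ (pi (A i `*` B j))); first by apply: le_outer_measure => z [].
  rewrite product_outer_rect; [|exact: (AP i).1|exact: (BP j).1].
  have [[_ Aoo] [_ Boo]] := (AP i, BP j).
  by apply: lte_mul_pinfty => //; rewrite ge0_fin_numE.
have [G [mG EG GE]] := product_outer_hull Eoo.
have GE0 : pi (G `\` E i j) = 0.
  have := mE i j G; rewrite setDE.
  have -> : G `&` E i j = E i j by apply/setIidPr.
  rewrite GE => /esym/eqP; rewrite -[X in _ == X]adde0 => /eqP h.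
  have Efin : pi (E i j) \is a fin_num by rewrite ge0_fin_numE ?outer_measure_ge0.
  by move: h; move/(congr1 (fun t => t - pi (E i j))); rewrite adde0 addeAC subee// add0e.
apply: (ae_imp (product_null_sections GE0)) => x Gx0.
have -> : xsection (E i j) x = xsection G x `\` xsection (G `\` E i j) x.
  apply/seteqP; split => y; rewrite /xsection/= !inE.
    by move=> Exy; split; [exact: EG|case].
  by move=> [Gxy nE]; apply: contrapT => nExy; apply: nE.
apply: caratheodory_measurable_setD; last exact: caratheodory_null.
exact: (@measurable_xsection _ _ CX CY G x mG).
Qed.

(** A function is measurable as soon as its superlevel sets of rational height
are, and these are countably many. *)
Lemma measurable_sections (u : X * Y -> \bar R) :
  measurable_fun setT (u : CP -> \bar R) ->
  {ae mX, forall x, measurable_fun setT ((fun y => u (x, y)) : CY -> \bar R)}.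
Proof.
move=> mu_.
have H (r : rat) : {ae mX, forall x, muY.-caratheodory (xsection (u @^-1` `](ratr r)%:E, +oo[) x)}.
  apply: caratheodory_sections; rewrite -[X in _.-caratheodory X]setTI.
  by apply: mu_ => //; exact: emeasurable_itv.
have {}H : {ae mX, forall x, forall n : nat, forall r : rat, unpickle n = Some r ->
    muY.-caratheodory (xsection (u @^-1` `](ratr r)%:E, +oo[) x)}.
  apply: ae_foralln => n; case: (unpickle n) => [q|]; last exact: aeW.
  by apply: (ae_imp (H q)) => x Hx r [<-].
apply: (ae_imp H) => x Hx.
apply: (measurability _ (ErealGenOInfty.measurableE R)) => _ [_ [r ->] <-].
rewrite setTI.
rewrite (_ : _ @^-1` _ = \bigcup_(q in [set q : rat | (r < ratr q)%R])
  xsection (u @^-1` `](ratr q)%:E, +oo[) x).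
  rewrite bigcup_mkcond; apply: bigcupT_measurable_rat => q; case: ifPn => // _.
  by apply: (Hx (pickle q)); rewrite pickleK.
apply/seteqP; split => y; rewrite /= in_itv/= andbT.
  move=> ru; have [q rq qu] : exists2 q : rat, (r < ratr q)%R & (ratr q)%:E < u (x, y).
    case: (u (x, y)) ru => [v|_|//].
      by rewrite lte_fin => /rat_in_itvoo[q]; rewrite in_itv/= => /andP[rq qv]; exists q.
    have r1 : (r < r + 1)%R by rewrite ltrDl.
    have [q] := rat_in_itvoo r1; rewrite in_itv/= => /andP[rq _].
    by exists q => //; exact: ltry.
  by exists q => //; rewrite /xsection/= inE/= in_itv/= qu.
move=> [q rq]; rewrite /xsection/= inE/= in_itv/= andbT; apply: lt_trans.
by rewrite lte_fin.
Qed.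

End product_outer_theory.

(** * The weighted half-line *)

Section density_measure.
Context {dd : measure_display} {T : measurableType dd} {R : realType}.
Variables (mu : {measure set T -> \bar R}) (w : T -> R).
Hypotheses (w0 : forall x, 0 <= w x) (mw : measurable_fun setT w).
Local Open Scope ereal_scope.
Import HBNNSimple.

Definition density_measure of (forall x, 0 <= w x)%R & measurable_fun setT w :=
  fun A : set T => \int[mu]_(x in A) (w x)%:E.

Local Notation dm := (density_measure w0 mw).

Let density_measure0 : dm set0 = 0.
Proof. exact: integral_set0. Qed.

Let density_measure_ge0 A : 0 <= dm A.
Proof. by apply: integral_ge0 => x _; rewrite lee_fin. Qed.

Let density_measure_sigma_additive : semi_sigma_additive dm.
Proof.
apply: semi_sigma_additive_nng_induced; first exact/measurable_EFinP.
by move=> x; rewrite lee_fin.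
Qed.

HB.instance Definition _ := isMeasure.Build _ _ _ dm
  density_measure0 density_measure_ge0 density_measure_sigma_additive.

Let mw' : measurable_fun setT (EFin \o w). Proof. exact/measurable_EFinP. Qed.

Lemma integral_density_nnsfun (h : {nnsfun T >-> R}) :
  \int[dm]_x (h x)%:E = \int[mu]_x ((h x)%:E * (w x)%:E).
Proof.
pose part r x : \bar R := (r * \1_(h @^-1` [set r]) x)%:E * (w x)%:E.
have part0 r x : 0 <= part r x by rewrite mule_ge0 ?nnfun_muleindic_ge0 ?lee_fin.
have mpart r : measurable_fun setT (part r).
  by apply: emeasurable_funM => //; apply/measurable_EFinP; exact: measurable_funM.
have hE x : (h x)%:E * (w x)%:E = \sum_(r \in range h) part r x.
  rewrite fimfunE -fsumEFin// ge0_mule_fsuml// => r; exact: nnfun_muleindic_ge0.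
rewrite integralT_nnsfun sintegralE; under [RHS]eq_integral do rewrite hE.
rewrite ge0_integral_fsum//; apply: eq_fsbigr => r /set_mem[t _ <-].
rewrite /density_measure -ge0_integralZl//; last 3 first.
- exact: measurable_funTS.
- by move=> x _; rewrite lee_fin.
- by rewrite lee_fin.
rewrite integral_mkcond; apply: eq_integral => x _; rewrite /part EFinM -muleA patchE indicE.
by case: ifPn => _; rewrite ?mul1e ?mul0e ?mule0.
Qed.

(** Simple functions below f bound the left-hand side, and those increasing to
f bound the right-hand side. *)
Lemma integral_density (f : T -> \bar R) : (forall x, 0 <= f x) ->
  measurable_fun setT f ->
  \int[dm]_x f x = \int[mu]_x (f x * (w x)%:E).
Proof.
move=> f0 mf; apply/eqP; rewrite eq_le; apply/andP; split.
  rewrite [leLHS]ge0_integralE//; apply: ge_ereal_sup => _ [h hf <-].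
  rewrite -integralT_nnsfun integral_density_nnsfun.
  apply: le_integral_ge0 => x _; first by rewrite mule_ge0 ?lee_fin.
  by apply: lee_wpmul2r; [rewrite lee_fin|have := hf x; rewrite patch_setT].
pose h := nnsfun_approx measurableT mf.
have fwE x : f x * (w x)%:E = limn (fun n => (h n x)%:E * (w x)%:E).
  by apply/esym/cvg_lim => //; apply: cvgeZr => //; exact: cvg_nnsfun_approx.
under eq_integral do rewrite fwE.
rewrite monotone_convergence//; last 3 first.
- by move=> n; apply: emeasurable_funM => //; exact/measurable_EFinP.
- by move=> n x _; rewrite mule_ge0 ?lee_fin.
- by move=> x _ m n mn; rewrite lee_wpmul2r ?lee_fin//; exact/lefP/nd_nnsfun_approx.
apply: lime_le.
  apply: ereal_nondecreasing_is_cvgn => m n mn; apply: le_integral_ge0 => x _.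
    by rewrite mule_ge0 ?lee_fin.
  by rewrite lee_wpmul2r ?lee_fin//; exact/lefP/nd_nnsfun_approx.
apply: nearW => n; rewrite -integral_density_nnsfun; apply: le_integral_ge0 => x _.
  by rewrite lee_fin.
by rewrite nnsfun_approxE; exact: le_approx.
Qed.

End density_measure.

Definition weighted_om {R : realType} (w : {nnfun R >-> R}) :
  {outer_measure set (halfline R) -> \bar R} := weighted_outer w.

Section halfline_measure.
Context {R : realType} (w : {nnfun R >-> R}).
Hypothesis mw : measurable_fun setT (w : R -> R).
Local Notation mu := (@lebesgue_measure R).
Local Notation HL := (caratheodory_type (weighted_om w)).
Local Open Scope ereal_scope.

Let w0 x : (0 <= w x)%R. Proof. exact: fun_ge0. Qed.

Let nu : {measure set (measurableTypeR R) -> \bar R} := density_measure mu w0 mw.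

Let sval_inj : injective (sval : halfline R -> R).
Proof. by move=> s t st; apply: eq_sig_hprop => // x; exact: bool_irrelevance. Qed.

Lemma weighted_outerE (B : set (halfline R)) : measurable (sval @` B) ->
  weighted_om w B = \int[mu]_(t in sval @` B) (w t)%:E.
Proof. by move=> mB; rewrite /weighted_om/= /weighted_outer -[RHS]/(nu _) -measurable_mu_extE. Qed.

Lemma halfline_caratheodory (B : set (halfline R)) : measurable (sval @` B) ->
  (weighted_om w).-caratheodory B.
Proof.
move=> mB S; rewrite /weighted_om/= /weighted_outer.
have := @caratheodory_measurable_mu_ext _ _ _ nu _ mB (sval @` S).
rewrite -/(mu_ext (weighted_lebesgue w) _) => ->; congr (_ + _); congr (mu_ext _ _).
  apply/seteqP; split => x.
    by move=> [[s Ss <-] [t Bt /sval_inj ts]]; rewrite ts in Bt; exists s.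
  by move=> [s [Ss Bs] <-]; split; exists s.
apply/seteqP; split => x.
  by move=> [[s Ss <-] nB]; exists s => //; split => // Bs; apply: nB; exists s.
move=> [s [Ss Bs] <-]; split; first by exists s.
by move=> [t Bt /sval_inj ts]; rewrite ts in Bt.
Qed.

Lemma sval_preimage (A : set R) :
  sval @` (sval @^-1` A : set (halfline R)) = A `&` `[0%R, +oo[.
Proof.
apply/seteqP; split => x /=.
  by move=> [s As <-]; split => //; rewrite in_itv/= andbT; exact: (svalP s).
by rewrite in_itv/= andbT => -[Ax x0]; exists (exist (fun t => is_true (0 <= t)%R) x x0).
Qed.

Lemma measurable_sval : measurable_fun setT (sval : HL -> measurableTypeR R).
Proof.
move=> _ A mA; rewrite setTI; apply: halfline_caratheodory.
by rewrite sval_preimage; apply: measurableI => //; exact: measurable_itv.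
Qed.

Lemma integral_halfline (f : R -> \bar R) : (forall x, 0 <= f x) ->
  measurable_fun setT (f : measurableTypeR R -> \bar R) ->
  \int[(weighted_om w : set HL -> \bar R)]_t f (sval t) =
  \int[mu]_(t in `[0%R, +oo[) (f t * (w t)%:E).
Proof.
move=> f0 mf.
have E : \int[pushforward (weighted_om w : set HL -> \bar R) (sval : HL -> measurableTypeR R)]_x f x =
    \int[(weighted_om w : set HL -> \bar R)]_t f (sval t).
  by rewrite ge0_integral_pushforward//; exact: measurable_sval.
pose w' := w \_ `[0%R, +oo[%classic.
have mw' : measurable_fun setT (w' : measurableTypeR R -> R).
  apply/(measurable_restrictT _ _).1; first exact: measurable_itv.
  exact: measurable_funTS.
have w'0 x : (0 <= w' x)%R by rewrite /w' patchE; case: ifPn.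
rewrite -E; transitivity (\int[density_measure mu w'0 mw']_x f x).
  apply: eq_measure_integral => [|ms A mA _]; first exact: measurable_sval.
  change (weighted_om w (sval @^-1` A) = \int[mu]_(x in A) (w' x)%:E).
  rewrite weighted_outerE sval_preimage.
    rewrite integral_mkcondr; apply: eq_integral => x _.
    by rewrite /w' !patchE; case: ifPn.
  by apply: measurableI => //; exact: measurable_itv.
rewrite integral_density// [RHS]integral_mkcond; apply: eq_integral => x _.
by rewrite /w' !patchE; case: ifPn => // _; rewrite mule0.
Qed.

Hypothesis w_loc : forall n : nat, \int[mu]_(t in `[0%R, n%:R]) (w t)%:E < +oo.

Lemma halfline_sigma_finite :
  sigma_finite setT (weighted_om w : set HL -> \bar R).
Proof.
pose B n : set (halfline R) := sval @^-1` [set` `]-oo, n%:R]].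
have mB n : measurable (sval @` B n).
  by rewrite sval_preimage; apply: measurableI; exact: measurable_itv.
exists B.
  apply/esym; rewrite -subTset => t _; exists (Num.bound (sval t)) => //=.
  by rewrite /B /= in_itv/= ltW// archi_boundP//; exact: (svalP t).
move=> n; split; first exact: halfline_caratheodory.
rewrite weighted_outerE//; apply: le_lt_trans (w_loc n).
apply: integral_subset_ge0 => x; last by rewrite lee_fin.
by rewrite sval_preimage /= !in_itv/= andbT => -[? ->].
Qed.

End halfline_measure.

(** * Hardy's inequality on rays *)

Section exponential_integrals.
Context {R : realType}.
Local Notation mu := (@lebesgue_measure R).
Local Open Scope ereal_scope.
Variable b : R.
Hypothesis b0 : (0 < b)%R.

Lemma integral_expR0y : \int[mu]_(s in `[0%R, +oo[) (expR (- (b * s)))%:E = (b^-1)%:E.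
Proof.
have : \int[mu]_(s in `[0%R, +oo[) (b%:E * (expR (- (b * s)))%:E) = 1.
  rewrite integral_mkcond -(integral_exponential_pdf b0); apply: eq_integral => x _.
  rewrite /exponential_pdf !patchE; case: ifPn => // _.
  by rewrite -EFinM -mulNr.
rewrite ge0_integralZl//.
- move=> E; rewrite -[LHS]mul1e -(mulVf (lt0r_neq0 b0)) EFinM -muleA.
  by rewrite E mule1.
- apply: measurable_funTS; apply/measurable_EFinP; apply: measurableT_comp => //.
  by apply: measurable_funN; apply: measurable_funM.
- by rewrite lee_fin ltW.
Qed.

Lemma integral_expR_right (t : R) :
  \int[mu]_(s in `[t, +oo[) (expR (- (b * (s - t))))%:E <= (b^-1)%:E.
Proof.
rewrite -integral_expR0y.
have -> : `[t, +oo[%classic = (fun x => x - t)%R @^-1` `[0%R, +oo[.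
  by apply/seteqP; split => x /=; rewrite !in_itv/= !andbT subr_ge0.
apply: (le_integral_shift (f := fun s => (expR (- (b * s)))%:E) (- t)%R).
by move=> x _; rewrite lee_fin expR_ge0.
Qed.

Lemma integral_expR_left (t : R) :
  \int[mu]_(s in `[0%R, t]) (expR (- (b * (t - s))))%:E <= (b^-1)%:E.
Proof.
rewrite -integral_expR0y.
have -> : `[0%R, t]%classic = -%R @^-1` `[(- t)%R, 0%R].
  by apply/seteqP; split => x /=; rewrite !in_itv/=; lra.
apply: (@le_trans _ _ (\int[mu]_(s in `[(- t)%R, 0%R]) (expR (- (b * (s + t))))%:E)).
  apply: le_trans (le_integral_opp (f := fun s => (expR (- (b * (s + t))))%:E) _).
    by apply: le_integral_ge0 => x _; rewrite lee_fin ?expR_ge0// (addrC (- x)%R).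
  by move=> x _; rewrite lee_fin expR_ge0.
have -> : `[(- t)%R, 0%R]%classic = (fun x => x + t)%R @^-1` `[0%R, t].
  by apply/seteqP; split => x /=; rewrite !in_itv/=; lra.
apply: (@le_trans _ _ (\int[mu]_(s in `[0%R, t]) (expR (- (b * s)))%:E)).
  apply: (le_integral_shift (f := fun s => (expR (- (b * s)))%:E) t).
  by move=> x _; rewrite lee_fin expR_ge0.
apply: integral_subset_ge0 => x; last by rewrite lee_fin expR_ge0.
by rewrite /= !in_itv/= => /andP[-> _].
Qed.

End exponential_integrals.

Lemma le_poweR (R : realType) (x y : \bar R) (r : R) : 0 <= r ->
  (0 <= x)%E -> (x <= y)%E -> (x `^ r <= y `^ r)%E.
Proof.
move=> r0 x0 xy; apply: gt0_ler_poweR => //; rewrite in_itv/= leey andbT//.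
exact: le_trans xy.
Qed.

Section hardy.
Context {R : realType}.
Local Notation mu := (@lebesgue_measure R).
Local Open Scope ereal_scope.
Variables (b p : R) (f : R -> \bar R).
Hypotheses (b0 : (0 < b)%R) (p1 : (1 <= p)%R).
Hypotheses (f0 : forall x, 0 <= f x) (mf : measurable_fun setT (f : measurableTypeR R -> \bar R)).

Let p0 : (0 < p)%R. Proof. exact: lt_le_trans p1. Qed.

Definition tail_integral t := \int[mu]_(s in `[t, +oo[) f s.

Let kern t s := f s `^ p * (expR ((p - 1) * b * (s - t)))%:E.

Let kern_ge0 t s : 0 <= kern t s.
Proof. by rewrite mule_ge0 ?poweR_ge0// lee_fin expR_ge0. Qed.

Let mexp (c t : R) : measurable_fun setT ((fun s => expR (c * (s - t))) : measurableTypeR R -> R).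
Proof.
apply: measurableT_comp => //; apply: measurable_funM => //.
by apply: measurable_funB => //; exact: measurable_cst.
Qed.

Let mkern t : measurable_fun setT (kern t : measurableTypeR R -> \bar R).
Proof.
apply: emeasurable_funM; first exact: (measurableT_comp (measurable_poweR _)).
by apply/measurable_EFinP; exact: mexp.
Qed.

(** Jensen's inequality for the probability density b e^{-b(s-t)} on the ray. *)
Lemma tail_integral_jensen t :
  tail_integral t `^ p <= (b `^ (1 - p))%:E * \int[mu]_(s in `[t, +oo[) kern t s.
Proof.
have mD : measurable (`[t, +oo[%classic : set (measurableTypeR R)) by exact: measurable_itv.
have [p1'|p1'] := eqVneq p 1%R.
  rewrite /kern p1' subrr powRr0 mul1e poweRe1; last exact: integral_ge0.
  rewrite le_eqVlt; apply/orP; left; apply/eqP; apply: eq_integral => s _.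
  by rewrite !mul0r expR0 mule1 poweRe1.
have {}p1' : (1 < p)%R by rewrite lt_neqAle eq_sym p1'.
have I0 : 0 <= \int[mu]_(s in `[t, +oo[) kern t s by apply: integral_ge0.
have [->|Ioo] := eqVneq (\int[mu]_(s in `[t, +oo[) kern t s) +oo.
  by rewrite gt0_muley ?leey// lte_fin powR_gt0.
have {}Ioo : \int[mu]_(s in `[t, +oo[) kern t s < +oo by rewrite ltey.
have ki : mu.-integrable `[t, +oo[ (kern t).
  apply/integrableP; split; first exact: measurable_funTS.
  by under eq_integral do rewrite gee0_abs//.
have ffin : {ae mu, forall s, s \in `[t, +oo[ -> f s = (fine (f s))%:E}.
  have := @integrable_ae _ _ _ mu _ mD _ ki.
  move/ae_imp; apply => s + Ds => /(_ Ds).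
  have := f0 s; rewrite /kern; case: (f s) => [r|_|//] //.
  by rewrite poweRyr ?gt_eqF// gt0_mulye ?lte_fin ?expR_gt0.
(* Hoelder's inequality for the factors f s e^{(b / q) (s - t)} and
   e^{- (b / q) (s - t)} of f, whose norms are explicit *)
pose q := ((1 - p^-1)^-1)%R.
have pV : (p^-1 < 1)%R by rewrite invf_lt1.
have q0 : (0 < q)%R by rewrite invr_gt0 subr_gt0.
have pq : (p^-1 + q^-1 = 1)%R by rewrite invrK addrC subrK.
have pdq : (p / q = p - 1)%R by rewrite /q invrK mulrBr mulr1 divff// gt_eqF.
pose A s := (fine (f s) * expR ((b / q) * (s - t)) * \1_(`[t, +oo[%classic) s)%R.
pose B s := (expR (- (b / q) * (s - t)) * \1_(`[t, +oo[%classic) s)%R.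
have mI : measurable_fun setT (\1_(`[t, +oo[%classic) : measurableTypeR R -> R).
  by apply: measurable_indic.
have mA : measurable_fun setT (A : measurableTypeR R -> R).
  apply: measurable_funM => //; apply: measurable_funM; last exact: mexp.
  exact: measurableT_comp (@fine_measurable _ _ _) mf.
have mB : measurable_fun setT (B : measurableTypeR R -> R).
  by apply: measurable_funM => //; exact: mexp.
have eAB s : (expR ((b / q) * (s - t)) * expR (- (b / q) * (s - t)) = 1)%R.
  by rewrite -expRD mulNr subrr expR0.
have in_ind s : s \in `[t, +oo[ -> (\1_(`[t, +oo[%classic) s = 1 :> R)%R.
  by move=> sD; rewrite indicE mem_set.
have nin_ind s : s \notin `[t, +oo[ -> (\1_(`[t, +oo[%classic) s = 0 :> R)%R.
  by move=> sD; rewrite indicE memNset//; exact/negP.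
have FE : tail_integral t = 'N[mu]_1[EFin \o (A \* B)%R].
  rewrite Lnorm1 /tail_integral [LHS]integral_mkcond.
  transitivity (\int[mu]_x (abse \o (EFin \o (A \* B)%R)) x); last by [].
  apply: ae_eq_integral => //.
  - apply/(measurable_restrictT _ _).1 => //; exact: measurable_funTS.
  - apply: measurableT_comp => //; apply/measurable_EFinP; exact: measurable_funM.
  - apply: (ae_imp ffin) => s fs _; rewrite patchE /=; case: ifPn => [/set_mem sD|/negP sD].
      rewrite fs// /A /B in_ind// !mulr1 -mulrA eAB mulr1 ger0_norm//.
      by rewrite fine_ge0.
    by rewrite /A /B nin_ind ?mulr0 ?normr0//; apply/negP => ?; apply: sD; exact/mem_set.
have pN0 : p != 0%R by rewrite gt_eqF.
have qN0 : q != 0%R by rewrite gt_eqF.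
have NA : 'N[mu]_p%:E[EFin \o A] `^ p = \int[mu]_(s in `[t, +oo[) kern t s.
  rewrite poweR_Lnorm// [RHS]integral_mkcond.
  transitivity (\int[mu]_x ((fun y => y `^ p) \o (abse \o (EFin \o A))) x); first by [].
  apply: ae_eq_integral => //.
  - apply: (measurableT_comp (measurable_poweR _)); apply: measurableT_comp => //.
    exact/measurable_EFinP.
  - apply/(measurable_restrictT _ _).1 => //; exact: measurable_funTS.
  - apply: (ae_imp ffin) => s fs _; rewrite patchE /=; case: ifPn => [/set_mem sD|/negP sD].
      rewrite /A in_ind// mulr1 /kern [in RHS]fs// poweR_EFin -EFinM; congr EFin.
      rewrite ger0_norm; last by rewrite mulr_ge0 ?expR_ge0 ?fine_ge0.
      rewrite powRM ?expR_ge0 ?fine_ge0//; congr (_ * _)%R.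
      by rewrite -expRM; congr expR; rewrite -pdq; ring.
    rewrite /A nin_ind ?mulr0 ?normr0 ?powR0//.
    by apply/negP => ?; apply: sD; exact/mem_set.
have NB : 'N[mu]_q%:E[EFin \o B] `^ q <= (b^-1)%:E.
  rewrite poweR_Lnorm//; apply: le_trans (integral_expR_right b0 t).
  rewrite [leRHS]integral_mkcond le_eqVlt; apply/orP; left; apply/eqP.
  apply: eq_integral => s _; rewrite patchE; case: ifPn => [/set_mem sD|/negP sD].
    rewrite /B /= in_ind// mulr1 ger0_norm ?expR_ge0// -expRM; congr ((expR _)%:E).
    by rewrite -mulrA [((s - t) * q)%R]mulrC mulrA mulNr divfK// mulNr.
  rewrite /B /= nin_ind ?mulr0 ?normr0 ?powR0//.
  by apply/negP => ?; apply: sD; exact/mem_set.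
have AB := hoelder mu mA mB p0 q0 pq.
rewrite FE; apply: (@le_trans _ _ (('N[mu]_p%:E[EFin \o A] * 'N[mu]_q%:E[EFin \o B]) `^ p)).
  by apply: le_poweR => //; [exact: ltW|exact: Lnorm_ge0].
rewrite poweRM ?Lnorm_ge0// NA muleC; apply: lee_wpmul2r => //.
have qp : (q * (p - 1) = p)%R by rewrite -pdq mulrC divfK.
rewrite -[X in _ `^ X <= _]qp poweRrM.
apply: (@le_trans _ _ ((b^-1)%:E `^ (p - 1))).
  by apply: le_poweR NB; rewrite ?subr_ge0// poweR_ge0.
rewrite poweR_EFin lee_fin -(powR_inv1 (ltW b0)) -powRrM.
by rewrite mulN1r opprB.
Qed.

Variables (beta : R) (w : R -> R).
Hypotheses (bbeta : (beta = p * b)%R) (w0 : forall t, (0 <= w t)%R).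
Hypothesis mw : measurable_fun setT (w : measurableTypeR R -> R).
Hypothesis w_growth : forall t s, (0 <= t -> t <= s -> w t <= expR (- (beta * (s - t))) * w s)%R.

Let kern_w t s : (0 <= t -> t <= s -> expR ((p - 1) * b * (s - t)) * w t <= expR (- (b * (s - t))) * w s)%R.
Proof.
move=> t0 ts; apply: le_trans (ler_wpM2l (expR_ge0 _) (w_growth t0 ts)) _.
rewrite mulrA -expRD le_eqVlt; apply/orP; left; apply/eqP; congr (expR _ * _)%R.
by rewrite bbeta; ring.
Qed.

(** The weight grows at least like e^{beta t}, which dominates the kernel of
Jensen's inequality. *)
Lemma tail_integral_le t : (0 <= t)%R ->
  tail_integral t `^ p * (w t)%:E <=
  (b `^ (1 - p))%:E * \int[mu]_(s in `[t, +oo[) (f s `^ p * (w s)%:E).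
Proof.
move=> t0; apply: le_trans (lee_wpmul2r _ (tail_integral_jensen t)) _.
  by rewrite lee_fin.
have mD : measurable (`[t, +oo[%classic : set (measurableTypeR R)) by exact: measurable_itv.
rewrite -muleA; apply: lee_wpmul2l; first by rewrite lee_fin powR_ge0.
rewrite -ge0_integralZr//; last 2 first.
- exact: measurable_funTS.
- by rewrite lee_fin.
apply: le_integral_ge0 => s; first by rewrite mule_ge0 ?lee_fin.
rewrite /= in_itv/= andbT => ts; rewrite /kern -muleA -EFinM.
apply: lee_wpmul2l; first exact: poweR_ge0.
rewrite lee_fin; apply: le_trans (kern_w t0 ts) _.
rewrite ler_piMl// -[leRHS]expR0 ler_expR oppr_le0; by apply: mulr_ge0; [exact: ltW|rewrite subr_ge0].
Qed.

(** Jensen's inequality is applied on each ray and the order of integration is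
exchanged. What remains is the integral of e^{- b (s - t)} over 0 <= t <= s, at
most 1 / b, because the growth of the weight leaves this much of its decay. *)
Lemma hardy :
  \int[mu]_(t in `[0%R, +oo[) (tail_integral t `^ p * (w t)%:E) <=
  (b `^ (- p))%:E * \int[mu]_(s in `[0%R, +oo[) (f s `^ p * (w s)%:E).
Proof.
pose k (z : measurableTypeR R * measurableTypeR R) :=
  if ((0 <= z.1) && (z.1 <= z.2))%R then kern z.1 z.2 * (w z.1)%:E else 0.
have k0 z : 0 <= k z by rewrite /k; case: ifPn => // _; rewrite mule_ge0 ?lee_fin.
have mk : measurable_fun setT k.
  apply: measurable_fun_ifT.
  - apply: measurable_and.
      by apply: measurable_fun_ler => //; exact: measurable_cst.
    by apply: measurable_fun_ler.
  - apply: emeasurable_funM.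
      apply: emeasurable_funM.
        apply: (measurableT_comp (measurable_poweR _)).
        exact: (measurableT_comp mf measurable_snd).
      apply/measurable_EFinP; apply: measurableT_comp => //.
      by apply: measurable_funM => //; apply: measurable_funB.
    by apply/measurable_EFinP; exact: (measurableT_comp mw measurable_fst).
  - exact: measurable_cst.
have b1p0 : (0 <= b `^ (1 - p))%R by exact: powR_ge0.
apply: (@le_trans _ _ ((b `^ (1 - p))%:E * \int[mu]_t \int[mu]_s k (t, s))).
  rewrite -ge0_integralZl//; last 2 first.
  - exact: (@measurable_fun_fubini_tonelli_F _ _ _ _ _ mu k mk k0).
  - by move=> t _; apply: integral_ge0.
  rewrite [leLHS]integral_mkcond; apply: le_integral_ge0 => t _.
    by apply: erestrict_ge0 => x _; rewrite mule_ge0 ?poweR_ge0 ?lee_fin.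
  rewrite patchE; case: ifPn => [/set_mem|_]; last first.
    by rewrite mule_ge0 ?lee_fin//; exact: integral_ge0.
  rewrite /= in_itv/= andbT => t0.
  apply: le_trans (lee_wpmul2r _ (tail_integral_jensen t)) _; first by rewrite lee_fin.
  rewrite -muleA; apply: lee_wpmul2l; first by rewrite lee_fin.
  rewrite -ge0_integralZr//; last 2 first.
  - exact: measurable_funTS.
  - by rewrite lee_fin.
  rewrite integral_mkcond le_eqVlt; apply/orP; left; apply/eqP; apply: eq_integral => s _.
  rewrite patchE /k /= t0/=; case: ifPn => [/set_mem|].
    by rewrite /= in_itv/= andbT => ->.
  by rewrite notin_setE /= in_itv/= andbT => /negP/negbTE ->.
rewrite (@fubini_tonelli _ _ _ _ _ mu mu k mk k0).
have -> : (b `^ (- p) = b `^ (1 - p) * b^-1)%R.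
  rewrite -(powR_inv1 (ltW b0)) -powRD; last by rewrite (gt_eqF b0) implybT.
  by congr (_ `^ _)%R; ring.
rewrite EFinM -muleA; apply: lee_wpmul2l; first by rewrite lee_fin.
rewrite -ge0_integralZl//; last 3 first.
- apply: measurable_funTS; apply: emeasurable_funM; last exact/measurable_EFinP.
  exact: (measurableT_comp (measurable_poweR _)).
- by move=> s _; rewrite mule_ge0 ?poweR_ge0 ?lee_fin.
- by rewrite lee_fin invr_ge0; exact: ltW.
rewrite [leRHS]integral_mkcond; apply: le_integral_ge0 => s _.
  exact: integral_ge0.
rewrite patchE; case: ifPn => [/set_mem|]; last first.
  rewrite notin_setE /= in_itv/= andbT => /negP; rewrite -ltNge => s0.
  rewrite integral0_eq// => t _; rewrite /k /=; case: ifPn => // /andP[t0 ts].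
  by have := le_lt_trans (le_trans t0 ts) s0; rewrite ltxx.
rewrite /= in_itv/= andbT => s0.
apply: (@le_trans _ _ (\int[mu]_(t in `[0%R, s]) ((f s `^ p * (w s)%:E) * (expR (- (b * (s - t))))%:E))).
  rewrite [leRHS]integral_mkcond; apply: le_integral_ge0 => t _ //.
  rewrite patchE /k /=; case: ifPn => [/andP[t0 ts]|nt]; last first.
    by case: ifPn => // _; rewrite !mule_ge0 ?poweR_ge0 ?lee_fin ?expR_ge0.
  rewrite mem_set/= ?in_itv/= ?t0//.
  rewrite /kern -!muleA -!EFinM; apply: lee_wpmul2l; first exact: poweR_ge0.
  by rewrite lee_fin [leRHS]mulrC; exact: kern_w.
rewrite ge0_integralZl//; last 2 first.
- apply: measurable_funTS; apply/measurable_EFinP; apply: measurableT_comp => //.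
  by apply: measurable_funN; apply: measurable_funM => //; apply: measurable_funB.
- by rewrite mule_ge0 ?poweR_ge0 ?lee_fin.
rewrite muleC; apply: lee_wpmul2r; first by rewrite mule_ge0 ?poweR_ge0 ?lee_fin.
exact: integral_expR_left.
Qed.

End hardy.

(** * Function spaces on metric measure spaces *)

Section mmspace_theory.
Context {R : realType} (Z : mmspace R).
Implicit Types (u g : Z -> \bar R) (p C c : R).
Local Notation CZ := (caratheodory_type (mmeas Z)).
Local Open Scope ereal_scope.

Lemma Lp_norm_poweR p A u : (0 < p)%R ->
  Lp_norm p A u `^ p = mm_integral setT (fun x => `|(u \_ A) x| `^ p).
Proof. by move=> p0; rewrite /Lp_norm poweR_Lnorm ?gt_eqF. Qed.

Lemma Lp_norm_powerT p u : (0 < p)%R ->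
  Lp_norm p setT u `^ p = mm_integral setT (fun x => `|u x| `^ p).
Proof. by move=> p0; rewrite Lp_norm_poweR// patch_setT. Qed.

Lemma Lp_norm_ge0 p A u : 0 <= Lp_norm p A u.
Proof. exact: Lnorm_ge0. Qed.

Lemma poweR_le_inv (x y : \bar R) p : (0 < p)%R -> 0 <= x -> 0 <= y ->
  x `^ p <= y `^ p -> x <= y.
Proof.
move=> p0 x0 y0 xy.
have pK (t : \bar R) : 0 <= t -> (t `^ p) `^ p^-1 = t.
  by move=> t0; rewrite -poweRrM divff ?gt_eqF// poweRe1.
by rewrite -(pK x)// -(pK y)//; apply: le_poweR; rewrite ?poweR_ge0// invr_ge0 ltW.
Qed.

Lemma Lp_norm_le p C u g : (0 < p)%R -> (0 <= C)%R ->
  mm_integral setT (fun x => `|u x| `^ p) <=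
    (C `^ p)%:E * mm_integral setT (fun x => `|g x| `^ p) ->
  Lp_norm p setT u <= C%:E * Lp_norm p setT g.
Proof.
move=> p0 C0 ug; apply: (@poweR_le_inv _ _ p) => //.
- exact: Lp_norm_ge0.
- by rewrite mule_ge0// Lp_norm_ge0.
- by rewrite poweRM// ?Lp_norm_ge0// !Lp_norm_powerT// poweR_EFin.
Qed.

Lemma Lp_norm_lty p g : (0 < p)%R ->
  Lp_norm p setT g < +oo <-> mm_integral setT (fun x => `|g x| `^ p) < +oo.
Proof.
move=> p0; rewrite -Lp_norm_powerT//; split; first exact: poweR_lty.
by apply: lty_poweRy; rewrite gt_eqF.
Qed.

(** This includes the infinite values, for which both sides are +oo. *)
Lemma addec_dist (x y : \bar R) c :
  `|(x + c%:E) - (y + c%:E)| = `|x - y|.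
Proof.
case: x => [x| |]; case: y => [y| |] //=; congr (`|_|%:E)%R; ring.
Qed.

Lemma upper_gradient_addc u g c : upper_gradient g u ->
  upper_gradient g (fun x => u x + c%:E).
Proof.
by case=> bg g0 gu; split => // c' a b ac nc; rewrite addec_dist; exact: gu.
Qed.

Hypothesis ballP : forall (x : Z) (r : R),
  (mmeas Z).-caratheodory (mmball x r) /\ mmeas Z (mmball x r) < +oo.

Lemma bounded_integrable_balls u (k : R) : measurable_on setT u ->
  (forall x, `|u x| <= k%:E) -> integrable_over_balls u.
Proof.
move=> mu uk x r r0; have [mB fB] := ballP x r.
apply: (@le_integrable _ CZ R (mmeas Z) (mmball x r) mB u (cst k%:E)).
- exact: measurable_funTS.
- by move=> z _; rewrite (le_trans (uk z))// lee_fin ler_norm.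
- apply/integrableP; split; first exact: measurable_cst.
  rewrite (_ : (fun x => _) = cst `|k|%:E); last by apply/funext => z.
  by rewrite integral_cst// lte_mul_pinfty// lee_fin.
Qed.

Lemma dirichlet_addc p u c : dirichlet_space Z p u ->
  dirichlet_space Z p (fun x => u x + c%:E).
Proof.
case=> mu iu [g ug gp]; split.
- by apply: emeasurable_funD => //; exact: measurable_cst.
- move=> x r r0; apply: integrableD; [exact: (ballP x r).1|exact: iu|].
  by apply: (@bounded_integrable_balls _ `|c|) r0; [exact: measurable_cst|].
- by exists g => //; exact: upper_gradient_addc.
Qed.

(** Subtracting the constant of the Sobolev-Poincare inequality from a function
of the Dirichlet space makes it p-integrable, and conversely constants are
integrable on balls. *)
Lemma sobolev_poincare_newtonian p C : (0 < p)%R -> sobolev_poincare Z p p C ->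
  dirichlet_space Z p = newtonian_plus_constants Z p.
Proof.
move=> p0 SP; apply/seteqP; split => u /=; last first.
  by case=> v [c [[Dv _] ->]]; exact: dirichlet_addc.
move=> Du; have [_ _ [g ug gp]] := Du.
have [c uc] := SP u g Du ug gp.
exists (fun x => u x - c%:E), c; split; last first.
  by apply/funext => x; rewrite subeK.
split.
  by rewrite (_ : (fun x => _) = (fun x => u x + (- c)%:E))//; exact: dirichlet_addc.
apply/Lp_norm_lty => //; apply: le_lt_trans uc _.
by move: gp (Lp_norm_ge0 p setT g); case: (Lp_norm p setT g) => // r _ _; rewrite ltry.
Qed.

End mmspace_theory.

Section separable.
Context {R : realType} {Y : pmetricType R} (muY : {outer_measure set Y -> \bar R}).
Hypothesis hY : metric_measure_space muY.

Lemma mdist_ball_open y (r : R) : open [set y' : Y | mdist y y' < r].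
Proof.
rewrite -(mmopenE muY) => z /= yz; exists (r - mdist y z); first by rewrite subr_gt0.
move=> z'; rewrite /mmball/= ltrBrDl; apply: le_lt_trans.
exact: metric_triangle.
Qed.

Lemma dense_sequence : exists e : nat -> Y,
  forall y (r : R), 0 < r -> exists n, mdist y (e n) < r.
Proof.
have [[D cD dD] _ _ _] := hY.
have hit y (r : R) : 0 < r -> exists2 z, D z & mdist y z < r.
  move=> r0; have [] := dD [set y' : Y | mdist y y' < r].
  - by exists y; rewrite /= mdistxx.
  - exact: mdist_ball_open.
  - by move=> z [/= yz Dz]; exists z.
have /countable_injP[f finj] := cD.
pose P n z := D z /\ f z = n.
exists (fun n => get (P n)) => y r r0.
have [z Dz yz] := hit y r r0; exists (f z).
have [Dg fg] : P (f z) (get (P (f z))) by apply: getPex; exists z.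
by have <- : z = get (P (f z)) by apply: finj; rewrite ?inE.
Qed.

Lemma mdist_ball_caratheodory y (r : R) : muY.-caratheodory [set y' | mdist y y' < r].
Proof.
by have [_ + _ _] := hY; apply; apply: sub_sigma_algebra; exact: mdist_ball_open.
Qed.
End separable.

Section squash.
Context {R : realType}.
Implicit Types (x y : R) (a b : \bar R).

Let sq x : R := x / (1 + `|x|).

Let den x : 0 < 1 + `|x|. Proof. by rewrite ltr_pwDl. Qed.

Let sqN x : sq (- x) = - sq x. Proof. by rewrite /sq normrN mulNr. Qed.

Let sq_ge0 x : 0 <= x -> 0 <= sq x. Proof. by move=> x0; rewrite divr_ge0// ltW. Qed.

Let sq_le x : 0 <= x -> sq x <= x.
Proof. by move=> x0; rewrite /sq ler_pdivrMr// ler_peMr// lerDl. Qed.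

Let sq_gt0 x : 0 < x -> 0 < sq x. Proof. by move=> x0; rewrite divr_gt0. Qed.

Let sqB x y : 0 <= y -> y <= x -> sq x - sq y = (x - y) / ((1 + x) * (1 + y)).
Proof.
move=> y0 yx; rewrite /sq !ger0_norm// ?(le_trans y0)//; field.
by rewrite !gt_eqF// ltr_pwDl// (le_trans y0).
Qed.

Let sq_lip0 x y : 0 <= y -> y <= x -> 0 <= sq x - sq y <= x - y.
Proof.
move=> y0 yx; have x0 := le_trans y0 yx; rewrite sqB//.
have d1 : 1 <= (1 + x) * (1 + y) by rewrite -[leLHS]mulr1 ler_pM// lerDl.
have d0 := lt_le_trans ltr01 d1.
by rewrite divr_ge0 ?subr_ge0 ?(ltW d0)//= ler_pdivrMr// ler_peMr// subr_ge0.
Qed.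

Let sq_lip1 x y : y <= x -> 0 <= sq x - sq y <= x - y.
Proof.
move=> yx; have [y0|y0] := leP 0 y; first exact: sq_lip0.
have [x0|x0] := leP 0 x.
  have := sq_ge0 x0; have := sq_le x0.
  have y0' : 0 <= - y by rewrite oppr_ge0 ltW.
  by have := sq_ge0 y0'; have := sq_le y0'; rewrite sqN; lra.
have x0' : 0 <= - x by rewrite oppr_ge0 ltW.
have := @sq_lip0 (- y) (- x) x0'; rewrite !sqN lerN2 => /(_ yx).
lra.
Qed.

(** A bounded injective 1-Lipschitz function, which makes any measurable
function integrable on sets of finite measure. *)
Definition squash a : \bar R := (sq (fine a))%:E.

Lemma squash_le1 a : (`|squash a| <= 1)%E.
Proof.
rewrite lee_fin /sq normrM normfV (ger0_norm (ltW (den _))) ler_pdivrMr// mul1r.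
by rewrite lerDr.
Qed.

(** If a or b is infinite then the right-hand side is +oo, even for oo - oo. *)
Lemma squash_lip a b : (`|squash a - squash b| <= `|a - b|)%E.
Proof.
case: a => [x| |]; case: b => [y| |]; rewrite /= ?leey//.
rewrite /squash/= lee_fin; have [yx|/ltW xy] := leP y x.
  by rewrite !ger0_norm ?subr_ge0//; have := sq_lip1 yx; lra.
by rewrite distrC [leRHS]distrC !ger0_norm ?subr_ge0//; have := sq_lip1 xy; lra.
Qed.

Let sq_ltr x y : y < x -> sq y < sq x.
Proof.
move=> yx; have [y0|y0] := leP 0 y.
  have d0 : 0 < (1 + x) * (1 + y).
    by rewrite mulr_gt0// ltr_pwDl// (le_trans y0)// ltW.
  by rewrite -subr_gt0 (sqB y0 (ltW yx)) divr_gt0// subr_gt0.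
have [x0|x0] := leP 0 x.
  have y0' : 0 < - y by rewrite oppr_gt0.
  by have := sq_ge0 x0; have := sq_gt0 y0'; rewrite sqN; lra.
have x0' : 0 <= - x by rewrite oppr_ge0 ltW.
have xy' : - x <= - y by rewrite lerN2 ltW.
have d0 : 0 < (1 + - y) * (1 + - x).
  by apply: mulr_gt0; move: x0' xy'; lra.
by rewrite -ltrN2 -!sqN -subr_gt0 (sqB x0' xy') divr_gt0// subr_gt0 ltrN2.
Qed.

Lemma squash_inj x y : squash x%:E = squash y%:E -> x = y.
Proof.
case=> /= sxy; have [xy|xy|//] := ltgtP x y.
  by have := sq_ltr xy; rewrite sxy ltxx.
by have := sq_ltr xy; rewrite sxy ltxx.
Qed.

Lemma fine_squash_cvg (v : nat -> R) (l : R) : v n @[n --> \oo] --> l ->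
  fine (squash (v n)%:E) @[n --> \oo] --> fine (squash l%:E).
Proof.
move=> /cvgrPdist_lt vl; apply/cvgrPdist_lt => e /vl; apply: filterS => n.
apply: le_lt_trans; have := squash_lip l%:E (v n)%:E.
by rewrite -!EFinB lee_fin.
Qed.

Lemma measurable_squash (d : measure_display) (T : measurableType d) (f : T -> \bar R) :
  measurable_fun setT f -> measurable_fun setT (squash \o f).
Proof.
move=> mf; apply/measurable_EFinP.
have mff : measurable_fun setT (fun x : T => fine (f x)).
  exact: measurableT_comp (@fine_measurable _ _ _) mf.
apply: (measurableT_comp (f := sq : measurableTypeR R -> R)) mff.
apply: continuous_measurable_fun => x; apply/cvgrPdist_lt => e e0.
near=> y; apply: (@le_lt_trans _ _ `|x - y|).
  by have := squash_lip x%:E y%:E; rewrite -!EFinB lee_fin.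
by near: y; exact: cvgr_dist_lt.
Unshelve. all: by end_near. Qed.
End squash.

Lemma abse_sub_fin (R : realType) (a b : \bar R) : (`|a - b| < +oo)%E ->
  a \is a fin_num /\ b \is a fin_num.
Proof. by case: a => [x| |]; case: b => [y| |]. Qed.

Section summable.
Context {dd : measure_display} {T : measurableType dd} {R : realType}.
Variable mu : {measure set T -> \bar R}.
Local Open Scope ereal_scope.

(** The Borel-Cantelli argument: summable integrals force almost everywhere
convergence to 0. *)
Lemma summable_ae_small (f : nat -> T -> \bar R) (C : R) :
  (forall n, measurable_fun setT (f n)) -> (forall n x, 0 <= f n x) ->
  (forall n, \int[mu]_x f n x <= (C / (2 ^ (n + 1))%:R)%:E) ->
  {ae mu, forall x, f n x @[n --> \oo] --> 0}.
Proof.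
move=> mf f0 fC.
have : \int[mu]_x (\sum_(n <oo) f n x) < +oo.
  rewrite integral_nneseries//.
  apply: (@le_lt_trans _ _ (\sum_(n <oo) (C / (2 ^ (n + 1))%:R)%:E)).
    by apply: lee_nneseries => n _ => [_|]; [exact: integral_ge0|exact: fC].
  by have /cvg_lim -> := @cvg_geometric_eseries_half R C 0; rewrite ?ltry.
move=> Sfin.
have mS : measurable_fun setT (fun x => \sum_(n <oo) f n x).
  by apply: ge0_emeasurable_sum.
have : mu.-integrable setT (fun x => \sum_(n <oo) f n x).
  apply/integrableP; split => //; under eq_integral do rewrite gee0_abs ?nneseries_ge0//.
  by [].
move=> /(integrable_ae measurableT) Sae; apply: (ae_imp Sae) => x /(_ I) Sx.
have Sx' : \sum_(n <oo) f n x < +oo by rewrite -ge0_fin_numE ?nneseries_ge0.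
have := nneseries_tail_cvg Sx' (fun k _ => f0 k x).
apply: (@squeeze_cvge _ _ _ _ (cst 0) _ (fun n => \sum_(n <= k <oo) f k x)).
- apply: nearW => n; rewrite f0/=.
  by have := @nneseries_lim_ge _ (f ^~ x) xpredT n n.+1; rewrite big_nat1; apply.
- exact: cvg_cst.
Qed.
End summable.

Section locally_constant_limit.
Context {R : realType} {Y : pmetricType R} (muY : {outer_measure set Y -> \bar R}).
Hypotheses (hY : metric_measure_space muY) (lenY : length_space (@mdist R Y)).
Local Notation CY := (caratheodory_type muY).
Local Notation nu := (muY : set CY -> \bar R).

Lemma ball_mdistE y (r : R) : ball y r = [set y' : Y | mdist y y' < r].
Proof. by rewrite ballEmdist. Qed.

(** Balls have positive measure. *)
Lemma ae_ball_point (P : Y -> Prop) (y : Y) (r : R) : 0 < r ->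
  {ae nu, forall z, P z} -> exists2 z, mdist y z < r & P z.
Proof.
move=> r0 [B [mB B0 PB]]; apply: contrapT => nP.
have [_ _ _ /(_ y r r0)/andP[+ _]] := hY.
apply/negP; rewrite -leNgt -B0 ball_mdistE; apply: le_outer_measure => z /= yz.
by apply: PB => Pz; apply: nP; exists z.
Qed.

(** Values attached to overlapping balls agree, so a path joining two points
carries a locally constant function. *)
Lemma locally_constant_path (k : Y -> R) :
  (forall x, exists2 r, 0 < r & forall y, mdist x y < r -> k y = k x) ->
  forall x y, k x = k y.
Proof.
move=> kloc x y; have [[g [a [b [[[ab gc] _] <- <-]]]] _] := (lenY.1 x y, I).
pose cl (s : R) := Num.max a (Num.min s b).
have cl_itv s : cl s \in `[a, b] by rewrite in_itv/= le_max lexx/= ge_max ab ge_min lexx orbT.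
have cl_lip s t : `|cl s - cl t| <= `|s - t|.
  have := ler_norm (s - t); have := ler_norm (t - s); rewrite [`|t - s|]distrC.
  rewrite ler_norml /cl /Order.max /Order.min; do !case: ifPn; rewrite -?leNgt; lra.
suff D (s : R) : is_derive s 1 (fun s : R => k (g (cl s))) 0.
  have := is_derive_0_is_cst a b D.
  by rewrite /cl (min_l ab) maxxx minxx (max_r ab).
have [r r0 kr] := kloc (g (cl s)).
have [d d0 gd] := gc _ (cl_itv s) _ r0.
have near_eq : \forall t \near s, k (g (cl s)) = k (g (cl t)).
  near=> t; apply/esym/kr/gd => //; rewrite distrC; apply: le_lt_trans (cl_lip _ _) _.
  by near: t; apply/nbhs_ballP; exists d.
apply: (@near_eq_is_derive _ _ _ (fun=> k (g (cl s))) _ s 1 0 near_eq).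
Unshelve. all: by end_near. Qed.

(** The local limits agree on overlaps, hence everywhere; countably many balls,
centred in a dense sequence and each inside a good ball, cover the space. *)
Lemma ae_limit_constant (v : nat -> Y -> R) :
  (forall x, exists k r : R, 0 < r /\
    {ae nu, forall y, mdist x y < r -> v n y @[n --> \oo] --> k}) ->
  exists k : R, {ae nu, forall y, v n y @[n --> \oo] --> k}.
Proof.
move=> /choice[k /choice[r kr]].
have r0 x : 0 < r x := (kr x).1.
have kr1 x y : mdist x y < r x -> k y = k x.
  move=> xy; pose e := Num.min (r y) (r x - mdist x y).
  have e0 : 0 < e by rewrite lt_min r0 subr_gt0.
  have [z yz [vx vy]] := @ae_ball_point (fun z => (mdist x z < r x -> v n z @[n --> \oo] --> k x) /\
     (mdist y z < r y -> v n z @[n --> \oo] --> k y)) y e e0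
     (ae_imp2 (kr x).2 (kr y).2 (fun z a b => conj a b)).
  move: yz; rewrite lt_min => /andP[yz1 yz2].
  apply: (cvg_unique _ (vy yz1)); first exact: Rhausdorff.
  apply: vx; apply: le_lt_trans (metric_triangle x y z) _; lra.
have kc x y : k x = k y.
  by apply: locally_constant_path => {}x; exists (r x) => // y'; exact: kr1.
exists (k point); have [e eD] := dense_sequence hY.
pose P i j := exists x, forall y, mdist (e i) y < j.+1%:R^-1 -> mdist x y < r x.
have aeij : {ae nu, forall y, forall i j, P i j -> mdist (e i) y < j.+1%:R^-1 ->
    v n y @[n --> \oo] --> k point}.
  apply/ae_foralln => i; apply/ae_foralln => j.
  have [[x xP]|nP] := pselect (P i j); last by apply: aeW.
  apply: (ae_imp (kr x).2) => y vy _ /xP xy.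
  by rewrite (kc point x); exact: vy.
apply: (ae_imp aeij) => y vy.
have : 0 < r y / 2 by rewrite divr_gt0.
move=> /ltr_add_invr[j]; rewrite add0r => jr.
have j0 : 0 < j.+1%:R^-1 :> R by rewrite invr_gt0.
have [i yi] := eD y _ j0.
apply: (vy i j) => //; last by rewrite metric_sym.
exists y => z iz; apply: le_lt_trans (metric_triangle y (e i) z) _.
rewrite [ltRHS](_ : _ = r y / 2 + r y / 2); last by field.
by apply: ltrD; apply: lt_trans jr.
Qed.

End locally_constant_limit.

(** * The half-line warped over a space *)

Lemma dist_lt_double (R : realType) (x q x' d : R) :
  x - d < q -> q < x + d -> `|q - x'| < d -> `|x - x'| < 2 * d.
Proof. by rewrite !ltr_norml; lra. Qed.

Lemma set_dist_lt (R : realType) (q d : R) :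
  [set x | `|q - x| < d] = `]q - d, q + d[%classic.
Proof. by apply/seteqP; split => x /=; rewrite in_itv/= ltr_norml; lra. Qed.

Section filling.
Context {R : realType} (N : R * R -> R) {Y : pmetricType R}
  (muY : {outer_measure set Y -> \bar R}) (W : R -> R) (w : {nnfun R >-> R}).
Local Notation mu := (@lebesgue_measure R).

(** Both solid fillings are of this form. *)
Definition filling : mmspace R :=
  warped_product N (weighted_om w) muY (fun t : halfline R => W (sval t)).

Definition filling_pt (z : halfline R * Y) : filling :=
  @warped_proj R N (halfline R) Y (fun t => W (sval t)) z.

(** The representative is unique except possibly over 0, where the warping
function may vanish. *)
Definition filling_repr (h : filling) : halfline R * Y :=
  @mquot_repr R (halfline R * Y)%type (warped_pdist N (fun t : halfline R => W (sval t))) h.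

Hypotheses (hN : warping_norm N) (hY : metric_measure_space muY).
Hypothesis lenY : length_space (@mdist R Y).
Hypothesis muYfin : (muY [set: Y] < +oo)%E.
Hypothesis W0 : forall t, 0 <= t -> 0 <= W t.
Hypothesis Wpos : forall t, 0 < t -> 0 < W t.
Hypothesis Wmono : forall s t, 0 <= s -> s <= t -> W s <= W t.
Hypothesis mw : measurable_fun setT (w : R -> R).
Hypothesis w_loc : forall n : nat, (\int[mu]_(t in `[0%R, n%:R]) (w t)%:E < +oo)%E.

Local Notation wd := (@warped_pdist R N (halfline R) Y (fun t => W (sval t))).
Local Notation dH := (@mmdist R filling).

Let wdP : pseudometric wd := warped_pdist_pseudometric hN W0 lenY.

Lemma filling_dist z z' : dH (filling_pt z) (filling_pt z') = wd z z'.
Proof. exact: mquot_distE. Qed.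

Lemma filling_reprK h : filling_pt (filling_repr h) = h.
Proof. exact: mquot_reprK. Qed.

Lemma filling_dist_pseudometric : pseudometric dH.
Proof. exact: mquot_dist_pseudometric. Qed.

(** Near a point of positive height W is bounded below, so that the warped
distance separates points of the same fibre. *)
Lemma filling_dist_gt0 z z' : 0 < sval z.1 -> filling_pt z = filling_pt z' -> z = z'.
Proof.
move=> t0 E.
have E0 : wd z z' = 0 by rewrite -filling_dist E; case: filling_dist_pseudometric => + _ _; apply.
have e1 : sval z.1 = sval z'.1.
  have := warped_pdist_ge1 hN W0 lenY z z'; rewrite E0 normr_le0 subr_eq0.
  by move=> /eqP.
have h2 : 0 < sval z.1 / 2 by rewrite divr_gt0.
have := @warped_pdist_ge2 R N Y W hN W0 lenY z z' (sval z.1 / 2) (W (sval z.1 / 2))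
  (ltW (Wpos h2)).
rewrite E0 => /(_ _)/wrap[x x0 zx|].
  by apply: Wmono; [exact: ltW|move: zx; rewrite ltr_norml; lra].
rewrite ge_min leNgt h2/= pmulr_rle0; last exact: Wpos.
move=> d0; have /mdist_positivity e2 : mdist z.2 z'.2 = 0.
  by apply/eqP; rewrite eq_le d0 mdist_ge0.
case: z z' e1 e2 {t0 E E0 h2 d0} => [t y] [t' y'] /= e1 ->.
by congr pair; rewrite -(halfline_ofK t) e1 halfline_ofK.
Qed.

Lemma filling_height_lip z z' : `|sval z.1 - sval z'.1| <= dH (filling_pt z) (filling_pt z').
Proof. by rewrite filling_dist; exact: warped_pdist_ge1. Qed.

Local Notation CX := (caratheodory_type (weighted_om w)).
Local Notation CY := (caratheodory_type muY).
Local Notation pi := (product_om (weighted_om w) muY).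
Local Notation CP := (caratheodory_type pi).
Local Notation CH := (caratheodory_type (mmeas filling)).
Local Notation RB := (measurableTypeR R).
Local Notation BH := (g_sigma_algebraType (@mmopen R filling)).

(** The parametrization of the filling by the whole plane, whose domain carries
Borel sets in the first variable. *)
Definition filling_of (q : R * Y) : filling := filling_pt (halfline_of q.1, q.2).

Lemma filling_ofE z : filling_pt z = filling_of (sval z.1, z.2).
Proof. by rewrite /filling_of /= halfline_ofK; case: z. Qed.

(** Balls for the warped distance contain products of balls, and the plane is
second countable, so open sets pull back to countable unions of rectangles. *)
Lemma filling_of_open (U : set filling) : mmopen U ->
  measurable (filling_of @^-1` U : set (RB * CY)).
Proof.
move=> oU; have [e eD] := dense_sequence hY.
pose rect (i : nat * nat * rat) : set (RB * CY) :=
  [set x : RB | `|ratr i.2 - x| < i.1.2.+1%:R^-1] `*`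
  [set y | mdist (e i.1.1) y < i.1.2.+1%:R^-1].
pose I : set (nat * nat * rat) := [set i | rect i `<=` filling_of @^-1` U].
have -> : filling_of @^-1` U = \bigcup_(i in I) rect i.
  apply/seteqP; split => [[x y] /= Uxy|[x y] [i Ii /Ii]//].
  have [r r0 rU] := oU _ Uxy.
  pose M := W (Num.max 0 x + 2).
  have M0 : 0 <= M by apply: W0; rewrite addr_ge0// le_max lexx.
  have : 0 < r / (2 * (2 + M)) by rewrite divr_gt0// mulr_gt0// ltr_wpDr.
  move=> /ltr_add_invr[n]; rewrite add0r => nr.
  have [d [d0 d1 nd dE]] : exists d : R,
      [/\ 0 < d, d <= 1, d < r / (2 * (2 + M)) & n.+1%:R^-1 = d].
    by exists n.+1%:R^-1; rewrite invr_gt0 invf_le1// ler1n.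
  have [k yk] := eD y _ d0.
  have [|q] := @rat_in_itvoo R (x - d) (x + d); first by lra.
  rewrite in_itv/= => /andP[q1 q2].
  exists ((k, n), q).
    suff near (x' : R) (y' : Y) : `|ratr q - x'| < d ->
        mdist (e k) y' < d -> U (filling_of (x', y')).
      by move=> [x' y'] [/=]; rewrite dE => xq' yk'; exact: near.
    move=> xq' yk'; apply: rU.
    change (dH (filling_pt (halfline_of x, y)) (filling_pt (halfline_of x', y')) < r).
    rewrite filling_dist.
    apply: le_lt_trans (warped_pdist_le hN W0 lenY _ _) _ => /=.
    have xx' : `|x - x'| < 2 * d by exact: dist_lt_double q1 q2 xq'.
    have yy' : mdist y y' < 2 * d.
      apply: le_lt_trans (metric_triangle y (e k) y') _; rewrite mulr2n mulrDl mul1r.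
      exact: ltrD.
    have h1 : `|Num.max 0 x - Num.max 0 x'| <= `|x - x'| by exact: halfline_of_lip.
    have h2 : W (Num.max 0 x') <= M.
      apply: Wmono; first by rewrite le_max lexx.
      by move: h1 xx'; rewrite ler_norml; lra.
    have h3 : W (Num.max 0 x') * mdist y y' <= M * (2 * d).
      by apply: ler_pM; rewrite ?W0 ?le_max ?lexx ?mdist_ge0// ltW.
    rewrite ltr_pdivlMr in nd; last by rewrite mulr_gt0// ltr_wpDr.
    apply: le_lt_trans (lerD h1 h3) _.
    by move: xx' nd; rewrite mulrDr; lra.
  rewrite /rect/= dE; split => /=; last by rewrite metric_sym.
  by rewrite ltr_norml; lra.
rewrite bigcup_mkcond; apply: countable_bigcupT_measurable => [|i]; first exact: countableP.
case: ifPn => // _; apply: measurableX; last exact: (mdist_ball_caratheodory hY).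
rewrite set_dist_lt; exact: measurable_itv.
Qed.

Lemma measurable_filling_of :
  measurable_fun setT (filling_of : (RB * CY)%type -> BH).
Proof.
apply: (@measurability _ _ _ BH setT _ (@mmopen R filling)) => //.
by move=> _ [U oU <-]; rewrite setTI; exact: filling_of_open.
Qed.

Lemma measurable_sval_pair :
  measurable_fun setT ((fun z => (sval z.1, z.2)) : (CX * CY)%type -> (RB * CY)%type).
Proof.
apply/measurable_fun_pairP; split.
  exact: (measurableT_comp (measurable_sval mw) measurable_fst).
exact: measurable_snd.
Qed.

Lemma measurable_filling_pt :
  measurable_fun setT (filling_pt : (CX * CY)%type -> BH).
Proof.
rewrite (_ : filling_pt = filling_of \o (fun z => (sval z.1, z.2))).
  exact: (measurableT_comp measurable_filling_of measurable_sval_pair).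
by apply/funext => z; rewrite filling_ofE.
Qed.

Lemma halfline_sf : sigma_finite setT (weighted_om w : set CX -> \bar R).
Proof. exact: halfline_sigma_finite. Qed.

Lemma space_sf : sigma_finite setT (muY : set CY -> \bar R).
Proof.
exists (fun=> setT); first by rewrite bigcup_const//; exists 0%N.
by move=> _; split => //; exact: measurableT.
Qed.

Local Notation mX := (cara_measure halfline_sf).
Local Notation mY := (cara_measure space_sf).

Lemma weighted_om1 t : weighted_om w [set t] = 0%E.
Proof.
rewrite weighted_outerE//; rewrite image_set1; last exact: measurable_set1.
by rewrite integral_set1.
Qed.

Lemma product_outer_setX0 (A : set (halfline R)) (B : set Y) :
  muY B = 0%E -> pi (A `*` B) = 0%E.
Proof.
move=> B0; apply/eqP; rewrite eq_le outer_measure_ge0 andbT.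
apply: (@le_trans _ _ (pi (setT `*` B))).
  by apply: le_outer_measure => z [].
apply: le_trans (product_outer_rect_le _ _) _.
- exact: (@measurableT _ CX).
- exact: caratheodory_null.
- by rewrite B0 mule0.
Qed.

Lemma product_outer_set0X (A : set (halfline R)) (B : set Y) :
  weighted_om w A = 0%E -> pi (A `*` B) = 0%E.
Proof.
move=> A0; apply/eqP; rewrite eq_le outer_measure_ge0 andbT.
apply: (@le_trans _ _ (pi (A `*` setT))).
  by apply: le_outer_measure => z [].
apply: le_trans (product_outer_rect_le _ _) _.
- exact: caratheodory_null.
- exact: (@measurableT _ CY).
- by rewrite A0 mul0e.
Qed.

Lemma mmeas_fillingE A : mmeas filling A = pi (filling_pt @^-1` A).
Proof. by []. Qed.

Lemma filling_caratheodory A : pi.-caratheodory (filling_pt @^-1` A) ->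
  (mmeas filling).-caratheodory A.
Proof. by move=> cA S; exact: (cA (filling_pt @^-1` S)). Qed.

(** The projection is injective off the fibre over 0, which is a null set. *)
Lemma measurable_filling_pt_caratheodory :
  measurable_fun setT (filling_pt : CP -> CH).
Proof.
move=> _ A mA; rewrite setTI.
suff cA : pi.-caratheodory (filling_pt @^-1` A) by [].
move=> S; pose Z : set (halfline R * Y) := [set halfline_of 0] `*` setT.
have Z0 : pi Z = 0%E by apply: product_outer_set0X; exact: weighted_om1.
pose S' := S `\` Z.
have S'E : filling_pt @^-1` (filling_pt @` S') = S'.
  apply/seteqP; split => [z [z' S'z' E]|z S'z]; last by exists z.
  suff <- : z' = z by [].
  apply: filling_dist_gt0 E; rewrite lt_neqAle (halfline_ge0 z'.1) andbT.
  apply/eqP => E; apply: S'z'.2; split => //=.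
  by rewrite E halfline_ofK.
have SE B : pi (S `&` B) = pi (S' `&` B).
  apply/eqP; rewrite eq_le; apply/andP; split; last first.
    by apply: le_outer_measure => z [[]].
  apply: (@le_trans _ _ (pi ((S' `&` B) `|` Z))).
    apply: le_outer_measure => z [Sz Bz].
    by have [Zz|nZz] := pselect (Z z); [right|left].
  by apply: le_trans (outer_measureU2 _ _ _) _; rewrite Z0 adde0.
have cA : (mmeas filling).-caratheodory A by [].
have := cA (filling_pt @` S').
rewrite !mmeas_fillingE !preimage_setI preimage_setC S'E.
by rewrite -[in X in X = _ -> _](setIT S') -!SE setIT.
Qed.

Lemma measurable_id_filling : measurable_fun setT (id : CH -> BH).
Proof.
move=> _ A mA; rewrite setTI; apply: filling_caratheodory.
apply: (@product_measurable_caratheodory _ _ _ _ _ (filling_pt @^-1` A)).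
by rewrite -[X in measurable X]setTI; exact: measurable_filling_pt.
Qed.

Lemma measurable_borel (g : filling -> \bar R) : borel_function g ->
  measurable_on setT g.
Proof. by move=> bg; exact: (measurableT_comp bg measurable_id_filling). Qed.

Local Open Scope ereal_scope.

(** The measure of the filling is an image measure. *)
Lemma integral_filling (f : filling -> \bar R) : measurable_on setT f ->
  (forall h, 0 <= f h) ->
  mm_integral setT f = \int[(pi : set CP -> \bar R)]_z f (filling_pt z).
Proof.
move=> mf f0.
have := @ge0_integral_pushforward _ _ _ _ _ _ measurable_filling_pt_caratheodory
  (pi : set CP -> \bar R) setT f measurableT.
by rewrite preimage_setT => <-.
Qed.

Lemma integral_filling_borel (f : filling -> \bar R) : borel_function f ->
  (forall h, 0 <= f h) ->
  mm_integral setT f = \int[mX \x mY]_z f (filling_pt z).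
Proof.
move=> bf f0; rewrite integral_filling//; last exact: measurable_borel.
rewrite -(integral_product_outer halfline_sf space_sf)//.
exact: (measurableT_comp bf measurable_filling_pt).
Qed.

Local Open Scope ring_scope.

Lemma mmopen_caratheodory (U : set filling) : mmopen U -> (mmeas filling).-caratheodory U.
Proof.
move=> oU; have mU : measurable (U : set BH) by exact: sub_sigma_algebra.
by have := measurable_id_filling measurableT mU; rewrite setTI.
Qed.

Lemma filling_ballP (h : filling) (r : R) :
  (mmeas filling).-caratheodory (mmball h r) /\ (mmeas filling (mmball h r) < +oo)%E.
Proof.
have [d0 dC dT] := filling_dist_pseudometric; split.
  apply: mmopen_caratheodory => h' hh'; exists (r - dH h h'); first by rewrite subr_gt0.
  move=> h''; rewrite /mmball/= ltrBrDl; apply: le_lt_trans; exact: dT.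
have [n hn] : exists n : nat, sval (filling_repr h).1 + r < n%:R.
  by eexists; exact: le_lt_trans (ler_norm _) (archi_boundP (normr_ge0 _)).
pose A : set (halfline R) := sval @^-1` [set` `]-oo, n%:R]].
have svA : sval @` A = `[0, n%:R]%classic.
  rewrite sval_preimage; apply/seteqP; split => x /=; rewrite !in_itv/= andbT.
    by move=> [-> ->].
  by move=> /andP[-> ->].
have mA : measurable (sval @` A : set RB) by rewrite svA; exact: measurable_itv.
have cA : (weighted_om w).-caratheodory A by exact: halfline_caratheodory.
rewrite mmeas_fillingE; apply: (@le_lt_trans _ _ (pi (A `*` setT))).
  apply: le_outer_measure => z /= hz; split => //=; rewrite /A/= in_itv/=.
  move: hz; rewrite /mmball/= -(filling_reprK h) => hz.
  have := le_lt_trans (filling_height_lip _ _) hz.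
  by rewrite ltr_norml => /andP[+ _]; move: hn; lra.
apply: le_lt_trans (product_outer_rect_le cA (@measurableT _ CY)) _.
rewrite weighted_outerE// svA.
apply: lte_mul_pinfty => //; first by apply: integral_ge0 => x _; rewrite lee_fin.
rewrite ge0_fin_numE//; by apply: integral_ge0 => x _; rewrite lee_fin.
Qed.

Lemma vertical_dist (x x' : R) y : dH (filling_of (x, y)) (filling_of (x', y)) <= `|x - x'|.
Proof.
rewrite filling_dist (warped_pdist_vertical hN W0 lenY); exact: halfline_of_lip.
Qed.

Lemma vertical_path (s t : R) y : s <= t -> ac_path dH (fun x => filling_of (x, y)) s t.
Proof.
move=> st; apply: (dominated_ac_path filling_dist_pseudometric st (@acont_id R s t)).
move=> x x' _ xx' _; apply: le_trans (vertical_dist _ _ _) _.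
by rewrite distrC ger0_norm// subr_ge0.
Qed.

(** Vertical rays are parametrized with speed at most one. *)
Lemma vertical_gradient u g (s t : R) y : upper_gradient g u -> 0 <= s -> s < t ->
  (`| u (filling_of (t, y)) - u (filling_of (s, y)) | <=
   tail_integral (fun x => g (filling_of (x, y))) s)%E.
Proof.
move=> [_ g0 gu] s0 st; apply: le_trans (gu _ _ _ (vertical_path y (ltW st)) _) _.
  exists s, t; split; rewrite ?in_itv/= ?lexx ?ltW// => E.
  have t0 := le_lt_trans s0 st.
  have E' : (halfline_of t, y) = (halfline_of s, y).
    by apply: filling_dist_gt0 (esym E); rewrite /= max_r ?ltW.
  have := congr1 (fun z : halfline R * Y => sval z.1) E'; rewrite [LHS]/= [RHS]/=.
  rewrite !max_r ?(ltW t0)// => ts.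
  by move: st; rewrite ts ltxx.
rewrite /path_integral /tail_integral.
apply: (@le_trans _ _ (\int[mu]_(x in `[s, t]) g (filling_of (x, y)))%E).
  apply: le_integral_ge0 => x _.
    by rewrite mule_ge0 ?lee_fin ?metric_speed_ge0//; exact: filling_dist_pseudometric.
  rewrite -[leRHS]mule1; apply: lee_wpmul2l => //; rewrite lee_fin.
  apply: metric_speed_le => //; exists 1 => // v _ _; rewrite mul1r.
  exact: vertical_dist.
apply: integral_subset_ge0 => // x /=; rewrite !in_itv/= andbT.
by case/andP.
Qed.

Hypothesis Wlsc : forall t e, 0 < t -> 0 < e ->
  exists2 d, 0 < d & forall x, 0 <= x -> `|t - x| < d -> W t - e <= W x.

Lemma horizontal_dist (t : R) y y' : 0 <= t ->
  dH (filling_of (t, y)) (filling_of (t, y')) <= W t * mdist y y'.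
Proof.
move=> t0; rewrite filling_dist -[t in W t](sval_halfline_of t0).
exact: warped_pdist_fiber.
Qed.

(** Near a fibre over t, the warped distance between points of that fibre is
at most W t and at least almost W t times their distance. *)
Lemma horizontal_speed (t : R) (c : R -> Y) x l : 0 < t ->
  speed_at dH (fun s => filling_of (t, c s)) x l ->
  speed_at (@mdist R Y) c x (l / W t).
Proof.
move=> t0 sl e e0; have Wt := Wpos t0.
pose L := `|l| + 1; have L0 : 0 < L by rewrite ltr_wpDl.
pose eta := Num.min (W t / 2) (e * W t ^+ 2 / (8 * L)).
have eta0 : 0 < eta by rewrite lt_min !divr_gt0// ?mulr_gt0// exprn_gt0.
have [d d0 dW] := Wlsc t0 eta0.
have e1 : 0 < Num.min 1 (e * W t / 4) by rewrite lt_min ltr01 divr_gt0// mulr_gt0.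
have [d1 d10 sd1] := sl _ e1.
exists (Num.min d1 (d / L)); first by rewrite lt_min d10 divr_gt0.
move=> v vx; rewrite lt_min => /andP[vd1 vdL].
set z := (halfline_of t, c v); set z' := (halfline_of t, c x).
set de := `|v - x| in vx vd1 vdL *.
pose q := dH (filling_pt z) (filling_pt z') / de.
have [] : `|q - l| < 1 /\ `|q - l| < e * W t / 4.
  by have := sd1 v vx vd1; rewrite lt_min => /andP[].
rewrite !ltr_norml => /andP[_ ql1] /andP[ql2 ql3].
have qL : q < L by have := ler_norm l; rewrite /L; lra.
have qE : dH (filling_pt z) (filling_pt z') = q * de by rewrite /q divfK// gt_eqF.
have qd : q * de < d by apply: lt_trans (_ : L * de < d); rewrite ?ltr_pM2r// mulrC -ltr_pdivlMr.
pose m := W t - eta.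
have m2 : W t / 2 <= m.
  have : eta <= W t / 2 by rewrite ge_min lexx.
  by rewrite /m; lra.
have m0 : 0 < m by apply: lt_le_trans m2; rewrite divr_gt0.
have lower : m * mdist (c v) (c x) <= q * de.
  have := @warped_pdist_ge2 R N Y W hN W0 lenY z z' d m (ltW m0).
  rewrite (sval_halfline_of (ltW t0)) -filling_dist qE => /(_ dW).
  by rewrite ge_min leNgt qd.
have upper : q * de <= W t * mdist (c v) (c x).
  by rewrite -qE; exact: (horizontal_dist _ _ (ltW t0)).
pose r := mdist (c v) (c x) / de.
have rE : mdist (c v) (c x) = r * de by rewrite /r divfK// gt_eqF.
have r0 : 0 <= r by rewrite divr_ge0 ?mdist_ge0// ltW.
have mr : m * r <= q by rewrite -(ler_pM2r vx) -mulrA -rE.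
have qr : q <= W t * r by rewrite -(ler_pM2r vx) -[leRHS]mulrA -rE.
have r2 : W t * r <= 2 * L.
  have : W t / 2 * r <= m * r by exact: ler_wpM2r.
  by lra.
have etar : eta * r <= e * W t / 4.
  apply: (@le_trans _ _ (e * W t ^+ 2 / (8 * L) * r)).
    by apply: ler_wpM2r => //; rewrite ge_min lexx orbT.
  have -> : e * W t ^+ 2 / (8 * L) * r = e * W t / (8 * L) * (W t * r).
    by rewrite expr2; ring.
  apply: le_trans (ler_wpM2l _ r2) _.
    by rewrite divr_ge0// mulr_ge0// ltW.
  rewrite le_eqVlt; apply/orP; left; apply/eqP; field.
  by rewrite gt_eqF.
have rl : W t * (r - l / W t) = W t * r - l by rewrite mulrBr [X in _ - X]mulrC divfK// gt_eqF.
have mrE : m * r = W t * r - eta * r by rewrite /m mulrBl.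
have eW : 0 < e * W t by rewrite mulr_gt0.
rewrite -/r -(ltr_pM2l Wt) -[X in _ && X](ltr_pM2l Wt) rl mulrN [W t * e]mulrC.
by apply/andP; split; lra.
Qed.

(** This holds at every point, including those where one of the speeds does not
exist. *)
Lemma horizontal_metric_speed_le (t : R) (c : R -> Y) x : 0 < t ->
  metric_speed dH (fun s => filling_of (t, c s)) x <=
  W t * metric_speed (@mdist R Y) c x.
Proof.
move=> t0; have Wt := Wpos t0.
have [[l sl]|nl] := pselect (exists l, speed_at dH (fun s => filling_of (t, c s)) x l).
  rewrite (metric_speedE sl) (metric_speedE (horizontal_speed t0 sl)).
  by rewrite mulrC divfK// gt_eqF.
rewrite (metric_speed_none nl); apply: mulr_ge0; first exact: ltW.
by apply: metric_speed_ge0; exact: mdist_pseudometric.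
Qed.

Lemma horizontal_borel (f : filling -> \bar R) (t : R) : 0 <= t -> borel_function f ->
  @borel_function R (mms_of_metric muY) (fun y => f (filling_of (t, y))).
Proof.
move=> t0 bf; apply: (measurableT_comp bf).
apply: (@measurability _ _ (g_sigma_algebraType (@mmopen R (mms_of_metric muY))) BH
  setT _ (@mmopen R filling)) => //.
move=> _ [U oU <-]; rewrite setTI; apply: sub_sigma_algebra => y /= Uy.
have [r r0 rU] := oU _ Uy.
have Wt1 : 0 < W t + 1 by rewrite ltr_wpDl// W0.
exists (r / (W t + 1)); first by rewrite divr_gt0.
move=> y' yy'; apply: rU; apply: le_lt_trans (horizontal_dist _ _ t0) _.
have := yy'; rewrite /mmball/= ltr_pdivlMr// => yr; apply: le_lt_trans yr.
by rewrite mulrC ler_wpM2l ?mdist_ge0// lerDl.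
Qed.

(** Restricting to the fibre over t multiplies upper gradients by the warping
factor. *)
Lemma slice_upper_gradient u g (t : R) : 0 < t -> upper_gradient g u ->
  @upper_gradient R (mms_of_metric muY)
    (fun y => (W t)%:E * g (filling_of (t, y)))%E (fun y => u (filling_of (t, y))).
Proof.
move=> t0 [bg g0 gu]; have Wt := Wpos t0; split.
- apply: emeasurable_funM; first exact: measurable_cst.
  by apply: horizontal_borel => //; exact: ltW.
- by move=> y; rewrite mule_ge0// lee_fin ltW.
move=> c a b ac [s [s' [sab sab' ss']]].
have [ab [f fac fdom]] := ac_path_dominated (mdist_pseudometric Y) ac.
have ac' : ac_path dH (fun s => filling_of (t, c s)) a b.
  apply: (dominated_ac_path filling_dist_pseudometric ab (acont_scale (W t) fac)).
  move=> x x' ax xx' xb; apply: le_trans (horizontal_dist _ _ (ltW t0)) _.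
  by rewrite -mulrBr ler_pM2l//; exact: fdom.
apply: le_trans (gu _ _ _ ac' _) _.
  exists s, s'; split => // /filling_dist_gt0 /=; rewrite max_r ?ltW// => /(_ t0)[].
  exact: ss'.
apply: le_integral_ge0 => x _.
  by rewrite mule_ge0 ?lee_fin ?metric_speed_ge0//; exact: filling_dist_pseudometric.
rewrite muleAC -EFinM muleC; apply: lee_wpmul2r => //; rewrite lee_fin.
exact: horizontal_metric_speed_le.
Qed.

Section tonelli.
Local Open Scope ereal_scope.
Variable k : R * Y -> \bar R.
Hypotheses (mk : measurable_fun setT (k : (RB * CY)%type -> \bar R)) (k0 : forall q, 0 <= k q).

Let mk' : measurable_fun setT ((fun z => k (sval z.1, z.2)) : (CX * CY)%type -> \bar R).
Proof. exact: (measurableT_comp mk measurable_sval_pair). Qed.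

Lemma filling_tonelli_ray : \int[mX \x mY]_z k (sval z.1, z.2) =
  \int[mY]_y \int[mu]_(t in `[0%R, +oo[) (k (t, y) * (w t)%:E).
Proof.
rewrite (@fubini_tonelli2 _ _ _ _ _ mX mY _ mk')//; apply: eq_integral => y _.
apply: (integral_halfline mw (f := fun t => k (t, y))) => //.
exact: (measurableT_comp mk (@pair2_measurable _ _ RB CY y)).
Qed.

Lemma filling_tonelli_slice : \int[mX \x mY]_z k (sval z.1, z.2) =
  \int[mX]_x \int[mY]_y k (sval x, y).
Proof. by rewrite (@fubini_tonelli1 _ _ _ _ _ mX mY _ mk'). Qed.

Lemma measurable_slice t : measurable_fun setT ((fun y => k (t, y)) : CY -> \bar R).
Proof. exact: (measurableT_comp mk (@pair1_measurable _ _ RB CY t)). Qed.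

Lemma measurable_ray y : measurable_fun setT ((fun t => k (t, y)) : RB -> \bar R).
Proof. exact: (measurableT_comp mk (@pair2_measurable _ _ RB CY y)). Qed.

Lemma measurable_ray_integral : measurable_fun setT
  ((fun y => \int[mu]_(t in `[0%R, +oo[) (k (t, y) * (w t)%:E)) : CY -> \bar R).
Proof.
pose k' (q : (CY * RB)%type) :=
  k (q.2, q.1) * (w q.2)%:E * (\1_(`[0%R, +oo[%classic) q.2)%:E.
have mk2 : measurable_fun setT k'.
  apply: emeasurable_funM; first apply: emeasurable_funM.
  - exact: (measurableT_comp mk (@measurable_swap _ _ CY RB)).
  - apply/measurable_EFinP; exact: (measurableT_comp mw measurable_snd).
  - apply/measurable_EFinP; apply: (measurableT_comp (f := \1_(`[0%R, +oo[%classic) : RB -> R)) measurable_snd.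
    by apply: measurable_indic.
have k'0 q : 0 <= k' q by rewrite !mule_ge0 ?lee_fin.
have := @measurable_fun_fubini_tonelli_F _ _ _ _ _ mu _ mk2 k'0.
apply: eq_measurable_fun => y _; rewrite /fubini_F [RHS]integral_mkcond.
apply: eq_integral => t _; rewrite patchE /k' indicE /=.
by case: ifPn => _; rewrite ?mule1 ?mule0.
Qed.

Lemma measurable_tail_integral : measurable_fun setT
  ((fun q => tail_integral (fun s => k (s, q.2)) q.1) : (RB * CY)%type -> \bar R).
Proof.
pose k' (q : (RB * CY) * RB) := if (q.1.1 <= q.2)%R then k (q.2, q.1.2) else 0.
have mk2 : measurable_fun setT k'.
  apply: measurable_fun_ifT.
  - apply: measurable_fun_ler => //; exact: (measurableT_comp measurable_fst measurable_fst).
  - apply: (measurableT_comp mk); apply/measurable_fun_pairP; split => /=.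
      exact: measurable_snd.
    exact: (measurableT_comp measurable_snd measurable_fst).
  - exact: measurable_cst.
have k'0 q : 0 <= k' q by rewrite /k'; case: ifPn.
have := @measurable_fun_fubini_tonelli_F _ _ _ _ _ mu _ mk2 k'0.
apply: eq_measurable_fun => q _; rewrite /fubini_F /tail_integral [RHS]integral_mkcond.
apply: eq_integral => t _; rewrite patchE /k' /=.
by rewrite mem_setE in_itv/= andbT.
Qed.

End tonelli.

(** * Oscillation along rays and across slices *)

Section oscillation.
Variables (p b beta : R).
Hypotheses (p1 : 1 <= p) (b0 : 0 < b) (bbeta : beta = p * b).
Hypothesis w_growth : forall t s : R, 0 <= t -> t <= s -> w t <= expR (- (beta * (s - t))) * w s.
Hypothesis wpos : forall t, 0 < t -> 0 < w t.
Hypothesis Ww : exists T0 : R, forall t, T0 <= t -> W t `^ p <= w t.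

Let p0 : 0 < p. Proof. exact: lt_le_trans p1. Qed.

Variables (u g : filling -> \bar R).
Hypotheses (mu_u : measurable_on setT u) (ug : upper_gradient g u).
Local Open Scope ereal_scope.
Hypothesis gp : mm_integral setT (fun h => g h `^ p) < +oo.

Let bg : borel_function g. Proof. by case: ug. Qed.

Let g0 h : 0 <= g h. Proof. by case: ug => _ + _; exact. Qed.

Let U q := u (filling_of q).
Let G q := g (filling_of q).
Let tail q := tail_integral (fun s => G (s, q.2)) q.1.
Let energy y := \int[mu]_(t in `[0%R, +oo[) (G (t, y) `^ p * (w t)%:E).

Let mG : measurable_fun setT (G : (RB * CY)%type -> \bar R).
Proof. exact: (measurableT_comp bg measurable_filling_of). Qed.

Let G0 q : 0 <= G q. Proof. exact: g0. Qed.

Let mGp : measurable_fun setT ((fun q => G q `^ p) : (RB * CY)%type -> \bar R).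
Proof. exact: (measurableT_comp (measurable_poweR _) mG). Qed.

Let Gp0 q : 0 <= G q `^ p. Proof. exact: poweR_ge0. Qed.

Let gpE : mm_integral setT (fun h => g h `^ p) = \int[mX \x mY]_z (G (sval z.1, z.2) `^ p).
Proof.
rewrite integral_filling_borel; last 2 first.
- exact: (measurableT_comp (measurable_poweR _) bg).
- by move=> h; exact: poweR_ge0.
by apply: eq_integral => z _; rewrite filling_ofE.
Qed.

Let mtail : measurable_fun setT (tail : (RB * CY)%type -> \bar R).
Proof. exact: measurable_tail_integral. Qed.

Let tail0 q : 0 <= tail q. Proof. by apply: integral_ge0 => s _; exact: G0. Qed.

Let mray y : measurable_fun setT ((fun t => G (t, y)) : RB -> \bar R).
Proof. exact: measurable_ray. Qed.

(** Hardy's inequality, applied on each ray. *)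
Lemma hardy_filling : \int[mX \x mY]_z (tail (sval z.1, z.2) `^ p) <=
  (b `^ (- p))%:E * mm_integral setT (fun h => g h `^ p).
Proof.
rewrite gpE (filling_tonelli_ray (k := fun q => tail q `^ p)); last 2 first.
- exact: (measurableT_comp (measurable_poweR _) mtail).
- by move=> q; exact: poweR_ge0.
rewrite (filling_tonelli_ray mGp Gp0) -ge0_integralZl//; last 3 first.
- exact: measurable_ray_integral mGp Gp0.
- by move=> y _; apply: integral_ge0 => t _; rewrite mule_ge0 ?lee_fin.
- by rewrite lee_fin powR_ge0.
apply: le_integral_ge0 => y _.
  by apply: integral_ge0 => t _; rewrite mule_ge0 ?poweR_ge0 ?lee_fin.
exact: (@hardy R b p (fun t => G (t, y)) b0 p1 _ (mray y) beta w bbeta).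
Qed.

Let energy0 y : 0 <= energy y.
Proof. by apply: integral_ge0 => t _; rewrite mule_ge0 ?lee_fin. Qed.

Let energy_fin : {ae mY, forall y, energy y < +oo}.
Proof.
have : mY.-integrable setT energy.
  apply/integrableP; split; first exact: measurable_ray_integral mGp Gp0.
  under eq_integral do rewrite gee0_abs//.
  by rewrite -(filling_tonelli_ray mGp Gp0) -gpE.
move=> /(integrable_ae measurableT) eae; apply: (ae_imp eae) => y /(_ I).
by rewrite ge0_fin_numE.
Qed.

Let tail_le y t : (0 <= t)%R -> tail (t, y) `^ p * (w t)%:E <= (b `^ (1 - p))%:E * energy y.
Proof.
move=> t0; have w0 s : (0 <= w s)%R by exact: fun_ge0.
apply: le_trans (@tail_integral_le R b p (fun t => G (t, y)) b0 p1 (fun=> G0 _) (mray y)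
  beta w bbeta w0 w_growth t t0) _.
apply: lee_wpmul2l; first by rewrite lee_fin powR_ge0.
apply: integral_subset_ge0 => s; last by rewrite mule_ge0 ?lee_fin.
by rewrite /= !in_itv/= !andbT; exact: le_trans.
Qed.

Let tail_fin y t : energy y < +oo -> (0 < t)%R -> tail (t, y) < +oo.
Proof.
move=> ey t0; apply: (@lty_poweRy _ _ p); first by rewrite gt_eqF.
rewrite ltey; apply/eqP => toy; have := tail_le y (ltW t0).
by rewrite toy gt0_mulye ?lte_fin ?wpos// leye_eq => /eqP; apply/eqP; rewrite lt_eqF// lte_mul_pinfty// lee_fin powR_ge0.
Qed.

(** Otherwise the pointwise bound on the tail would bound the weight, which is
unbounded. *)
Let tail_small y (e : R) : energy y < +oo -> (0 < e)%R ->
  exists2 t, (0 < t)%R & tail (t, y) < e%:E.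
Proof.
move=> ey e0; apply: contrapT => nt.
have tl t : (0 < t)%R -> e%:E <= tail (t, y).
  by move=> t0; rewrite leNgt; apply/negP => te; apply: nt; exists t.
have : (b `^ (1 - p))%:E * energy y < +oo by rewrite lte_mul_pinfty// lee_fin powR_ge0.
set K := _ * energy y => Ky.
have K0 : 0 <= K by rewrite mule_ge0 ?lee_fin ?powR_ge0.
have KE : K = (fine K)%:E by rewrite fineK// ge0_fin_numE.
have ew t : (0 < t)%R -> (e `^ p * w t <= fine K)%R.
  move=> t0; rewrite -lee_fin -KE; apply: le_trans (tail_le y (ltW t0)).
  rewrite EFinM; apply: lee_wpmul2r; first by rewrite lee_fin.
  by rewrite -poweR_EFin; apply: le_poweR; [exact: ltW p0|rewrite lee_fin ltW|exact: tl].
have bt0 : (0 < beta)%R by rewrite bbeta mulr_gt0.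
have w1 := wpos ltr01.
have ep : (0 < e `^ p)%R by exact: powR_gt0.
(* at height s the weight is too large for the bound ew *)
pose q := (e `^ p * w 1)%R; have q0 : (0 < q)%R by exact: mulr_gt0.
pose s := (1 + (fine K / q) / beta)%R.
have fK0 : (0 <= fine K)%R by exact: fine_ge0.
have s1 : (1 <= s)%R.
  by rewrite lerDl; apply: divr_ge0; [apply: divr_ge0 => //; exact: ltW|exact: ltW].
have := ew s (lt_le_trans ltr01 s1); apply/negP; rewrite -ltNge.
have : (w 1 * (1 + fine K / q) <= w s)%R.
  have := w_growth ler01 s1.
  rewrite expRN -ler_pdivrMl ?invr_gt0 ?expR_gt0// invrK mulrC; apply: le_trans.
  rewrite ler_pM2l//; apply: le_trans (expR_ge1Dx _) _.
  by rewrite ler_expR /s addrAC subrr add0r [leRHS]mulrC divfK ?gt_eqF.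
move=> /(ler_wpM2l (ltW ep)); apply: lt_le_trans.
rewrite mulrA -/q mulrDr mulr1 [X in (_ + X)%R]mulrC divfK; last by rewrite gt_eqF.
by rewrite ltrDr.
Qed.

(** The energy of a slice far away is at most w t times the integral of g^p over
it. If it exceeded e on almost all of them, the integral of g^p over the filling
would be at least that of the constant e over a half-line. *)
Let good_height (n : nat) (e : R) : (0 < e)%R -> exists t : R, [/\ (n.+1%:R <= t)%R,
  measurable_fun setT ((fun y => U (t, y)) : CY -> \bar R) &
  \int[mY]_y (((W t)%:E * G (t, y)) `^ p) <= e%:E].
Proof.
move=> e0; apply: contrapT => nt; have [T0 WT0] := Ww.
pose S := Num.max T0 n.+1%:R.
have S0 : (0 < S)%R by rewrite lt_max ltr0n orbT.
pose B t := \int[mY]_y (G (t, y) `^ p).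
have B0 t : 0 <= B t by exact: integral_ge0.
have sections : {ae mX, forall x, measurable_fun setT ((fun y => U (sval x, y)) : CY -> \bar R)}.
  have mup : measurable_fun setT ((fun z => u (filling_pt z)) : CP -> \bar R).
    exact: (measurableT_comp mu_u measurable_filling_pt_caratheodory).
  apply: (ae_imp (measurable_sections halfline_sf space_sf mup)) => x.
  by apply: eq_measurable_fun => y _; rewrite filling_ofE.
pose f (t : R) := (e * w t `^ (-1) * \1_(`[S, +oo[%classic) t)%:E.
have mf : measurable_fun setT (f : RB -> \bar R).
  apply/measurable_EFinP; apply: measurable_funM.
    apply: measurable_funM => //.
    exact: (measurableT_comp (measurable_powR _) mw).
  by apply: measurable_indic.
have f0 t : 0 <= f t by rewrite lee_fin !mulr_ge0 ?powR_ge0// ltW.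
have fB : {ae mX, forall x, setT x -> f (sval x) <= B (sval x)}.
  apply: (ae_imp sections) => x mx _; rewrite /f.
  have [xS|xS] := boolP (sval x \in `[S, +oo[); last first.
    by rewrite indicE memNset ?mulr0//; exact/negP.
  rewrite indicE mem_set//= mulr1.
  have Sx : (S <= sval x)%R by move: xS; rewrite in_itv/= andbT.
  have x0 := lt_le_trans S0 Sx; have wx := wpos x0.
  have : e%:E <= (w (sval x))%:E * B (sval x).
    rewrite leNgt; apply/negP => wB; apply: nt; exists (sval x); split => //.
      by apply: le_trans Sx; rewrite le_max lexx orbT.
    under eq_integral do rewrite poweRM ?lee_fin ?(ltW (Wpos x0))//.
    rewrite ge0_integralZl//; last 2 first.
    - exact: measurable_slice mGp (sval x).
    - exact: poweR_ge0.
    apply: le_trans (ltW wB); apply: lee_wpmul2r; first exact: integral_ge0.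
    rewrite poweR_EFin lee_fin; apply: WT0.
    by apply: le_trans Sx; rewrite le_max lexx.
  rewrite (powR_inv1 (ltW wx)).
  case: (B (sval x)) (B0 (sval x)) => [r|_ _|//]; rewrite ?leey// => r0.
  by rewrite -EFinM !lee_fin ler_pdivrMr// mulrC.
have : \int[mX]_x f (sval x) <= \int[mX]_x B (sval x).
  apply: (@ae_le_integral_ge0 _ _ _ mX setT (fun x => f (sval x)) (fun x => B (sval x))).
  - exact: measurableT.
  - exact: (measurableT_comp mf (measurable_sval mw)).
  - by move=> x _; exact: f0.
  - by move=> x _; exact: B0.
  - exact: fB.
rewrite -(filling_tonelli_slice mGp Gp0) -gpE leNgt => /negP; apply.
apply: lt_le_trans gp _.
rewrite (integral_halfline mw f0 mf).
apply: (@le_trans _ _ (\int[mu]_(t in `[S, +oo[) e%:E)).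
  rewrite integral_cst//= lebesgue_measure_itv/= ltry.
  by rewrite addye// gt0_muley ?lte_fin ?leey.
rewrite integral_mkcond [leRHS]integral_mkcond; apply: le_integral_ge0 => t _.
  by apply: erestrict_ge0 => ? _; rewrite lee_fin ltW.
rewrite !patchE; case: ifPn => [|_]; last first.
  by case: ifPn => _; [apply: mule_ge0; rewrite // lee_fin|exact: lexx].
rewrite mem_setE in_itv/= andbT => St; have t0 := lt_le_trans S0 St.
rewrite mem_setE in_itv/= andbT (ltW t0) /f indicE mem_set/= ?in_itv/= ?St//.
by rewrite mulr1 (powR_inv1 (ltW (wpos t0))) -EFinM divfK// gt_eqF// wpos.
Qed.

Let space_ballP (y : Y) (r : R) :
  (mmeas (mms_of_metric muY)).-caratheodory (@mmball R (mms_of_metric muY) y r) /\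
  mmeas (mms_of_metric muY) (@mmball R (mms_of_metric muY) y r) < +oo.
Proof.
split; first exact: (mdist_ball_caratheodory hY).
by apply: le_lt_trans muYfin; exact: le_outer_measure.
Qed.

Let ray_cauchy y s t : (0 < s)%R -> (s < t)%R -> `|U (t, y) - U (s, y)| <= tail (s, y).
Proof. by move=> s0 st; exact: vertical_gradient (ltW s0) st. Qed.

Section heights.
Variable tau : nat -> R.
Hypothesis tau_ge : forall n, (n.+1%:R <= tau n)%R.
Hypothesis mtau : forall n, measurable_fun setT ((fun y => U (tau n, y)) : CY -> \bar R).
Hypothesis tau_energy : forall n,
  \int[mY]_y (((W (tau n))%:E * G (tau n, y)) `^ p) <= (1 / (2 ^ (n + 1))%:R)%:E.

Let tau0 n : (0 < tau n)%R. Proof. by apply: lt_le_trans (tau_ge n). Qed.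

Let tau_near (s : R) : \forall n \near \oo, (s < tau n)%R.
Proof.
near=> n; apply: lt_le_trans (tau_ge n).
apply: (@lt_le_trans _ _ n%:R); last by rewrite ler_nat.
near: n; exact: nbhs_infty_gtr.
Unshelve. all: by end_near. Qed.

Let ray_fin y s : energy y < +oo -> (0 < s)%R -> U (s, y) \is a fin_num.
Proof.
move=> ey s0; have s1 : (s < s + 1)%R by rewrite ltrDl.
have /abse_sub_fin[] // : `|U ((s + 1)%R, y) - U (s, y)| < +oo.
exact: le_lt_trans (ray_cauchy y s0 s1) (tail_fin ey s0).
Qed.

(** Beyond height s the function stays within the tail at s of its value there,
which is a Cauchy condition. *)
Let ray_limit y : energy y < +oo -> exists c : R,
  fine (U (tau n, y)) @[n --> \oo] --> c /\
  forall s, (0 < s)%R -> `|U (s, y) - c%:E| <= tail (s, y).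
Proof.
move=> ey.
have bound s t : (0 < s)%R -> (s < t)%R ->
    (`|fine (U (t, y)) - fine (U (s, y))| <= fine (tail (s, y)))%R.
  move=> s0 st; rewrite -lee_fin fineK; last by rewrite ge0_fin_numE// tail_fin.
  rewrite -abse_EFin EFinB (fineK (ray_fin ey s0)) (fineK (ray_fin ey (lt_trans s0 st))).
  exact: ray_cauchy.
have : cvg (fine (U (tau n, y)) @[n --> \oo]).
  apply/cauchy_cvgP; apply: cauchy_exP => e e0.
  have [r r0 re] := tail_small ey e0.
  exists (fine (U (r, y))).
  suff : \forall n \near \oo, ball (fine (U (r, y))) e (fine (U (tau n, y))) by [].
  near=> n; rewrite /ball/= distrC.
  apply: le_lt_trans (bound _ _ r0 _) _; first by near: n; exact: tau_near.
  by rewrite -lte_fin fineK// ge0_fin_numE// tail_fin.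
move=> /cvg_ex[c xc]; exists c; split => // s s0.
rewrite -(fineK (ray_fin ey s0)) -EFinB abse_EFin.
rewrite -[leRHS]fineK; last by rewrite ge0_fin_numE// tail_fin.
rewrite lee_fin; apply/ler_addgt0Pr => e e0.
have [n [ns nc]] : exists n, (s < tau n)%R /\ (`|fine (U (tau n, y)) - c| < e)%R.
  apply: (@filter_ex _ \oo); near=> n; split; first by near: n; exact: tau_near.
  by rewrite distrC; near: n; move/cvgrPdist_lt : xc; exact.
rewrite (_ : _ - c = - (fine (U (tau n, y)) - fine (U (s, y))) + (fine (U (tau n, y)) - c))%R; last by ring.
apply: le_trans (ler_normD _ _) _; rewrite normrN lerD ?bound//; exact: ltW.
Unshelve. all: by end_near. Qed.

Let v n y := fine (squash (U (tau n, y))).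

Let ray_limit_squash y : energy y < +oo -> exists c : R,
  v n y @[n --> \oo] --> fine (squash c%:E) /\
  forall s, (0 < s)%R -> `|U (s, y) - c%:E| <= tail (s, y).
Proof. by move=> /ray_limit[c [xc cs]]; exists c; split => //; exact: fine_squash_cvg xc. Qed.

Hypothesis poinc : weak_local_poincare (mms_of_metric muY) p p.

(** The averages of the squashed slices differ from the slices themselves by
terms with summable p-th powers, so that the averages converge together with the
values on one good ray, and then to the same limit for all good rays. *)
Let local_limit x : exists k r : R, (0 < r)%R /\
  {ae (muY : set CY -> \bar R), forall y, (mdist x y < r)%R -> v n y @[n --> \oo] --> k}.
Proof.
have [C [r [C0 r0 Cr]]] := poinc x.
pose un n : mms_of_metric muY -> \bar R := fun y => squash (U (tau n, y)).
pose B := @mmball R (mms_of_metric muY) x r.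
pose a n := ball_average (un n) B.
pose f n (y : Y) := `|((fun y => un n y - (a n)%:E) \_ B) y| `^ p.
have mun n : measurable_fun setT (un n : CY -> \bar R) by exact: measurable_squash.
have fC n : \int[mY]_y f n y <= ((C `^ p) / (2 ^ (n + 1))%:R)%:E.
  have ugn : @upper_gradient R (mms_of_metric muY)
      (fun y => (W (tau n))%:E * g (filling_of (tau n, y))) (un n).
    have [bgn gn0 gn] := slice_upper_gradient (tau0 n) ug; split => // c s t ac nc.
    by apply: le_trans (squash_lip _ _) _; exact: gn.
  have iun : integrable_over_balls (un n).
    by refine (@bounded_integrable_balls R (mms_of_metric muY) space_ballP (un n) 1%R (mun n) _) => y; exact: squash_le1.
  have := le_poweR (ltW p0) (Lp_norm_ge0 _ _ _) (Cr _ _ iun ugn).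
  rewrite poweRM ?lee_fin ?(ltW C0) ?Lp_norm_ge0// Lp_norm_powerT// Lp_norm_poweR//.
  move=> /le_trans; apply; rewrite poweR_EFin -[(_ / _)%R]mulr1 mulrAC -mulrA EFinM.
  apply: lee_wpmul2l; first by rewrite lee_fin powR_ge0.
  apply: le_trans (tau_energy n); apply: le_integral_ge0 => y _; first exact: poweR_ge0.
  by rewrite gee0_abs// mule_ge0// lee_fin ltW// Wpos.
have mf n : measurable_fun setT (f n : CY -> \bar R).
  apply: (measurableT_comp (measurable_poweR _)); apply: measurableT_comp => //.
  apply/(measurable_restrictT _ _).1; first exact: (space_ballP x r).1.
  apply: measurable_funTS; apply: emeasurable_funB; [exact: mun|exact: measurable_cst].
have f0 n y : 0 <= f n y by exact: poweR_ge0.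
have fae := summable_ae_small mf f0 fC.
have fv n y : (mdist x y < r)%R -> f n y = (`|v n y - a n| `^ p)%:E.
  by move=> xy; rewrite /f patchE mem_set.
have va y : (mdist x y < r)%R -> f n y @[n --> \oo] --> 0 ->
    (v n y - a n)%R @[n --> \oo] --> 0%R.
  move=> xy; under eq_fun do rewrite fv//.
  move=> /fine_cvgP[_] /cvgrPdist_lt fy; apply/cvgrPdist_lt => e e0.
  have := fy (e `^ p)%R (powR_gt0 _ e0); apply: filterS => n.
  rewrite !sub0r !normrN /= ger0_norm ?powR_ge0// => vp.
  rewrite ltNge; apply/negP => ev; move: vp; apply/negP; rewrite -leNgt.
  by apply: ge0_ler_powR => //; rewrite ?nnegrE ?ltW.
have good : {ae mY, forall y, f n y @[n --> \oo] --> 0 /\ energy y < +oo}.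
  exact: (ae_imp2 fae energy_fin).
have [y1 xy1 [fy1 /ray_limit_squash[c1 [vc1 _]]]] := ae_ball_point hY x r0 good.
have ac : a n @[n --> \oo] --> fine (squash c1%:E).
  rewrite (_ : a = (fun n => v n y1 - (v n y1 - a n))%R); last by apply/funext => n; ring.
  by rewrite -[fine _]subr0; apply: cvgB => //; exact: va.
exists (fine (squash c1%:E)), r; split => //.
apply: (ae_imp good) => y [fy _] xy.
rewrite (_ : (fun n => v n y) = (fun n => (v n y - a n) + a n)%R); last by apply/funext => n; ring.
by rewrite -[fine _]add0r; apply: cvgD => //; exact: va.
Qed.

(** The limits of the squashed values agree on almost all rays, and squashing is
injective on real numbers. *)
Let ray_constant : exists c : R, {ae mY, forall y, forall s, (0 < s)%R ->
  `|U (s, y) - c%:E| <= tail (s, y)}.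
Proof.
have [k vk] := ae_limit_constant hY lenY local_limit.
have good : {ae mY, forall y, v n y @[n --> \oo] --> k /\ energy y < +oo}.
  exact: (ae_imp2 vk energy_fin).
have [y1 _ [vy1 /ray_limit_squash[c [vc _]]]] := ae_ball_point hY point ltr01 good.
exists c; apply: (ae_imp good) => y [vy /ray_limit_squash[c' [vc' cs]]].
suff -> : c = c' by [].
apply: squash_inj.
have -> : squash c%:E = (fine (squash c%:E))%:E by [].
rewrite -(cvg_unique _ vy1 vc); last exact: Rhausdorff.
by rewrite (cvg_unique _ vy vc')//; exact: Rhausdorff.
Qed.

Lemma sobolev_poincare_heights : exists c : R,
  mm_integral setT (fun h => `|u h - c%:E| `^ p) <=
  (b `^ (- p))%:E * mm_integral setT (fun h => g h `^ p).
Proof.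
have [c [A [mA A0 cA]]] := ray_constant; exists c.
have muc : measurable_on setT (fun h => `|u h - c%:E| `^ p).
  apply: (measurableT_comp (measurable_poweR _)).
  apply: (@measurableT_comp _ _ _ CH _ _ abse); first exact: abse_measurable.
  apply: (@emeasurable_funB _ CH R setT u (cst c%:E)); first exact: mu_u.
  exact: measurable_cst.
rewrite (integral_filling muc); last by move=> h; exact: poweR_ge0.
apply: le_trans hardy_filling.
have mtp : measurable_fun setT ((fun z => tail (sval z.1, z.2) `^ p) : (CX * CY)%type -> \bar R).
  apply: (measurableT_comp (measurable_poweR _)).
  exact: (measurableT_comp mtail measurable_sval_pair).
rewrite -(integral_product_outer halfline_sf space_sf mtp); last by move=> z; exact: poweR_ge0.
apply: (@ae_le_integral_ge0 _ CP R pi setT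
  (fun z => `|u (filling_pt z) - c%:E| `^ p) (fun z => tail (sval z.1, z.2) `^ p)).
- exact: measurableT.
- exact: (measurableT_comp muc measurable_filling_pt_caratheodory).
- by move=> z _; exact: poweR_ge0.
- by move=> z _; exact: poweR_ge0.
pose E := ([set halfline_of 0] `*` setT) `|` (setT `*` A) : set (halfline R * Y).
have E0 : pi E = 0.
  apply/eqP; rewrite eq_le outer_measure_ge0 andbT.
  apply: le_trans (outer_measureU2 _ _ _) _.
  by rewrite product_outer_set0X ?weighted_om1// product_outer_setX0// adde0.
exists E; split => //; first exact: caratheodory_null.
move=> [x y] /= nz; apply: contrapT => nE; apply: nz => _.
apply: le_poweR; [exact: ltW p0|exact: abse_ge0|].
rewrite filling_ofE /=.
have [Ay|nAy] := pselect (A y); first by case: nE; right.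
have x0 : (0 < sval x)%R.
  rewrite lt_neqAle (halfline_ge0 x) andbT; apply/eqP => x0; apply: nE; left.
  by split => //=; rewrite x0 halfline_ofK.
by apply: contrapT => ny; apply: nAy; apply: cA => /= /(_ (sval x) x0).
Qed.

End heights.

Lemma sobolev_poincare_integral : weak_local_poincare (mms_of_metric muY) p p ->
  exists c : R, mm_integral setT (fun h => `|u h - c%:E| `^ p) <=
    (b `^ (- p))%:E * mm_integral setT (fun h => g h `^ p).
Proof.
move=> poinc.
have e0 n : (0 < 1 / (2 ^ (n + 1))%:R :> R)%R by rewrite divr_gt0// ltr0n expn_gt0.
have /choice[tau tauP] n := good_height n (e0 n).
apply: (@sobolev_poincare_heights tau) => // n; by have [] := tauP n.
Qed.

End oscillation.

(** With b = beta / p the constant of Hardy's inequality is p / beta. *)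
Lemma filling_sobolev_poincare (p b beta : R) : 1 <= p -> 0 < b -> beta = p * b ->
  (forall t s : R, 0 <= t -> t <= s -> w t <= expR (- (beta * (s - t))) * w s) ->
  (forall t, 0 < t -> 0 < w t) ->
  (exists T0 : R, forall t, T0 <= t -> W t `^ p <= w t) ->
  weak_local_poincare (mms_of_metric muY) p p ->
  sobolev_poincare filling p p b^-1.
Proof.
move=> p1 b0 bb wg wp Ww poinc u g [mu_u _ _] ug gp.
have p0 : 0 < p by exact: lt_le_trans p1.
have g0 h : (0 <= g h)%E by case: ug => _ + _; exact.
have gE : mm_integral setT (fun h => `|g h| `^ p)%E = mm_integral setT (fun h => g h `^ p)%E.
  by congr mm_integral; apply/funext => h; rewrite gee0_abs.
have gp' : (mm_integral setT (fun h => g h `^ p) < +oo)%E.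
  by rewrite -gE; apply/Lp_norm_lty.
have [c uc] := sobolev_poincare_integral p1 b0 bb wg wp Ww mu_u ug gp' poinc.
exists c; apply: Lp_norm_le => //; first by rewrite invr_ge0 ltW.
by rewrite gE -(powR_inv1 (ltW b0)) -powRrM mulN1r.
Qed.

Lemma filling_dirichlet (p b beta : R) : 1 <= p -> 0 < b -> beta = p * b ->
  (forall t s : R, 0 <= t -> t <= s -> w t <= expR (- (beta * (s - t))) * w s) ->
  (forall t, 0 < t -> 0 < w t) ->
  (exists T0 : R, forall t, T0 <= t -> W t `^ p <= w t) ->
  weak_local_poincare (mms_of_metric muY) p p ->
  dirichlet_space filling p = newtonian_plus_constants filling p.
Proof.
move=> p1 b0 bb wg wp Ww poinc.
apply: (sobolev_poincare_newtonian filling_ballP (lt_le_trans ltr01 p1)).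
exact: (filling_sobolev_poincare p1 b0 bb wg wp Ww poinc).
Qed.

(** * A function that is not Newtonian up to constants *)

Lemma lipschitz_borel (F : filling -> R) (L : R) : 0 < L ->
  (forall h h', `|F h - F h'| <= L * dH h h') ->
  measurable_fun setT (F : BH -> RB).
Proof.
move=> L0 FL; apply: (measurability _ (RGenOInfty.measurableE R)).
move=> _ [_ [a ->] <-]; rewrite setTI; apply: sub_sigma_algebra => h /=.
rewrite in_itv/= andbT => ah; exists ((F h - a) / L); first by rewrite divr_gt0// subr_gt0.
move=> h'; rewrite /mmball/= ltr_pdivlMr// mulrC in_itv/= andbT => hh'.
have := FL h h'; rewrite ler_norml => /andP[_]; move: hh'.
set d := L * _; lra.
Qed.

Definition height (h : filling) : R := sval (filling_repr h).1.

Lemma height_pt z : height (filling_pt z) = sval z.1.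
Proof.
have := filling_height_lip (filling_repr (filling_pt z)) z.
rewrite filling_reprK; have [-> _ _] := filling_dist_pseudometric.
by rewrite normr_le0 subr_eq0 => /eqP.
Qed.

Lemma height_lip h h' : `|height h - height h'| <= 1 * dH h h'.
Proof.
rewrite mul1r -{2}(filling_reprK h) -{2}(filling_reprK h'); exact: filling_height_lip.
Qed.

Section nonconstant_trace.
Variables (alpha beta p kappa : R).
Hypotheses (alpha0 : 0 < alpha) (p1 : 1 <= p) (kappa0 : 0 < kappa).
Hypothesis bap : beta < alpha * p.
Hypothesis Wexp : forall t, 2^-1 <= t -> kappa * expR (alpha * t) <= W t.
Hypothesis wexp : forall t, 0 <= t -> w t <= expR (beta * t).
Hypothesis wlow : exists2 m, 0 < m & forall t, 1 <= t -> m <= w t.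
Variables (y0 y1 : Y).
Hypothesis y01 : y0 <> y1.

Let p0 : 0 < p. Proof. exact: lt_le_trans p1. Qed.

(** A cutoff that vanishes up to height 1 and equals 1 from height 2 on. *)
Let eta (t : R) := Num.min 1 (Num.max 0 (t - 1)).
Let f (y : Y) := Num.min 1 (mdist y0 y).
Let bump (z : halfline R * Y) := eta (sval z.1) * f z.2.

Let eta01 t : 0 <= eta t <= 1.
Proof. by rewrite /eta le_min ler01 le_max lexx/= ge_min lexx. Qed.

Let f01 y : 0 <= f y <= 1.
Proof. by rewrite /f le_min ler01 mdist_ge0/= ge_min lexx. Qed.

Let eta_lip t t' : `|eta t - eta t'| <= `|t - t'|.
Proof.
have := ler_norm (t - t'); have := ler_norm (t' - t); rewrite [`|t' - t|]distrC.
rewrite ler_norml /eta /Order.max /Order.min; do !case: ifPn; rewrite -?leNgt; lra.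
Qed.

Let min1_lip (a b d : R) : a <= b + d -> b <= a + d -> 0 <= d ->
  `|Num.min 1 a - Num.min 1 b| <= d.
Proof.
rewrite ler_norml /Order.min; do !case: ifPn; rewrite -?leNgt; lra.
Qed.

Let f_lip y y' : `|f y - f y'| <= mdist y y'.
Proof.
apply: min1_lip; rewrite ?mdist_ge0//.
  by rewrite (metric_sym y y') metric_triangle.
exact: metric_triangle.
Qed.

Let eta0 t : t <= 1 -> eta t = 0.
Proof. by rewrite /eta /Order.max /Order.min; do !case: ifPn; rewrite -?leNgt; lra. Qed.

Let eta1 t : 2 <= t -> eta t = 1.
Proof. by rewrite /eta /Order.max /Order.min; do !case: ifPn; rewrite -?leNgt; lra. Qed.

(* K1 e^{- alpha t} is at least 1 up to height 5/2, and beyond it the cutoff is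
   constant on intervals of radius 1/4; K2 comes from the lower bound for W at
   height t - 1/4 *)
Let K1 := expR (3 * alpha).
Let K2 := kappa^-1 * expR (alpha / 4).
Let K := K1 + K2.

Let K10 : 0 < K1. Proof. exact: expR_gt0. Qed.
Let K20 : 0 < K2. Proof. by rewrite mulr_gt0 ?invr_gt0 ?expR_gt0. Qed.
Let K0 : 0 < K. Proof. exact: addr_gt0. Qed.

Let bump01 z : 0 <= bump z <= 1.
Proof.
have /andP[a0 a1] := eta01 (sval z.1); have /andP[b0 b1] := f01 z.2.
by rewrite /bump mulr_ge0//= mulr_ile1.
Qed.

(** Far from the root, a displacement d for the warped distance moves the
second coordinate by at most a multiple of d e^{- alpha t}. *)
Let bump_local z z' : wd z z' < 4^-1 ->
  `|bump z - bump z'| <= K * expR (- (alpha * sval z.1)) * wd z z'.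
Proof.
move=> d4; set d := wd z z' in d4 *; set t := sval z.1.
have d0 : 0 <= d by exact: pseudometric_ge0 wdP.
have td : `|t - sval z'.1| <= d by exact: warped_pdist_ge1.
set t' := sval z'.1 in td *.
set E := expR _; have E0 : 0 < E by exact: expR_gt0.
have [td1 td2] : t - t' <= d /\ t' - t <= d by move: td; rewrite ler_norml; lra.
have step1 : `|eta t - eta t'| <= K1 * E * d.
  have [t52|t52] := leP (5 / 2) t.
    rewrite (eta1 (_ : 2 <= t)); last by lra.
    rewrite (eta1 (_ : 2 <= t')); last by lra.
    by rewrite subrr normr0; apply: mulr_ge0 => //; apply: mulr_ge0; exact: ltW.
  apply: le_trans (eta_lip _ _) _; apply: le_trans td _; apply: ler_peMl => //.
  rewrite -[leLHS]expR0 -expRD ler_expR -mulrN mulrC -mulrDr mulr_ge0 ?(ltW alpha0)//.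
  by lra.
have step2 : eta t' * `|f z.2 - f z'.2| <= K2 * E * d.
  have [t1|t1] := leP t' 1; first by rewrite eta0// mul0r; apply: mulr_ge0 => //; apply: mulr_ge0; exact: ltW.
  have /andP[e0 e1] := eta01 t'.
  apply: (@le_trans _ _ (mdist z.2 z'.2)).
    by rewrite -[leRHS]mul1r ler_pM.
  pose m := kappa * expR (alpha * (t - 4^-1)).
  have m0 : 0 < m by apply: mulr_gt0 => //; exact: expR_gt0.
  have := @warped_pdist_ge2 R N Y W hN W0 lenY z z' 4^-1 m (ltW m0).
  rewrite -/d -/t ge_min leNgt d4 /= => md.
  have {}md : m * mdist z.2 z'.2 <= d.
    apply: md => x x0; rewrite ltr_norml => /andP[tx1 tx2].
    apply: le_trans (Wexp _); last by lra.
    by rewrite ler_pM2l// ler_expR ler_pM2l//; lra.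
  rewrite -(ler_pM2l m0); apply: le_trans md _.
  have -> : m * (K2 * E * d) = (kappa * kappa^-1) *
      (expR (alpha * (t - 4^-1)) * expR (alpha / 4) * E) * d.
    by rewrite /m /K2; ring.
  rewrite divff ?gt_eqF// mul1r -!expRD.
  rewrite (_ : _ + _ - _ = 0) ?expR0 ?mul1r//; ring.
have -> : bump z - bump z' = (eta t - eta t') * f z.2 + eta t' * (f z.2 - f z'.2).
  by rewrite /bump -/t -/t'; ring.
apply: le_trans (ler_normD _ _) _; rewrite !normrM.
have /andP[e0 e1] := eta01 t'; have /andP[f0 f1] := f01 z.2.
rewrite (ger0_norm e0) (ger0_norm f0) /K !mulrDl; apply: lerD => //.
by apply: le_trans step1; rewrite ler_piMr.
Qed.

Let bump_lip z z' : `|bump z - bump z'| <= (K + 4) * wd z z'.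
Proof.
have d0 : 0 <= wd z z' by exact: pseudometric_ge0 wdP.
have [d4|d4] := ltP (wd z z') 4^-1.
  apply: le_trans (bump_local d4) _; apply: ler_wpM2r => //.
  rewrite -[leLHS]addr0 lerD// ger_pMr// -expR0 ler_expR oppr_le0 mulr_ge0 ?(ltW alpha0)//.
  exact: halfline_ge0.
apply: (@le_trans _ _ 1).
  by have := bump01 z; have := bump01 z'; rewrite ler_norml; lra.
have : K * 4^-1 <= K * wd z z' by rewrite ler_pM2l.
by have := K0; lra.
Qed.

Let u (h : filling) : \bar R := (bump (filling_repr h))%:E.
Let g (h : filling) : \bar R := (K * expR (- (alpha * height h)))%:E.

Let u_pt z : u (filling_pt z) = (bump z)%:E.
Proof.
congr EFin; apply/eqP; rewrite -subr_eq0 -normr_le0.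
apply: le_trans (bump_lip _ _) _; rewrite -filling_dist filling_reprK.
by have [-> _ _] := filling_dist_pseudometric; rewrite mulr0.
Qed.

Let g_pt z : g (filling_pt z) = (K * expR (- (alpha * sval z.1)))%:E.
Proof. by rewrite /g height_pt. Qed.

Let u_lip h h' : `|bump (filling_repr h) - bump (filling_repr h')| <= (K + 4) * dH h h'.
Proof. exact: bump_lip. Qed.

Let K4 : 0 < K + 4. Proof. by rewrite addr_gt0. Qed.

Let u_borel : borel_function u.
Proof. by apply/measurable_EFinP; exact: lipschitz_borel K4 u_lip. Qed.

Let g_borel : borel_function g.
Proof.
have mh := lipschitz_borel ltr01 height_lip.
apply/measurable_EFinP; apply: measurable_funM; first exact: measurable_cst.
apply: measurableT_comp => //; apply: measurable_funN.
by apply: measurable_funM => //; exact: measurable_cst.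
Qed.

(** The distance estimate bounds the speed of the real function along a path by
g times the speed of the path. *)
Let u_gradient : upper_gradient g u.
Proof.
split => //; first by move=> h; rewrite lee_fin mulr_ge0 ?expR_ge0// ltW.
move=> c a b ac _.
have [ab [F Fac Fdom]] := ac_path_dominated filling_dist_pseudometric ac.
pose phi s := bump (filling_repr (c s)).
have phidom : dominated (fun x y : R => `|y - x|) phi (fun s => (K + 4) * F s) a b.
  move=> s t as_ st tb; rewrite -mulrBr distrC.
  apply: le_trans (u_lip _ _) _; rewrite ler_pM2l//; exact: Fdom.
have := @dist_le_integral _ _ _ _ _ _ _ real_pseudometric ab
  (acont_scale (K + 4) Fac) phidom
  (fun s => g (c s) * (metric_speed dH c s)%:E)%E.
move=> H; apply: H.
  move=> s _; rewrite -EFinM lee_fin !mulr_ge0 ?expR_ge0 ?(ltW K0)//.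
  exact: metric_speed_ge0 filling_dist_pseudometric.
apply: (ae_imp (speed_at_ae filling_dist_pseudometric ab Fac Fdom)).
move=> s sp sab l sl; have [lH slH] := sp sab.
rewrite (metric_speedE slH) -EFinM lee_fin.
set k := K * _; have k0 : 0 < k by apply: mulr_gt0 => //; exact: expR_gt0.
apply/ler_addgt0Pr => e e0.
have [d d0 dlH] := slH _ (divr_gt0 e0 k0).
have lH0 : 0 <= lH.
  by rewrite -(metric_speedE slH); exact: metric_speed_ge0 filling_dist_pseudometric.
pose q := lH + e / k; have q0 : 0 < q by rewrite ltr_wpDl// divr_gt0.
apply: (speed_at_le _ sl).
exists (Num.min d (4^-1 / q)); first by rewrite lt_min d0 divr_gt0.
move=> v v0; rewrite lt_min => /andP[vd vq].
have dq : dH (c v) (c s) <= q * `|v - s|.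
  have := dlH v v0 vd; rewrite ltr_norml => /andP[_].
  by rewrite ltrBlDr ltr_pdivrMr// [e / k + lH]addrC => /ltW.
have d4 : dH (c v) (c s) < 4^-1.
  by apply: le_lt_trans dq _; rewrite mulrC -ltr_pdivlMr.
have [_ dC _] := filling_dist_pseudometric.
rewrite dC in d4 dq.
apply: (@le_trans _ _ (k * dH (c s) (c v))).
  exact: (@bump_local (filling_repr (c s)) (filling_repr (c v)) d4).
have -> : k * lH + e = k * q by rewrite /q mulrDr [k * (e / k)]mulrC divfK// gt_eqF.
by rewrite -[leRHS]mulrA; exact: (ler_wpM2l (ltW k0) dq).
Qed.

Let gp_fin : (mm_integral setT (fun h => `|g h| `^ p) < +oo)%E.
Proof.
have gpb : borel_function (fun h => `|g h| `^ p)%E.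
  apply: (measurableT_comp (measurable_poweR _)).
  exact: measurableT_comp (@abse_measurable _ _) g_borel.
rewrite integral_filling_borel//; last by move=> h; exact: poweR_ge0.
pose k (q : R * Y) := ((K * expR (- (alpha * q.1))) `^ p)%:E.
have mk : measurable_fun setT (k : (RB * CY)%type -> \bar R).
  apply/measurable_EFinP; apply: (measurableT_comp (measurable_powR _)).
  apply: measurable_funM; first exact: measurable_cst.
  apply: measurableT_comp => //; apply: measurable_funN.
  by apply: measurable_funM; [exact: measurable_cst|exact: measurable_fst].
have k0 q : (0 <= k q)%E by rewrite lee_fin powR_ge0.
have -> : (\int[mX \x mY]_z `|g (filling_pt z)| `^ p)%E =
    (\int[mX \x mY]_z k (sval z.1, z.2))%E.
  apply: eq_integral => z _; rewrite g_pt /k /= ger0_norm ?poweR_EFin//.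
  by rewrite mulr_ge0 ?expR_ge0 ?ltW.
rewrite (filling_tonelli_ray mk k0).
apply: (@le_lt_trans _ _ (\int[mY]_y ((K `^ p)%:E * ((alpha * p - beta)^-1)%:E))%E).
  have ab0 : 0 < alpha * p - beta by rewrite subr_gt0.
  apply: le_integral_ge0 => y _.
    by apply: integral_ge0 => t _; apply: mule_ge0; [exact: k0|rewrite lee_fin].
  rewrite -(integral_expR0y ab0) -ge0_integralZl//; last 2 first.
  - apply: measurable_funTS; apply/measurable_EFinP; apply: measurableT_comp => //.
    by apply: measurable_funN; apply: measurable_funM.
  - by rewrite lee_fin powR_ge0.
  apply: le_integral_ge0 => t; first by move=> _; apply: mule_ge0; [exact: k0|rewrite lee_fin].
  rewrite /= in_itv/= andbT => t0; rewrite /k /= -!EFinM lee_fin.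
  rewrite powRM ?expR_ge0 ?(ltW K0)// -mulrA; apply: ler_wpM2l; first exact: powR_ge0.
  apply: le_trans (ler_wpM2l (powR_ge0 _ _) (wexp t0)) _.
  by rewrite -expRM -expRD ler_expR; lra.
rewrite integral_cst//=; apply: lte_mul_pinfty => //.
by rewrite lee_fin mulr_ge0 ?powR_ge0// invr_ge0 subr_ge0 ltW.
Qed.

Let u_dirichlet : dirichlet_space filling p u.
Proof.
split.
- exact: measurable_borel.
- refine (@bounded_integrable_balls R filling filling_ballP u 1 (measurable_borel u_borel) _).
  by move=> h; have /andP[b0 b1] := bump01 (filling_repr h); rewrite lee_fin ger0_norm.
- by exists g => //; apply/Lp_norm_lty.
Qed.

(** A continuous function that is not constant stays away from any given
constant on some ball. *)
Let away (c : R) : exists y r e, [/\ 0 < r, 0 < e &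
  forall y', mdist y y' < r -> e <= `|f y' - c|].
Proof.
have fy0 : f y0 = 0 by rewrite /f mdistxx min_r// ler01.
have a0 : 0 < f y1.
  rewrite /f lt_min ltr01 lt_neqAle mdist_ge0 andbT eq_sym.
  by apply/eqP => /mdist_positivity.
set a := f y1 in a0.
have a4 : 0 < a / 4 by rewrite divr_gt0.
have [ca|ca] := leP (a / 2) `|c|.
  exists y0, (a / 4), (a / 4); split => // y' yy'.
  have := f_lip y' y0; rewrite fy0 subr0 metric_sym => fy'.
  have := ler_distD (f y') c 0; rewrite !subr0 (distrC c) => H.
  by move: yy' H fy' ca; lra.
exists y1, (a / 4), (a / 4); split => // y' yy'.
have := f_lip y1 y'; have := ler_norm (f y1 - f y'); have := ler_norm (f y' - c).
have := ler_norm c; rewrite -/a; move: yy' ca; lra.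
Qed.

(** Above a ball where the trace at infinity stays away from c, the difference
of the function and c does not decay, while the half-line has infinite measure. *)
Lemma filling_not_newtonian :
  dirichlet_space filling p <> newtonian_plus_constants filling p.
Proof.
move=> E; have := u_dirichlet; rewrite E => -[v [c [[[mv _ _] vp] uE]]].
have vE h : v h = (u h - c%:E)%E by rewrite uE addeK.
have [y [r [e [r0 e0 fe]]]] := away c.
pose T : set (halfline R) := sval @^-1` [set` `[2, +oo[].
have svT : sval @` T = `[2, +oo[%classic.
  rewrite sval_preimage; apply/seteqP; split => t /=; rewrite !in_itv/= !andbT.
    by case.
  by move=> t2; split => //; exact: le_trans t2.
have mT : measurable (sval @` T : set RB) by rewrite svT; exact: measurable_itv.
have cT : (weighted_om w).-caratheodory T by exact: halfline_caratheodory.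
pose B : set Y := [set y' | mdist y y' < r].
have cB : muY.-caratheodory B by exact: (mdist_ball_caratheodory hY).
have muB : (0 < muY B)%E.
  have [_ _ _ /(_ y r r0)/andP[+ _]] := hY.
  by rewrite ballEmdist.
have muT : weighted_om w T = +oo%E.
  have [m m0 mw1] := wlow.
  apply/eqP; rewrite -leye_eq weighted_outerE// svT.
  apply: (@le_trans _ _ (\int[mu]_(t in `[2%R, +oo[) m%:E)%E).
    rewrite integral_cst//= lebesgue_measure_itv/= ltry.
    by rewrite addye// gt0_muley ?lte_fin ?leey.
  apply: le_integral_ge0 => t; first by rewrite lee_fin ltW.
  rewrite /= in_itv/= andbT => t2; rewrite lee_fin; apply: mw1; lra.
move: vp; rewrite integral_filling; last 2 first.
- apply: (measurableT_comp (measurable_poweR _)).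
  exact: measurableT_comp (@abse_measurable _ _) mv.
- by move=> h; exact: poweR_ge0.
apply/negP; rewrite -leNgt.
apply: (@le_trans _ _ (\int[(pi : set CP -> \bar R)]_(z in T `*` B) (e `^ p)%:E)%E).
  rewrite integral_cst; last exact: product_outer_rect_caratheodory.
  rewrite [X in (_ * X)%E](_ : _ = (weighted_om w T * muY B)%E); last first.
    exact: (product_outer_rect halfline_sf space_sf).
  by rewrite muT gt0_mulye// gt0_muley ?lte_fin ?powR_gt0.
apply: (@le_trans _ _ (\int[(pi : set CP -> \bar R)]_(z in T `*` B)
    (`|v (filling_pt z)| `^ p)%E)%E).
  apply: le_integral_ge0 => z; first by rewrite lee_fin powR_ge0.
  move=> [Tz Bz]; rewrite vE u_pt /bump eta1 ?mul1r; last first.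
    by move: Tz; rewrite /T/= in_itv/= andbT.
  rewrite -EFinB /= lee_fin.
  apply: ge0_ler_powR; rewrite ?nnegrE ?(ltW p0) ?(ltW e0)//.
  exact: fe.
by apply: integral_subset_ge0 => // z _; exact: poweR_ge0.
Qed.

End nonconstant_trace.

End filling.

(** * Exponential and hyperbolic profiles *)

(** What the two solid fillings have in common, in terms of the warping
function W and of the density w: both grow like an exponential. *)
Record exponential_profile (R : realType) (alpha beta : R) (W : R -> R)
    (w : {nnfun R >-> R}) : Prop := ExponentialProfile {
  profile_ge0 : forall t, 0 <= t -> 0 <= W t ;
  profile_gt0 : forall t, 0 < t -> 0 < W t ;
  profile_mono : forall s t, 0 <= s -> s <= t -> W s <= W t ;
  profile_lsc : forall t e, 0 < t -> 0 < e ->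
    exists2 d, 0 < d & forall x, 0 <= x -> `|t - x| < d -> W t - e <= W x ;
  profile_lower : exists2 k, 0 < k &
    forall t, 2^-1 <= t -> k * expR (alpha * t) <= W t ;
  profile_measurable : measurable_fun setT (w : R -> R) ;
  profile_density_gt0 : forall t, 0 < t -> 0 < w t ;
  profile_density_le : forall t, 0 <= t -> w t <= expR (beta * t) ;
  profile_density_lower : exists2 m, 0 < m & forall t, 1 <= t -> m <= w t ;
  profile_growth : forall t s, 0 <= t -> t <= s -> w t <= expR (- (beta * (s - t))) * w s ;
  profile_power : forall p, 0 < p -> alpha * p <= beta ->
    exists T0 : R, forall t, T0 <= t -> W t `^ p <= w t }.

Section profiles.
Context {R : realType}.
Local Notation mu := (@lebesgue_measure R).
Implicit Types (alpha beta : R).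

Lemma profile_locally_finite alpha beta W w : 0 < beta ->
  @exponential_profile R alpha beta W w ->
  forall n : nat, (\int[mu]_(t in `[0%R, n%:R]) (w t)%:E < +oo)%E.
Proof.
move=> beta0 wW n.
apply: (@le_lt_trans _ _ (\int[mu]_(t in `[0%R, n%:R]) (expR (beta * n%:R))%:E)%E).
  apply: le_integral_ge0 => t; first by rewrite lee_fin.
  rewrite /= in_itv/= => /andP[t0 tn]; rewrite lee_fin.
  by apply: le_trans (profile_density_le wW t0) _; rewrite ler_expR ler_pM2l.
rewrite integral_cst//= lebesgue_measure_itv/=.
by case: ifPn => _; rewrite -?EFinB -?EFinM ?mule0 ltry.
Qed.

Lemma continuous_lsc (h : R -> R) (t e : R) : {for t, continuous h} -> 0 < e ->
  exists2 d, 0 < d & forall x, `|t - x| < d -> h t - e <= h x.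
Proof.
move=> /cvgrPdist_lt ch e0; have /nbhs_ballP[d d0 hd] := ch _ e0.
exists d => // x tx; have := hd x tx; rewrite /= ltr_norml; lra.
Qed.

Lemma exp_profile alpha beta : 0 < alpha -> 0 < beta ->
  exponential_profile alpha beta (exp_weight alpha) (exp_weight beta).
Proof.
move=> alpha0 beta0; rewrite /exp_weight; split.
- by move=> t _; exact: expR_ge0.
- by move=> t _; exact: expR_gt0.
- by move=> s t _ st; rewrite ler_expR ler_pM2l.
- move=> t e t0 e0; have [|d d0 td] := @continuous_lsc (fun t => expR (alpha * t)) t e _ e0.
    apply: (continuous_comp (f := *%R alpha) (g := expR)); first exact: mulrl_continuous.
    exact: continuous_expR.
  by exists d => // x _; exact: td.
- by exists 1 => // t _; rewrite mul1r.
- by apply: measurableT_comp => //; exact: measurable_funM.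
- by move=> t _; exact: expR_gt0.
- by [].
- by exists 1 => // t t1; rewrite -expR0 ler_expR mulr_ge0 ?(ltW beta0)// (le_trans ler01).
- by move=> t s _ _; rewrite /= -expRD ler_expR; lra.
- move=> p p0 ab; exists 0 => t t0; rewrite /= -expRM ler_expR mulrAC.
  exact: ler_wpM2r.
Qed.

Lemma sinh_le s t : s <= t -> sinh s <= sinh t :> R.
Proof.
move=> st; rewrite /sinh ler_pM2r ?invr_gt0// lerB ?ler_expR//.
by rewrite lerN2.
Qed.

Lemma sinh0 : sinh 0 = 0 :> R. Proof. by rewrite /sinh oppr0 subrr mul0r. Qed.

Lemma sinh_ge0 t : 0 <= t -> 0 <= sinh t :> R.
Proof. by move=> t0; rewrite -sinh0 sinh_le. Qed.

Lemma sinh_gt0 t : 0 < t -> 0 < sinh t :> R.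
Proof.
by move=> t0; rewrite divr_gt0// subr_gt0 ltr_expR; lra.
Qed.

(** This says that e^{- t} sinh t is nondecreasing. *)
Lemma sinh_growth (t s : R) : t <= s -> sinh t <= expR (- (s - t)) * sinh s.
Proof.
move=> ts; rewrite /sinh mulrA ler_pM2r ?invr_gt0// mulrBr -!expRD opprB subrK.
by rewrite lerB// ler_expR; lra.
Qed.

Lemma sinh_ge1 (t : R) : 2 <= t -> 1 <= sinh t.
Proof.
move=> /sinh_le; apply: le_trans; rewrite /sinh ler_pdivlMr// mul1r.
have := expR_ge1Dx (2 : R); have : expR (- 2) <= expR 0 :> R by rewrite ler_expR; lra.
by rewrite expR0; lra.
Qed.

Lemma continuous_sinh : continuous (@sinh R).
Proof.
move=> t; apply: cvgM; last exact: cvg_cst.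
apply: cvgB; first exact: continuous_expR.
apply: (@continuous_comp _ _ _ -%R expR); first exact: opp_continuous.
exact: continuous_expR.
Qed.

Lemma sinh_profile alpha beta : 0 < alpha -> 0 < beta ->
  exponential_profile alpha beta (sinh_weight alpha) (sinh_weight beta).
Proof.
move=> alpha0 beta0; rewrite /sinh_weight.
have mono (a s t : R) : 0 < a -> 0 <= s -> s <= t -> sinh s `^ a <= sinh t `^ a.
  move=> a0 s0 st; apply: ge0_ler_powR; rewrite ?nnegrE ?sinh_ge0 ?sinh_le//.
  + exact: ltW.
  + exact: le_trans st.
split.
- by move=> t _; exact: powR_ge0.
- by move=> t t0; apply: powR_gt0; exact: sinh_gt0.
- by move=> s t; exact: mono.
- move=> t e t0 e0; pose h (x : R) := expR (alpha * ln (sinh x)).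
  have hE x : 0 < x -> sinh x `^ alpha = h x.
    by move=> x0; rewrite /powR gt_eqF// sinh_gt0.
  have ch : {for t, continuous h}.
    have cl : {for t, continuous (@ln R \o @sinh R)}.
      apply: continuous_comp; first exact: continuous_sinh.
      by apply: continuous_ln; exact: sinh_gt0.
    have cm : {for t, continuous ( *%R alpha \o (@ln R \o @sinh R))}.
      by apply: continuous_comp; [exact: cl|exact: mulrl_continuous].
    by apply: (continuous_comp cm); exact: continuous_expR.
  have [d d0 td] := continuous_lsc ch e0.
  exists (Num.min d t); first by rewrite lt_min d0.
  move=> x _; rewrite lt_min => /andP[xd xt].
  have x0 : 0 < x by move: xt; rewrite ltr_norml; lra.
  by rewrite !hE//; exact: td.
- have h0 : 0 < sinh 2^-1 :> R by exact: sinh_gt0.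
  exists ((sinh 2^-1 * expR (- 2^-1)) `^ alpha).
    by apply: powR_gt0; rewrite mulr_gt0 ?expR_gt0.
  move=> t t2; have t0 : 0 <= t by lra.
  rewrite [alpha * t]mulrC expRM -powRM ?expR_ge0 ?mulr_ge0 ?(ltW h0)//.
  apply: ge0_ler_powR; rewrite ?nnegrE ?sinh_ge0 ?mulr_ge0 ?expR_ge0 ?(ltW h0)//.
    exact: ltW.
  have := ler_wpM2l (expR_ge0 (t - 2^-1)) (sinh_growth t2).
  rewrite [leRHS]mulrA -expRD subrr expR0 mul1r; apply: le_trans.
  by rewrite -[leLHS]mulrA -expRD mulrC addrC.
- apply: (measurableT_comp (measurable_powR _)).
  by apply: continuous_measurable_fun; exact: continuous_sinh.
- by move=> t t0; apply: powR_gt0; exact: sinh_gt0.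
- move=> t t0; rewrite /= mulrC expRM; apply: ge0_ler_powR.
  + exact: ltW.
  + by rewrite nnegrE sinh_ge0.
  + by rewrite nnegrE expR_ge0.
  + have := expR_gt0 t; have := expR_gt0 (- t); rewrite /sinh; lra.
- exists (sinh 1 `^ beta); first by apply: powR_gt0; exact: sinh_gt0.
  by move=> t t1; exact: mono.
- move=> t s t0 ts /=; have s0 := le_trans t0 ts.
  have g0 : 0 <= expR (- (s - t)) * sinh s by rewrite mulr_ge0 ?expR_ge0 ?sinh_ge0.
  have -> : - (beta * (s - t)) = - (s - t) * beta by ring.
  rewrite expRM -powRM ?expR_ge0 ?sinh_ge0//.
  apply: ge0_ler_powR; rewrite ?nnegrE ?sinh_ge0 ?g0 ?(ltW beta0)//.
  exact: sinh_growth.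
- move=> p p0 ab; exists 2 => t t2; rewrite /= -powRrM ler_powR//.
  exact: sinh_ge1.
Qed.

End profiles.

Section exponential_filling.
Context {R : realType} (alpha beta p : R) (N : R * R -> R) (Y : pmetricType R)
  (muY : {outer_measure set Y -> \bar R}) (W : R -> R) (w : {nnfun R >-> R}).
Hypotheses (alpha0 : 0 < alpha) (beta0 : 0 < beta) (p1 : 1 <= p).
Hypotheses (hN : warping_norm N) (hY : metric_measure_space muY).
Hypotheses (lenY : length_space (@mdist R Y)) (muYfin : (muY [set: Y] < +oo)%E).
Hypothesis wW : exponential_profile alpha beta W w.

Let p0 : 0 < p. Proof. exact: lt_le_trans p1. Qed.

Lemma exponential_filling_sobolev_poincare : p <= beta / alpha ->
  weak_local_poincare (mms_of_metric muY) p p ->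
  sobolev_poincare (filling N muY W w) p p (beta / p)^-1 /\
  dirichlet_space (filling N muY W w) p = newtonian_plus_constants (filling N muY W w) p.
Proof.
move=> pab poinc.
have b0 : 0 < beta / p by rewrite divr_gt0.
have bb : beta = p * (beta / p) by rewrite mulrC divfK// gt_eqF.
have Ww : exists T0 : R, forall t, T0 <= t -> W t `^ p <= w t.
  by apply: (profile_power wW p0); rewrite mulrC -ler_pdivlMr.
have wloc := profile_locally_finite beta0 wW.
case: wW => ? ? ? ? _ ? ? _ _ ? _.
by split; [apply: filling_sobolev_poincare|apply: filling_dirichlet]; eauto.
Qed.

Lemma exponential_filling_not_newtonian : beta / alpha < p -> (exists y y' : Y, y <> y') ->
  dirichlet_space (filling N muY W w) p <> newtonian_plus_constants (filling N muY W w) p.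
Proof.
move=> bap [y [y' yy']].
have wloc := profile_locally_finite beta0 wW.
have ab : beta < alpha * p by rewrite mulrC -ltr_pdivrMr.
case: wW => W0 Wpos Wmono _ [k k0 Wk] mw _ wle wlow _ _.
exact: (filling_not_newtonian hN hY lenY muYfin W0 Wpos Wmono mw wloc alpha0 p1 k0 ab Wk wle wlow yy').
Qed.

End exponential_filling.

Theorem theorem1p3 (R : realType) (beta p : R) (hbeta : 0 < beta) (hp : 1 <= p) :
  exists C : R, 0 < C /\
  forall (alpha : R) (N : R * R -> R) (Y : pmetricType R)
    (muY : {outer_measure set Y -> \bar R}),
  0 < alpha ->
  warping_norm N ->
  metric_measure_space muY ->
  length_space (@mdist R Y) ->
  (muY [set: Y] < +oo)%E ->
  weak_local_poincare (mms_of_metric muY) p p ->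
  let Hexp := solid_filling_exp N alpha beta muY in
  let Hsinh := solid_filling_sinh N alpha beta muY in
  (p <= beta / alpha ->
    [/\ sobolev_poincare Hexp p p C,
        sobolev_poincare Hsinh p p C,
        dirichlet_space Hexp p = newtonian_plus_constants Hexp p
      & dirichlet_space Hsinh p = newtonian_plus_constants Hsinh p]) /\
  (beta / alpha < p -> (exists y y' : Y, y <> y') ->
    dirichlet_space Hexp p <> newtonian_plus_constants Hexp p /\
    dirichlet_space Hsinh p <> newtonian_plus_constants Hsinh p).
Proof.
exists (beta / p)^-1; split; first by rewrite invr_gt0 divr_gt0// (lt_le_trans ltr01).
move=> alpha N Y muY alpha0 hN hY lenY fY poinc Hexp Hsinh.
have pe := exp_profile alpha0 hbeta; have ps := sinh_profile alpha0 hbeta.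
have -> : Hexp = filling N muY (exp_weight alpha) (exp_weight beta) by [].
have -> : Hsinh = filling N muY (sinh_weight alpha) (sinh_weight beta) by [].
split=> [pab|bap yy'].
  have [se de] := exponential_filling_sobolev_poincare alpha0 hbeta hp hN hY lenY fY pe pab poinc.
  have [ss ds] := exponential_filling_sobolev_poincare alpha0 hbeta hp hN hY lenY fY ps pab poinc.
  by split; [exact: se|exact: ss|exact: de|exact: ds].
split.
  exact: (exponential_filling_not_newtonian alpha0 hbeta hp hN hY lenY fY pe bap yy').
exact: (exponential_filling_not_newtonian alpha0 hbeta hp hN hY lenY fY ps bap yy').
Qed.
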